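(* Let $\Omega, a, b, c, g, \theta$ be as specified in the context. If $\theta\ge 0$ and $b\ge 0$, $c\le 0$ a.e. in $\Omega$, then there is a unique positive weak solution $\Psi\in H^1(\Omega)$ to the boundary value problem $$\nabla\cdot a\nabla\Psi = b\,\Psi + c\,|\Psi|^{-(1+\theta)}\Psi \ \text{ in }\Omega,\qquad \Psi = g^{\frac{2}{1+\theta}}\ \text{ on }\partial\Omega .$$
   Context: Setting: $d\in\{2,3\}$; $\Omega\subset\mathbb{R}^d$ is a bounded, simply connected domain with $C^2$ boundary. $K_0,K_1$ are positive constants. $a\in C^{0,1}(\overline\Omega)$ (a diffusion coefficient), $\sigma_{x,a}\in L^\infty(\Omega)$ and $g\in C^1(\overline\Omega)$ (only its restriction to $\partial\Omega$ is used as boundary datum) satisfy $K_0<a,\sigma_{x,a},g<K_1$. $\theta\in\mathbb{R}\setminus\{-1\}$ and $\mu\in\mathbb{R}$ are constants, $b:=-\frac{2}{1+\theta}\mu\,\sigma_{x,a}$, and $c\in L^\infty(\Omega)$ is real-valued. Positive weak solution: $\Psi\in H^1(\Omega)$ with $\Psi>0$ a.e. in $\Omega$ and trace $g^{2/(1+\theta)}$ on $\partial\Omega$ such that, for every $\phi\in H^1_0(\Omega)$, the function $(b\Psi+c\Psi^{-\theta})\phi$ is integrable and $\int_\Omega a\nabla\Psi\cdot\nabla\phi\,d\mathbf{x} = -\int_\Omega (b\Psi+c\Psi^{-\theta})\phi\,d\mathbf{x}$. (For $\Psi>0$, $|\Psi|^{-(1+\theta)}\Psi=\Psi^{-\theta}$.)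 *)

(* Defs.v *)
From HB Require Import structures.
From mathcomp Require Import all_boot all_order all_algebra.
From mathcomp Require Import all_classical all_reals all_analysis.

Set Implicit Arguments.
Unset Strict Implicit.
Unset Printing Implicit Defensive.

Import Order.TTheory GRing.Theory Num.Theory numFieldNormedType.Exports.

Local Open Scope classical_set_scope.
Local Open Scope ring_scope.

(* R^n is 'rV[R]_n. Its library norm is the max norm; every notion below that
   uses this norm (topology, boundedness, Lipschitz continuity, boundary
   charts) is the same for the Euclidean norm. *)

Section borel_rV.
Context {R : realType} {n : nat}.

Definition rV_coord (i : 'I_n) (x : 'rV[R]_n) : measurableTypeR R := x 0 i.

Definition rV_measurable : set (set 'rV[R]_n) := g_sigma_preimage rV_coord.

Let rV_measurable0 : rV_measurable set0.
Proof. exact: sigma_algebra0. Qed.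

Let rV_measurableC A : rV_measurable A -> rV_measurable (~` A).
Proof. exact: sigma_algebraC. Qed.

Let rV_measurable_bigcup (F : (set 'rV[R]_n)^nat) :
  (forall i, rV_measurable (F i)) -> rV_measurable (\bigcup_i F i).
Proof. exact: sigma_algebra_bigcup. Qed.

HB.instance Definition _ :=
  @isMeasurable.Build (measure_tuple_display default_measure_display)
    'rV[R]_n rV_measurable rV_measurable0 rV_measurableC rV_measurable_bigcup.

End borel_rV.

Section lebesgue_rV.
Context {R : realType}.

Lemma measurable_rV_coord n (i : 'I_n) :
  measurable_fun [set: 'rV[R]_n] (@rV_coord R n i).
Proof.
move=> _ Y mY; rewrite setTI; apply: sub_sigma_algebra => /=.
rewrite -bigcup_seq/=; exists i => /=; first by rewrite mem_index_enum.
by exists Y => //; rewrite setTI.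
Qed.

Lemma measurable_fun_rVP d (T : measurableType d) n (f : T -> 'rV[R]_n) :
  (forall i, measurable_fun [set: T] (@rV_coord R n i \o f)) ->
  measurable_fun [set: T] f.
Proof.
move=> mf; suff H : preimage_set_system [set: T] f rV_measurable `<=` measurable.
  by move=> _ A mA; apply: H; exists A.
rewrite /rV_measurable -g_sigma_preimage_comp.
apply: smallest_sub; first exact: sigma_algebra_measurable.
rewrite -bigcup_seq; apply: bigcup_sub => i _ A [B mB <-].
exact: mf.
Qed.

Definition rV_cons n (p : measurableTypeR R * 'rV[R]_n) : 'rV[R]_n.+1 :=
  \row_j (if unlift 0 j is Some k then p.2 0 k else p.1).

Definition rV_uncons n (x : 'rV[R]_n.+1) : measurableTypeR R * 'rV[R]_n :=
  (x 0 0, \row_k x 0 (lift 0 k)).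

Lemma rV_consK n : cancel (@rV_cons n) (@rV_uncons n).
Proof.
case=> t y; rewrite /rV_uncons /rV_cons; congr pair.
  by rewrite mxE unlift_none.
by apply/rowP => k; rewrite !mxE liftK.
Qed.

Lemma measurable_rV_cons n : measurable_fun setT (@rV_cons n).
Proof.
apply: measurable_fun_rVP => j; case: (unliftP 0 j) => [k|] ->.
  rewrite (_ : _ \o _ = @rV_coord R n k \o snd).
    exact: measurableT_comp (measurable_rV_coord k) measurable_snd.
  by apply/funext => p /=; rewrite /rV_coord/= mxE liftK.
rewrite (_ : _ \o _ = fst); first exact: measurable_fst.
by apply/funext => p /=; rewrite /rV_coord/= mxE unlift_none.
Qed.

Lemma measurable_rV_uncons n : measurable_fun setT (@rV_uncons n).
Proof.
apply: measurable_fun_pair; first exact: (measurable_rV_coord 0).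
apply: measurable_fun_rVP => k.
rewrite (_ : _ \o _ = @rV_coord R n.+1 (lift 0 k)).
  exact: measurable_rV_coord.
by apply/funext => x; rewrite /rV_coord/= mxE.
Qed.

Section step.
Context n (mu : {sigma_finite_measure set 'rV[R]_n -> \bar R}).

Let prod : {measure set (measurableTypeR R * 'rV[R]_n)%type -> \bar R} :=
  (@lebesgue_measure R \x mu)%E.

Definition lebesgue_rV_step : set 'rV[R]_n.+1 -> \bar R :=
  pushforward prod (@rV_cons n).

Let step0 : lebesgue_rV_step set0 = 0%E.
Proof. by rewrite /lebesgue_rV_step /pushforward preimage_set0 measure0. Qed.

Let step_ge0 A : (0 <= lebesgue_rV_step A)%E.
Proof. by rewrite /lebesgue_rV_step /pushforward measure_ge0. Qed.

Let step_sigma_additive : semi_sigma_additive lebesgue_rV_step.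
Proof.
move=> F mF tF mUF; rewrite /lebesgue_rV_step /pushforward preimage_bigcup.
apply: measure_semi_sigma_additive.
- by move=> k; rewrite -[X in measurable X]setTI; exact: measurable_rV_cons.
- apply/trivIsetP => /= i j _ _ ij; rewrite -preimage_setI.
  by move/trivIsetP : tF => /(_ _ _ _ _ ij) ->//; rewrite preimage_set0.
- by rewrite -preimage_bigcup -[X in measurable X]setTI;
    exact: measurable_rV_cons.
Qed.

HB.instance Definition _ :=
  isMeasure.Build _ _ _ lebesgue_rV_step step0 step_ge0 step_sigma_additive.

Let sigma_finite_step : sigma_finite setT lebesgue_rV_step.
Proof.
have /sigma_finiteP[F [FT ndF Ffin]] :
  sigma_finite setT (@lebesgue_measure R) := sigma_finiteT _.
have /sigma_finiteP[G [GT ndG Gfin]] := sigma_finiteT mu.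
exists (fun i => @rV_uncons n @^-1` (F i `*` G i)).
  rewrite -preimage_bigcup -[LHS](preimage_setT (@rV_uncons n)); congr preimage.
  rewrite -setXTT FT GT predeqE => -[x y]; split.
    move=> [/= [i _ Fix] [k _ Gky]]; exists (maxn i k) => //; split.
    - by move: x Fix; exact/subsetPset/ndF/leq_maxl.
    - by move: y Gky; exact/subsetPset/ndG/leq_maxr.
  by move=> [i _ []/= ? ?]; split; exists i.
move=> i; have [mF Fi] := Ffin i; have [mG Gi] := Gfin i; split.
  by rewrite -[X in measurable X]setTI; apply: measurable_rV_uncons => //;
    exact: measurableX.
rewrite /lebesgue_rV_step /pushforward.
rewrite (_ : _ @^-1` _ = F i `*` G i); last first.
  by apply/funext => p; rewrite /preimage/mkset rV_consK.
by rewrite /prod/= product_measure1E// lte_mul_pinfty// ge0_fin_numE.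
Qed.

HB.instance Definition _ :=
  Measure_isSigmaFinite.Build _ _ _ lebesgue_rV_step sigma_finite_step.

End step.

Fixpoint leb n : {sigma_finite_measure set 'rV[R]_n -> \bar R} :=
  match n return {sigma_finite_measure set 'rV[R]_n -> \bar R} with
  | 0%N => @dirac _ 'rV[R]_0 0 R
  | m.+1 => lebesgue_rV_step (leb m)
  end.

End lebesgue_rV.

Section domains.
Context {R : realType} {d : nat}.
Implicit Types (Omega : set 'rV[R]_d) (x y : 'rV[R]_d).

Definition path_connected Omega :=
  forall x y, Omega x -> Omega y ->
  exists p : R -> 'rV[R]_d,
    [/\ {within `[0, 1], continuous p}, p 0 = x, p 1 = y &
        forall t, t \in `[0, 1] -> Omega (p t)].

Definition null_homotopic_loops Omega :=
  forall p : R -> 'rV[R]_d,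
    {within `[0, 1], continuous p} -> p 0 = p 1 ->
    (forall t, t \in `[0, 1] -> Omega (p t)) ->
  exists H : R * R -> 'rV[R]_d,
    [/\ {within `[0, 1] `*` `[0, 1], continuous H},
        forall s t, s \in `[0, 1] -> t \in `[0, 1] -> Omega (H (s, t)),
        forall t, t \in `[0, 1] -> H (0, t) = p t /\ H (1, t) = p 0 &
        forall s, s \in `[0, 1] -> H (s, 0) = p 0 /\ H (s, 1) = p 0].

Definition simply_connected Omega :=
  path_connected Omega /\ null_homotopic_loops Omega.

Definition domain Omega := [/\ open Omega, connected Omega & Omega !=set0].

Definition boundary Omega : set 'rV[R]_d := closure Omega `\` interior Omega.

End domains.

Section differentiability_classes.
Context {R : realType} {d : nat}.
Implicit Types (Omega : set 'rV[R]_d) (u : 'rV[R]_d -> R).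

Definition e_ (i : 'I_d) : 'rV[R]_d := delta_mx 0 i.

Definition partial (i : 'I_d) u : 'rV[R]_d -> R := fun x => 'D_(e_ i) u x.

Fixpoint Ck (k : nat) u : Prop :=
  continuous u /\
  if k is k'.+1 then
    forall i, (forall x, derivable u x (e_ i)) /\ Ck k' (partial i u)
  else True.

Definition smooth u := forall k, Ck k u.

Definition C1_closure Omega u :=
  {within closure Omega, continuous u} /\
  forall i, exists2 v : 'rV[R]_d -> R,
    {within closure Omega, continuous v} &
    forall x, Omega x -> is_derive x (e_ i) u (v x).

(* C_c^oo(Omega) *)
Definition test_function Omega u :=
  [/\ smooth u, compact (closure [set x | u x != 0]) &
      closure [set x | u x != 0] `<=` Omega].

End differentiability_classes.

Section sobolev.
Context {R : realType} {d : nat}.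
Implicit Types (Omega : set 'rV[R]_d) (u v : 'rV[R]_d -> R) (i : 'I_d).

Definition L2 Omega u :=
  measurable_fun Omega (u : 'rV[R]_d -> measurableTypeR R) /\
  (\int[leb d]_(x in Omega) ((u x) ^+ 2)%:E < +oo)%E.

Definition Linfty Omega u :=
  measurable_fun Omega (u : 'rV[R]_d -> measurableTypeR R) /\
  exists M : R, \forall x \ae leb d, Omega x -> `|u x| <= M.

Definition weak_partial Omega i u v :=
  forall phi, test_function Omega phi ->
  \int[leb d]_(x in Omega) (u x * partial i phi x) =
  - \int[leb d]_(x in Omega) (v x * phi x).

Definition H1 Omega u :=
  L2 Omega u /\
  forall i, exists2 v, L2 Omega v & weak_partial Omega i u v.

(* A chosen representative of the i-th weak partial derivative; it is
   determined up to a null set, and meaningful for u in H^1(Omega). *)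
Definition wD Omega i u : 'rV[R]_d -> R :=
  xget (fun=> 0) [set v | L2 Omega v /\ weak_partial Omega i u v].

(* || u - v ||_{H^1(Omega)}^2 *)
Definition H1_dist2 Omega u v : \bar R :=
  (\int[leb d]_(x in Omega) ((u x - v x) ^+ 2)%:E +
   \sum_(i < d)
     \int[leb d]_(x in Omega) ((wD Omega i u x - wD Omega i v x) ^+ 2)%:E)%E.

(* H^1_0(Omega), the closure of C_c^oo(Omega) in H^1(Omega) *)
Definition H10 Omega u :=
  H1 Omega u /\
  exists2 phi_ : ('rV[R]_d -> R)^nat, (forall n, test_function Omega (phi_ n)) &
    H1_dist2 Omega (phi_ n) u @[n --> \oo] --> 0%E.

End sobolev.

Section traces.
Context {R : realType} {d : nat}.
Implicit Types (Omega : set 'rV[R]_d) (u f : 'rV[R]_d -> R).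

(* The point whose i-th coordinate is t and whose other coordinates, in order,
   are those of y. *)
Definition insert_coord (i : 'I_d) (y : 'rV[R]_d.-1) (t : R) : 'rV[R]_d :=
  \row_j (if unlift i j is Some k then y 0 k else t).

Definition graph_point (i : 'I_d) (gamma : 'rV[R]_d.-1 -> R) y : 'rV[R]_d :=
  insert_coord i y (gamma y).

(* In the ball B(x0, r), Omega is the part of the space lying on one side of the
   graph x_i = gamma (x without its i-th coordinate), the side being given
   by s. *)
Definition C2_chart Omega (x0 : 'rV[R]_d) (r : R) (i : 'I_d) (s : bool)
    (gamma : 'rV[R]_d.-1 -> R) :=
  [/\ 0 < r, Ck 2 gamma &
      forall x, ball x0 r x ->
        (Omega x <-> 0 < (-1) ^+ s * (x 0 i - gamma (col' i x)))].

Definition C2_boundary Omega :=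
  forall x0, boundary Omega x0 ->
  exists r i s gamma, C2_chart Omega x0 r i s gamma.

Definition chart_domain (x0 : 'rV[R]_d) (r : R) (i : 'I_d)
    (gamma : 'rV[R]_d.-1 -> R) : set 'rV[R]_d.-1 :=
  [set y | ball x0 r (graph_point i gamma y)].

Definition area_element (gamma : 'rV[R]_d.-1 -> R) (y : 'rV[R]_d.-1) : R :=
  Num.sqrt (1 + \sum_(k < d.-1) (partial k gamma y) ^+ 2).

(* The integral of f ^ 2 over the portion of the boundary in the chart, with
   respect to surface measure. *)
Definition chart_integral2 (x0 : 'rV[R]_d) (r : R) (i : 'I_d)
    (gamma : 'rV[R]_d.-1 -> R) f : \bar R :=
  (\int[leb d.-1]_(y in chart_domain x0 r i gamma)
    ((f (graph_point i gamma y)) ^+ 2 * area_element gamma y)%:E)%E.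

(* Finitely many charts cover the boundary of a bounded C^2 domain, so
   measurability on the boundary and convergence in L^2(boundary) can be tested
   in each chart. *)
Definition boundary_measurable Omega f :=
  forall x0 r i s gamma, C2_chart Omega x0 r i s gamma ->
  measurable_fun (chart_domain x0 r i gamma)
    (f \o graph_point i gamma : 'rV[R]_d.-1 -> measurableTypeR R).

Definition cvg_L2_boundary Omega (f_ : ('rV[R]_d -> R)^nat) f :=
  forall x0 r i s gamma, C2_chart Omega x0 r i s gamma ->
  chart_integral2 x0 r i gamma (f_ n \- f) @[n --> \oo] --> 0%E.

(* f is the trace of u on the boundary: the trace operator is the continuous
   extension to H^1(Omega), with values in L^2(boundary), of the restriction to
   the boundary of functions in C^1(closure Omega). *)
Definition has_trace Omega u f :=
  boundary_measurable Omega f /\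
  exists u_ : ('rV[R]_d -> R)^nat,
    [/\ forall n, C1_closure Omega (u_ n),
        H1_dist2 Omega (u_ n) u @[n --> \oo] --> 0%E &
        cvg_L2_boundary Omega u_ f].

End traces.

(* Positive weak solutions of
     div (a grad Psi) = b Psi + c |Psi| ^ -(1 + theta) Psi  in Omega,
     Psi = h  on the boundary. *)
Definition positive_weak_solution {R : realType} {d : nat}
    (Omega : set 'rV[R]_d) (a b c h : 'rV[R]_d -> R) (theta : R)
    (Psi : 'rV[R]_d -> R) :=
  let F x := b x * Psi x + c x * (`|Psi x| `^ (- (1 + theta)) * Psi x) in
  [/\ H1 Omega Psi,
      \forall x \ae leb d, Omega x -> 0 < Psi x,
      has_trace Omega Psi h &
      forall phi, H10 Omega phi ->
        (leb d).-integrable Omega (fun x => (F x * phi x)%:E) /\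
        \int[leb d]_(x in Omega)
          (a x * \sum_(i < d) wD Omega i Psi x * wD Omega i phi x) =
        - \int[leb d]_(x in Omega) (F x * phi x)].

(* Main.v *)
(** Existence.  Replace [t `^ (- theta)] by its truncation [(max t m0) `^ (- theta)],
    which is bounded and Lipschitz.  The associated energy is strictly convex on
    [h + H^1_0], and by the Poincare inequality a minimising sequence is Cauchy in
    [H^1]; its limit solves the truncated equation.  For [lam] large and [kap] small
    the function [kap * expR (lam * x 0 i)] is a subsolution lying below [h], so
    testing the equation with a smooth nonnegative increasing function of
    [v - Psi] gives [Psi >= v >= m0]: the truncation is not active.

    Uniqueness.  The difference [w] of two solutions has zero trace.  In a boundary
    chart the one-dimensional fundamental theorem of calculus gives
    [\int w^2 <= C tau^2 \int |grad w|^2] on a layer of thickness [tau], so that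
    cutting [w] off at distance [1/k] from the boundary converges in [H^1] and [w]
    belongs to [H^1_0].  Since [t |-> b t + c t `^ (- theta)] is nondecreasing,
    testing with [w] forces the gradient of [w], hence [w], to vanish.

    Smooth approximation uses no convolution: a function is replaced by the sum of
    its values at the nodes of a grid times smooth hat functions whose translates
    reproduce affine functions, so that gradients converge uniformly as well. *)

Require Import Defs.
From HB Require Import structures.
From mathcomp Require Import all_boot all_order all_algebra.
From mathcomp Require Import all_classical all_reals all_analysis.
From mathcomp Require Import measurable_realfun ring lra.

Set Implicit Arguments.
Unset Strict Implicit.
Unset Printing Implicit Defensive.

Import Order.TTheory GRing.Theory Num.Theory numFieldNormedType.Exports.

Local Open Scope classical_set_scope.
Local Open Scope ring_scope.

(** * Lebesgue measure on row vectors *)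

(** The sign of [c] serves twice. As [t |-> t ^ (- theta)] decreases, a primitive of its truncation
    [k] is concave, and the factor [c <= 0] makes the energy convex. As [c * k <= 0] for every
    nonnegative [k], the subsolution only has to beat [B * v]: its lower bound [m0] is found before
    the truncation and then fixes its level, so there is no circle.

    The coefficient [a] is merely Lipschitz. The flux of the subsolution is therefore differentiated
    through difference quotients, moved by translation onto the test function. The surplus [m0] in
    the resulting inequality is what forces the positive part of [v - Psi] to vanish.

    Weak gradients are determined up to null sets, so functions travel with a chosen gradient as
    pairs [(u, du)]. Minimisation takes place on compactly supported C^1 pairs, a genuine vector
    space, and completeness of [L^2] supplies the limit.

    From zero trace to [H^1_0] two scales must match: a cutoff at distance [1 / k] has a gradient of
    order [k], and the layer estimate gains [tau ^+ 2] with [tau] of order [1 / k]. *)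

Section boxes.
Context {R : realType}.

Definition box n (a b : 'rV[R]_n) : set 'rV[R]_n :=
  [set x | forall i, a 0 i < x 0 i < b 0 i].

Lemma measurable_slab n (i : 'I_n) (A : set (measurableTypeR R)) :
  measurable A -> measurable [set x : 'rV[R]_n | A (x 0 i)].
Proof.
move=> mA; rewrite -[X in measurable X]setTI.
exact: (measurable_rV_coord i measurableT).
Qed.

Lemma boxE n (a b : 'rV[R]_n) :
  box a b = \bigcap_(i in [set: 'I_n]) [set x | `]a 0 i, b 0 i[%classic (x 0 i)].
Proof.
apply/seteqP; split=> x /= xab i.
  by move=> _ /=; rewrite in_itv/=; exact: xab.
by have := xab i Logic.I; rewrite /= in_itv.
Qed.

Lemma measurable_box n (a b : 'rV[R]_n) : measurable (box a b).
Proof.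
rewrite boxE; apply: fin_bigcap_measurable => //= i _.
exact: (@measurable_slab n i `]a 0 i, b 0 i[%classic).
Qed.

Lemma box_setI n (a b a' b' : 'rV[R]_n) :
  box a b `&` box a' b' =
  box (\row_i Num.max (a 0 i) (a' 0 i)) (\row_i Num.min (b 0 i) (b' 0 i)).
Proof.
apply/seteqP; split=> [x [xab xab'] i|x xab]; rewrite ?mxE.
  by have /andP[h1 h2] := xab i; have /andP[h3 h4] := xab' i;
    rewrite gt_max lt_min h1 h2 h3 h4.
split=> i; have := xab i; rewrite !mxE gt_max lt_min.
  by move=> /andP[/andP[-> _] /andP[-> _]].
by move=> /andP[/andP[_ ->] /andP[_ ->]].
Qed.

Definition boxes n : set (set 'rV[R]_n) :=
  [set B | exists a b, B = box a b].
Arguments boxes n : clear implicits.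

Lemma boxes_setI_closed n : setI_closed (boxes n).
Proof.
move=> _ _ [a [b ->]] [a' [b' ->]]; rewrite box_setI; by do 2 eexists.
Qed.

Lemma rV_bounded_nat n (x : 'rV[R]_n) : exists k : nat, forall i, `|x 0 i| < k%:R.
Proof.
exists (Num.truncn (\sum_i `|x 0 i|)).+1 => i.
rewrite (le_lt_trans _ (Num.Theory.truncnS_gt _))//.
by rewrite (bigD1 i)//= lerDl sumr_ge0.
Qed.

Lemma bigcup_box n :
  \bigcup_k box (const_mx (- k%:R)) (const_mx k%:R) = [set: 'rV[R]_n].
Proof.
rewrite -subTset => x _; have [k xk] := rV_bounded_nat x.
by exists k => // i; rewrite !mxE -ltr_norml.
Qed.

(** Only the half-spaces bounding one coordinate from below have to be produced from boxes, and each
    is a countable union of boxes truncated at height [k]. *)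
Lemma measurable_rV_boxes n :
  @measurable _ 'rV[R]_n = <<s boxes n >>.
Proof.
apply/seteqP; split; last first.
  apply: smallest_sub; first exact: sigma_algebra_measurable.
  by move=> _ [a [b ->]]; exact: measurable_box.
apply: smallest_sub; first exact: smallest_sigma_algebra.
rewrite -bigcup_seq; apply: bigcup_sub => i _.
suff mf : measurable_fun [set: g_sigma_algebraType (boxes n)]
    (fun x : 'rV[R]_n => x 0 i : measurableTypeR R).
  by move=> _ [A mA <-]; exact: mf.
apply: (measurability (@RGenOInfty.G R)).
  exact: RGenOInfty.measurableE.
move=> _ [_ [x ->] <-]; rewrite setTI.
have -> : (fun y : 'rV[R]_n => y 0 i) @^-1` `]x, +oo[ =
    \bigcup_k box (\row_j if j == i then x else - k%:R) (const_mx k%:R).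
  apply/seteqP; split=> y /=.
    rewrite in_itv/= andbT => xy; have [k yk] := rV_bounded_nat y.
    exists k => // j; rewrite !mxE; have := yk j; rewrite ltr_norml => /andP[h1 h2].
    by case: eqP => [->|]; rewrite ?xy ?h1 ?h2//=; have := yk i; rewrite ltr_norml => /andP[].
  by move=> [k _ /(_ i)]; rewrite !mxE eqxx in_itv/= andbT => /andP[].
apply: sigma_algebra_bigcup => k.
by apply: sub_sigma_algebra; do 2 eexists.
Qed.

(** Dynkin's argument: boxes are stable under intersection and generate the sigma-algebra, and the
    cubes of half-width [k] exhaust the space with finite measure. *)
Lemma rV_measure_unique n (m1 m2 : {measure set 'rV[R]_n -> \bar R}) :
  (forall a b, m1 (box a b) = m2 (box a b)) ->
  (forall a b, (m1 (box a b) < +oo)%E) ->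
  forall A, measurable A -> m1 A = m2 A.
Proof.
move=> m12 m1oo A mA.
apply: (measure_unique (boxes n)
  (fun k => box (const_mx (- k%:R)) (const_mx k%:R))) => //.
- exact: measurable_rV_boxes.
- exact: boxes_setI_closed.
- by move=> i; do 2 eexists.
- exact: bigcup_box.
- by move=> _ [a [b ->]].
Qed.

Lemma lebesgue_measure_oo (a b : R) :
  lebesgue_measure (`]a, b[%classic : set (measurableTypeR R)) = (Num.max 0 (b - a))%:E.
Proof.
rewrite lebesgue_measure_itv/= lte_fin; case: ltP => ab.
  by rewrite -EFinB max_r// subr_ge0 ltW.
by rewrite max_l// subr_le0.
Qed.

Lemma rV_cons_box n (a b : 'rV[R]_n.+1) :
  @rV_cons R n @^-1` box a b =
  `]a 0 0, b 0 0[%classic `*` box (\row_k a 0 (lift 0 k)) (\row_k b 0 (lift 0 k)).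
Proof.
apply/seteqP; split=> -[t y] /=.
  move=> h; split=> /=; first by have := h 0; rewrite mxE unlift_none in_itv.
  by move=> k; have := h (lift 0 k); rewrite !mxE liftK.
rewrite in_itv/= => -[h1 h2] j; rewrite mxE.
case: unliftP => [k ->|->]//.
by have := h2 k; rewrite !mxE.
Qed.

Lemma lebS n (A : set 'rV[R]_n.+1) :
  leb n.+1 A = (@lebesgue_measure R \x leb n)%E (@rV_cons R n @^-1` A).
Proof. by []. Qed.

Lemma leb_box n (a b : 'rV[R]_n) :
  leb n (box a b) = (\prod_(i < n) Num.max 0 (b 0 i - a 0 i))%:E.
Proof.
elim: n a b => [|n IHn] a b.
  rewrite big_ord0 /= diracE mem_set//.
  by move=> [].
rewrite lebS rV_cons_box product_measure1E//; last exact: measurable_box.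
rewrite IHn big_ord_recl EFinM; congr (_ * _)%E.
  exact: lebesgue_measure_oo.
congr EFin; by apply: eq_bigr => i _; rewrite !mxE.
Qed.

Lemma leb_box_lty n (a b : 'rV[R]_n) : (leb n (box a b) < +oo)%E.
Proof. by rewrite leb_box ltry. Qed.

(** Characterises Lebesgue measure. Translation invariance and Tonelli along any coordinate then
    reduce to a computation on boxes. *)
Lemma leb_unique n (m : {measure set 'rV[R]_n -> \bar R}) :
  (forall a b, m (box a b) = (\prod_(i < n) Num.max 0 (b 0 i - a 0 i))%:E) ->
  forall A, measurable A -> leb n A = m A.
Proof.
move=> mE; apply: rV_measure_unique => a b; last exact: leb_box_lty.
by rewrite (mE a b); exact: leb_box.
Qed.

End boxes.

(** * Open sets as countable unions of rational boxes *)

Section open_sets.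
Context {R : realType} {n : nat}.

Lemma ball_rVP (x y : 'rV[R]_n) (e : R) :
  ball x e y <-> 0 < e /\ forall i, `|x 0 i - y 0 i| < e.
Proof.
split=> -[e0 h]; split => //; first by move=> i; exact: h.
by move=> i j; rewrite (ord1 i); exact: h.
Qed.

Definition cbox (a b : 'rV[R]_n) : set 'rV[R]_n :=
  [set x | forall i, a 0 i <= x 0 i <= b 0 i].

Lemma box_cbox (a b : 'rV[R]_n) : box a b `<=` cbox a b.
Proof. by move=> x h i; have /andP[/ltW -> /ltW ->] := h i. Qed.

(** Cubes with rational centre [p.1] and half-width [1 / p.2.+1]. The index type is countable, which
    serves both measurability and almost-everywhere statements. *)
Definition rat_box (p : 'rV[rat]_n * nat) : 'rV[R]_n * 'rV[R]_n :=
  (\row_i (ratr (p.1 0 i) - p.2.+1%:R^-1), \row_i (ratr (p.1 0 i) + p.2.+1%:R^-1)).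

(** The index set asks for the closed box inside [U]: a bump living on the box is then compactly
    supported in [U], as the fundamental lemma requires. *)
Lemma open_bigcup_rat_box (U : set 'rV[R]_n) : open U ->
  U = \bigcup_(p in [set p | cbox (rat_box p).1 (rat_box p).2 `<=` U])
        box (rat_box p).1 (rat_box p).2.
Proof.
move=> oU.
apply/seteqP; split; last by move=> x [p /= pU /box_cbox]; exact: pU.
move=> x Ux; have /nbhs_ballP[e /= e0 xeU] : nbhs x U by apply: open_nbhs_nbhs; split.
(* Chosen so that [2 / k.+1 < e]: the half-width of the cube plus the distance from its centre to
   [x] stay below [e]. *)
pose k := Num.trunc (2 / e).
have kp : 0 < k.+1%:R^-1 :> R by rewrite invr_gt0.
have ke : k.+1%:R^-1 + k.+1%:R^-1 < e.
  have : 2 / e < k.+1%:R by exact: truncnS_gt.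
  rewrite ltr_pdivrMr// => h.
  have : 2 * k.+1%:R^-1 < e by rewrite ltr_pdivrMr// mulrC.
  by rewrite mulr2n mulrDl mul1r.
have /choice[q hq] : forall i, exists q : rat, x 0 i - k.+1%:R^-1 < ratr q < x 0 i + k.+1%:R^-1.
  move=> i; have : x 0 i - k.+1%:R^-1 < x 0 i + k.+1%:R^-1 by rewrite ltrD2l gtrN.
  by move=> /rat_in_itvoo[q]; rewrite in_itv => ?; exists q.
exists (\row_i q i, k) => /=.
  move=> y hy; apply: xeU; apply/ball_rVP; split=> // j; have := hy j.
  have := hq j; rewrite !mxE => /andP[h1 h2] /andP[h3 h4].
  move: kp ke h1 h2 h3 h4; move: (_^-1) (ratr _) (x 0 j) (y 0 j) => t r u v.
  by rewrite ltr_norml => *; apply/andP; split; lra.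
move=> i; have := hq i; rewrite !mxE => /andP[].
by move: (_^-1) (ratr _) (x 0 i) => t r u *; apply/andP; split; lra.
Qed.

Lemma open_measurable_rV (U : set 'rV[R]_n) : open U -> measurable U.
Proof.
move=> /open_bigcup_rat_box ->.
rewrite bigcup_mkcond; apply: countable_bigcupT_measurable => //.
by move=> p; case: ifP => _ //; exact: measurable_box.
Qed.

Lemma continuous_measurable_rV (D : set 'rV[R]_n) (f : 'rV[R]_n -> R) :
  open D -> {in D, continuous f} ->
  measurable_fun D (f : 'rV[R]_n -> measurableTypeR R).
Proof.
move=> oD cf mD.
apply: (measurability (@RGenOInfty.G R)) => //.
  exact: RGenOInfty.measurableE.
move=> _ [_ [x ->] <-]; apply: open_measurable_rV.
rewrite openE => y [Dy fy]; apply: filterI; first exact: open_nbhs_nbhs.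
by apply: (cf y); [rewrite inE|apply: open_nbhs_nbhs; split => //; exact: interval_open].
Qed.

End open_sets.

(** * Translation invariance and Tonelli along an arbitrary coordinate *)

Section lebesgue_rV_invariance.
Context {R : realType}.

Lemma measurable_shift n (v : 'rV[R]_n) : measurable_fun setT (fun x : 'rV[R]_n => x + v).
Proof.
apply: measurable_fun_rVP => i.
rewrite (_ : _ \o _ = (fun x : 'rV[R]_n => x 0 i + v 0 i : measurableTypeR R)); last first.
  by apply/funext => x; rewrite /rV_coord /= !mxE.
by apply: measurable_funD => //; exact: (measurable_rV_coord i).
Qed.

Lemma leb_shift n (v : 'rV[R]_n) (A : set 'rV[R]_n) : measurable A ->
  leb n ((fun x => x + v) @^-1` A) = leb n A.
Proof.
move=> mA; apply/esym.
pose m2 := pushforward (leb n) (fun x => x + v) : {measure set 'rV[R]_n -> \bar R}.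
apply: (@leb_unique R n (m2 (measurable_shift v)) _ _ mA) => a b.
rewrite [LHS](_ : _ = leb n (box (a - v) (b - v))); last first.
  congr (leb n _).
  apply/seteqP; split => x /= h i; have := h i; rewrite !mxE => /andP[h1 h2];
  apply/andP; split; lra.
rewrite leb_box; congr EFin; apply: eq_bigr => i _; rewrite !mxE.
by congr Num.max; lra.
Qed.

(** Uncurried [insert_coord]. A boundary chart is a graph in some coordinate [i], so integration
    along that particular coordinate must be available. *)
Definition ins n (i : 'I_n.+1) (p : measurableTypeR R * 'rV[R]_n) : 'rV[R]_n.+1 :=
  @insert_coord R n.+1 i p.2 p.1.

Lemma insE n (i j : 'I_n.+1) p : ins i p 0 j = if unlift i j is Some k then p.2 0 k else p.1.
Proof. by rewrite mxE. Qed.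

Lemma ins_lift n (i : 'I_n.+1) k p : ins i p 0 (lift i k) = p.2 0 k.
Proof. by rewrite insE liftK. Qed.

Lemma ins_id n (i : 'I_n.+1) p : ins i p 0 i = p.1.
Proof. by rewrite insE unlift_none. Qed.

Lemma measurable_ins n (i : 'I_n.+1) : measurable_fun setT (ins i).
Proof.
apply: measurable_fun_rVP => j; case: (unliftP i j) => [k|] ->.
  rewrite (_ : _ \o _ = @rV_coord R n k \o snd).
    exact: measurableT_comp (measurable_rV_coord k) measurable_snd.
  by apply/funext => p /=; rewrite /rV_coord ins_lift.
rewrite (_ : _ \o _ = fst); first exact: measurable_fst.
by apply/funext => p /=; rewrite /rV_coord ins_id.
Qed.

(** Checked on boxes, whose volume does not depend on the order of the coordinates. *)
Lemma leb_ins n (i : 'I_n.+1) (A : set 'rV[R]_n.+1) : measurable A ->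
  leb n.+1 A = (@lebesgue_measure R \x leb n)%E (ins i @^-1` A).
Proof.
move=> mA.
pose m2 := pushforward (@lebesgue_measure R \x leb n)%E (ins i) :
  {measure set 'rV[R]_n.+1 -> \bar R}.
apply: (@leb_unique R n.+1 (m2 (measurable_ins i)) _ _ mA) => a b.
rewrite [LHS](_ : _ = (@lebesgue_measure R \x leb n)%E (`]a 0%R i, b 0%R i[%classic `*`
    box (\row_k a 0%R (lift i k)) (\row_k b 0%R (lift i k)))); last first.
  congr ((@lebesgue_measure R \x leb n)%E _).
  apply/seteqP; split=> -[t y] /=.
    move=> h; split=> /=; first by have := h i; rewrite ins_id in_itv.
    by move=> k; have := h (lift i k); rewrite !mxE liftK.
  rewrite in_itv/= => -[h1 h2] j; case: (unliftP i j) => [k ->|->].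
    by rewrite ins_lift; have := h2 k; rewrite !mxE.
  by rewrite ins_id.
rewrite product_measure1E//; last exact: measurable_box.
rewrite (bigD1_ord i)//= EFinM; congr (_ * _)%E.
  exact/lebesgue_measure_oo.
by rewrite leb_box; congr EFin; apply: eq_bigr => k _; rewrite !mxE.
Qed.

Lemma ge0_integral_shift n (v : 'rV[R]_n) (f : 'rV[R]_n -> \bar R) :
  measurable_fun [set: 'rV[R]_n] f -> (forall x, 0 <= f x)%E ->
  (\int[leb n]_x f (x + v)%R = \int[leb n]_x f x)%E.
Proof.
move=> mf f0.
rewrite -[LHS](ge0_integral_pushforward (measurable_shift v) (leb n) measurableT mf (fun y _ => f0 y)).
apply: eq_measure_integral => [|mphi A mA _]; first exact: measurable_shift.
exact: (leb_shift v mA).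
Qed.

Lemma integral_shift n (v : 'rV[R]_n) (f : 'rV[R]_n -> \bar R) :
  measurable_fun [set: 'rV[R]_n] f ->
  (\int[leb n]_x f (x + v)%R = \int[leb n]_x f x)%E.
Proof.
move=> mf.
have mp : measurable_fun [set: 'rV[R]_n] f^\+%E by exact: measurable_funepos.
have mn : measurable_fun [set: 'rV[R]_n] f^\-%E by exact: measurable_funeneg.
rewrite [RHS]integralE [LHS]integralE.
rewrite -(ge0_integral_shift v mp (funepos_ge0 f)).
rewrite -(ge0_integral_shift v mn (funeneg_ge0 f)).
by congr (_ - _)%E; apply: eq_integral => x _; rewrite ?funeposE ?funenegE.
Qed.

Lemma ge0_integral_ins n (i : 'I_n.+1) (f : 'rV[R]_n.+1 -> \bar R) :
  measurable_fun [set: 'rV[R]_n.+1] f -> (forall x, 0 <= f x)%E ->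
  (\int[leb n.+1]_x f x =
   \int[leb n]_y \int[lebesgue_measure]_t f (ins i (t, y)))%E.
Proof.
move=> mf f0.
rewrite -[RHS](@fubini_tonelli2 _ _ _ _ _ _ _ (f \o ins i)); last first.
- by move=> x; exact: f0.
- by apply: measurableT_comp mf _; exact: measurable_ins.
rewrite -[RHS](ge0_integral_pushforward (measurable_ins i) _ measurableT mf (fun y _ => f0 y)).
apply/esym; apply: eq_measure_integral => [|mphi A mA _]; first exact: measurable_ins.
exact/esym/(leb_ins i mA).
Qed.

End lebesgue_rV_invariance.

(** * Smooth functions of one variable *)

Section smooth_R.
Context {R : realType}.
Implicit Types (f g : R -> R) (x t : R) (k n : nat).

Fixpoint nderivable k f : Prop :=
  if k is k'.+1 then (forall x, derivable f x 1) /\ nderivable k' (derive1 f) else True.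

Definition smoothR f := forall k, nderivable k f.

Lemma nderivableS k f df : (forall x, is_derive x 1 f (df x)) ->
  nderivable k df -> nderivable k.+1 f.
Proof.
move=> fdf kdf; split; first by move=> x; have := fdf x; case.
suff -> : derive1 f = df by [].
by apply/funext => x; rewrite derive1E; exact: derive_val.
Qed.

Lemma eq_nderivable k f g : f =1 g -> nderivable k f -> nderivable k g.
Proof. by move=> /funext ->. Qed.

Lemma nderivable_is_derive k f x : nderivable k.+1 f -> is_derive x 1 f (derive1 f x).
Proof. by move=> [df _]; rewrite derive1E; exact: DeriveDef. Qed.

Lemma nderivableW k f : nderivable k.+1 f -> nderivable k f.
Proof. by elim: k f => // k IH f [df kf]; split => //; exact: IH. Qed.

Lemma nderivable_cst k (c : R) : nderivable k (fun=> c).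
Proof.
by elim: k c => // k IH c; apply: nderivableS (IH 0) => x; exact: is_derive_cst.
Qed.

Lemma nderivableD k f g : nderivable k f -> nderivable k g ->
  nderivable k (fun x => f x + g x).
Proof.
elim: k f g => // k IH f g kf kg.
apply: (nderivableS _ (IH _ _ kf.2 kg.2)) => x.
by apply: is_deriveD; [exact: (nderivable_is_derive x kf)|exact: (nderivable_is_derive x kg)].
Qed.

Lemma nderivableM k f g : nderivable k f -> nderivable k g ->
  nderivable k (fun x => f x * g x).
Proof.
elim: k f g => // k IH f g kf kg.
apply: (nderivableS _ (nderivableD (IH _ _ (nderivableW kf) kg.2) (IH _ _ (nderivableW kg) kf.2))) => x.
by apply: is_deriveM; [exact: (nderivable_is_derive x kf)|exact: (nderivable_is_derive x kg)].
Qed.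

Lemma nderivable_id k : nderivable k (fun x : R => x).
Proof.
case: k => // k; apply: nderivableS (nderivable_cst k 1) => x.
Qed.

Lemma nderivableV k f : (forall x, f x != 0) -> nderivable k f ->
  nderivable k (fun x => (f x)^-1).
Proof.
move=> f0; elim: k => // k IH kf.
have h := IH (nderivableW kf).
apply: (nderivableS _ (nderivableM (nderivableM (nderivable_cst k (-1)) kf.2) (nderivableM h h))) => x.
apply: is_derive_eq.
  by apply: is_deriveV => //; exact: (nderivable_is_derive x kf).
by rewrite /GRing.scale/= -exprVn; ring.
Qed.

Lemma nderivable_affine k f (a b : R) : nderivable k f ->
  nderivable k (fun x => f (a * x + b)).
Proof.
elim: k f => // k IH f kf.
apply: (nderivableS _ (nderivableM (IH _ kf.2) (nderivable_cst k a))) => x.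
apply: (@is_derive1_comp _ f (fun x => a * x + b)).
  exact: (nderivable_is_derive _ kf).
apply: is_derive_eq.
by rewrite addr0 /GRing.scale/= mulr1.
Qed.

(** Flat functions at [0]. Keeping every power [n] makes the family stable under differentiation up
    to linear combinations, so that smoothness of all members comes from one induction. *)
Definition inv_expR n t : R := if 0 < t then t ^- n * expR (- t^-1) else 0.

Lemma inv_expR_gt0 n t : 0 < t -> 0 < inv_expR n t.
Proof. by move=> t0; rewrite /inv_expR t0 mulr_gt0 ?expR_gt0 ?invr_gt0 ?exprn_gt0. Qed.

Lemma inv_expR_le0 n t : t <= 0 -> inv_expR n t = 0.
Proof. by rewrite /inv_expR ltNge => ->. Qed.

(** Comes from the Taylor bound [e^s >= s ^+ n.+1 / n.+1!] at [s = t^-1]; taking one power more than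
    [n] leaves the factor [t]. *)
Lemma inv_expR_bound n t : 0 < t -> inv_expR n t <= (n.+1)`!%:R * t.
Proof.
move=> t0; rewrite /inv_expR t0 expRN.
have e0 : 0 < expR t^-1 by exact: expR_gt0.
rewrite ler_pdivrMr//.
have := @expR_ge1Dxn R t^-1 n; rewrite invr_ge0 (ltW t0) => /(_ isT) h.
have {}h : t^-1 ^+ n.+1 / (n.+1)`!%:R <= expR t^-1 by lra.
rewrite ler_pdivrMr ?ltr0n ?fact_gt0// in h.
have -> : t ^- n = t * t^-1 ^+ n.+1.
  by rewrite exprS exprVn mulrA divff ?mul1r// gt_eqF.
by rewrite mulrC mulrAC ler_pM2r// (le_trans h)// mulrC.
Qed.

Lemma inv_expR_ge0 n t : 0 <= inv_expR n t.
Proof. by case: (ltP 0 t) => [/(inv_expR_gt0 n)/ltW//|/(inv_expR_le0 n) ->]. Qed.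

(** The difference quotient at [0] is bounded by [C * |h|]. *)
Lemma is_derive0_bound f (C : R) : f 0 = 0 -> (forall h, `|f h| <= C * h ^+ 2) ->
  is_derive (0 : R) 1 f 0.
Proof.
move=> f0 fC.
have h : h^-1 *: ((f \o shift (0:R)) (h *: (1 : R)) - f 0) @[h --> (0:R)^'] --> (0 : R).
  apply/cvgr0Pnorm_le => e e0.
  have C1 : 0 < `|C| + 1 by rewrite ltr_wpDl.
  have Ce : 0 < (`|C| + 1)^-1 * e by rewrite mulr_gt0 ?invr_gt0.
  near=> h; rewrite /GRing.scale/= f0 subr0 addr0 mulr1.
  have h0 : 0 < `|h| by rewrite normr_gt0; near: h; exact: nbhs_dnbhs_neq.
  rewrite normrM normfV mulrC ler_pdivrMr// (le_trans (fC h))//.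
  rewrite -real_normK ?num_real// expr2 mulrA ler_pM2r//.
  apply: (@le_trans _ _ ((`|C| + 1) * `|h|)).
    by rewrite ler_pM2r// (le_trans (ler_norm C))// lerDl.
  rewrite -ler_pdivlMl//; near: h; exact: (@dnbhs0_le R R _ Ce).
apply: DeriveDef; last exact: cvg_lim.
by apply/cvg_ex; exists 0.
Unshelve. all: end_near. Qed.

Lemma is_derive_exprn n x : is_derive x 1 (fun y : R => y ^+ n) (n%:R * x ^+ n.-1).
Proof.
elim: n => [|n IH]; first by rewrite mul0r; exact: is_derive_cst.
rewrite [X in is_derive _ _ X _](_ : _ = (fun y => y * y ^+ n)); last first.
  by apply/funext => y; rewrite exprS.
apply: is_derive_eq (is_deriveM (is_derive_id x 1) IH) _.
rewrite /GRing.scale/=; case: n {IH} => [|n] /=; first by rewrite mul0r; ring.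
by rewrite exprS -[in RHS]natr1; ring.
Qed.

Lemma is_derive_inv_expR n x :
  is_derive x 1 (inv_expR n) (inv_expR n.+2 x - n%:R * inv_expR n.+1 x).
Proof.
have [x0|x0|->] := ltgtP x 0.
- rewrite !inv_expR_le0 ?ltW// mulr0 subr0.
  apply: (@near_eq_is_derive _ _ _ (cst 0)).
  near=> y; rewrite inv_expR_le0//; apply: ltW; near: y.
  exact: lt_nbhsl.
- apply: (@near_eq_is_derive _ _ _ (fun y : R => (y ^+ n)^-1 * expR (- y^-1))).
    near=> y; rewrite /inv_expR ifT//; near: y; exact: lt_nbhsr.
  apply: is_derive_eq.
    apply: is_deriveM.
      by apply: is_deriveV; [rewrite expf_neq0// gt_eqF|exact: is_derive_exprn].
        apply: (@is_derive1_comp _ expR (fun y : R => - y^-1)).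
    apply: is_deriveN; apply: is_deriveV; by rewrite gt_eqF.
  rewrite /inv_expR x0 /GRing.scale/=.
  have xn : x != 0 by rewrite gt_eqF.
  case: n => [|n] /=; rewrite ?mul0r ?mulr0n ?mul0r.
    by field.
  by rewrite !exprS; field; rewrite xn expf_neq0.
- rewrite !inv_expR_le0// mulr0 subr0; apply: (@is_derive0_bound _ ((n.+2)`!%:R)).
    by rewrite inv_expR_le0.
  move=> h; have [h0|h0] := ltP 0 h; last first.
    by rewrite inv_expR_le0// normr0 mulr_ge0// sqr_ge0.
  rewrite ger0_norm ?inv_expR_ge0// expr2 mulrA.
  (* Raising the power by one buys a second factor [h], hence the quadratic bound that gives
     derivative [0] at the origin. *)
  have -> : inv_expR n h = h * inv_expR n.+1 h.
    by rewrite /inv_expR h0 exprS invfM !mulrA divff ?mul1r// gt_eqF.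
  by rewrite mulrC ler_pM2r// inv_expR_bound.
Unshelve. all: end_near. Qed.

Lemma nderivable_inv_expR k n : nderivable k (inv_expR n).
Proof.
elim: k n => // k IH n.
apply: (@nderivableS _ _ (fun x => inv_expR n.+2 x + (- n%:R) * inv_expR n.+1 x)).
  by move=> x; apply: is_derive_eq (is_derive_inv_expR n x) _; rewrite mulNr.
by apply: nderivableD => //; apply: nderivableM => //; exact: nderivable_cst.
Qed.

(* A smooth function equal to [0] for [t <= 0] and to [t] for [t >= 1]; its second
   difference [spline] replaces the piecewise linear hat function. *)
Definition ramp t : R :=
  t * (inv_expR 0 t * (inv_expR 0 t + inv_expR 0 (1 - t))^-1).

(** One of [t] and [1 - t] is positive. *)
Lemma inv_expR_sum_neq0 t : inv_expR 0 t + inv_expR 0 (1 - t) != 0.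
Proof.
rewrite gt_eqF//; have [t0|t0] := ltP 0 t.
  by rewrite ltr_pwDl ?inv_expR_gt0 ?inv_expR_ge0.
by rewrite ltr_wpDl ?inv_expR_ge0// inv_expR_gt0//; lra.
Qed.

Lemma nderivable_ramp k : nderivable k ramp.
Proof.
apply: nderivableM; first exact: nderivable_id.
apply: nderivableM; first exact: nderivable_inv_expR.
apply: nderivableV; first exact: inv_expR_sum_neq0.
apply: nderivableD; first exact: nderivable_inv_expR.
have := @nderivable_affine k _ (-1) 1 (@nderivable_inv_expR k 0).
by apply: eq_nderivable => x; congr inv_expR; lra.
Qed.

Lemma ramp_le0 t : t <= 0 -> ramp t = 0.
Proof. by move=> t0; rewrite /ramp inv_expR_le0// mul0r mulr0. Qed.

Lemma ramp_ge1 t : 1 <= t -> ramp t = t.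
Proof.
move=> t1; rewrite /ramp (@inv_expR_le0 0 (1 - t)) ?subr_le0// addr0.
by rewrite divff ?mulr1// gt_eqF// inv_expR_gt0// (lt_le_trans _ t1).
Qed.

Definition spline t : R := ramp (t + 1) - 2 * ramp t + ramp (t - 1).

Lemma nderivable_spline k : nderivable k spline.
Proof.
apply: nderivableD; last first.
  have := @nderivable_affine k _ 1 (-1) (@nderivable_ramp k).
  by apply: eq_nderivable => x; rewrite mul1r.
apply: (@nderivableD k (fun t => ramp (t + 1)) (fun t => - (2 * ramp t))).
  have := @nderivable_affine k _ 1 1 (@nderivable_ramp k).
  by apply: eq_nderivable => x; rewrite mul1r.
have := nderivableM (nderivable_cst k (-2)) (nderivable_ramp k).
by apply: eq_nderivable => x; ring.
Qed.

Lemma spline_le t : t <= -1 -> spline t = 0.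
Proof. by move=> t1; rewrite /spline !ramp_le0//; lra. Qed.

Lemma spline_ge t : 2 <= t -> spline t = 0.
Proof. by move=> t1; rewrite /spline !ramp_ge1//; lra. Qed.

(** The window is longer than the [(-1, 1)] of the piecewise linear hat because [ramp] is affine
    only outside [[0, 1]]. *)
Lemma spline_neq0 t : spline t != 0 -> -1 < t < 2.
Proof.
by apply: contraR; rewrite negb_and -!leNgt => /orP[/spline_le|/spline_ge] ->.
Qed.

Lemma is_derive_spline t : is_derive t 1 spline (derive1 spline t).
Proof. exact: (nderivable_is_derive t (nderivable_spline 1)). Qed.

Lemma derive1_eq_near f g t : (\near t, f t = g t) -> derive1 f t = derive1 g t.
Proof. by move=> fg; rewrite !derive1E; exact: near_eq_derive. Qed.

Lemma derive1_spline_lt t : t < -1 -> derive1 spline t = 0.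
Proof.
move=> t1; rewrite (@derive1_eq_near _ (cst 0)) ?derive1_cst//.
by near=> y; apply: spline_le; near: y; exact: lt_le_nbhsl.
Unshelve. all: end_near. Qed.

Lemma derive1_spline_gt t : 2 < t -> derive1 spline t = 0.
Proof.
move=> t1; rewrite (@derive1_eq_near _ (cst 0)) ?derive1_cst//.
by near=> y; apply: spline_ge; near: y; exact: lt_le_nbhsr.
Unshelve. all: end_near. Qed.

Lemma nderivable_continuous f : nderivable 1 f -> continuous f.
Proof.
move=> [df _] x; apply: differentiable_continuous; exact/derivable1_diffP.
Qed.

(* [4] nodes [i] at most satisfy [-1 <= u - i <= 2] *)
Lemma sum_window_bound (h : R -> R) (M : R) n u :
  (forall t, 0 <= h t <= M) -> (forall t, t < -1 \/ 2 < t -> h t = 0) ->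
  \sum_(i < n) h (u - i%:R) <= 4 * M.
Proof.
move=> hM h0.
have M0 : 0 <= M by have /andP[] := hM 0; exact: le_trans.
(* With [k] the integer part of [u + 1], a contributing node [i] satisfies [k - 4 < i <= k]. Each
   term is therefore dominated by a sum over the [j < 4] with [i + j = k], and the two sums are
   exchanged. *)
pose k := Num.trunc (Num.max 0 (u + 1)).
have kP : k%:R <= Num.max 0 (u + 1) < k.+1%:R.
  by apply: truncn_itv; rewrite le_max lexx.
have step i : h (u - i%:R) <= \sum_(j < 4) (if (i + j == k)%N then M else 0).
  have hi := hM (u - i%:R).
  have [ik|ik] := boolP [exists j : 'I_4, (i + j == k)%N].
    have /existsP[j jk] := ik.
    rewrite (bigD1 j)//= jk (le_trans (proj2 (andP hi)))// lerDl sumr_ge0// => l _.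
    by case: ifP.
  rewrite h0 ?sumr_ge0//; first by move=> l _; case: ifP.
  have [//|h1] := ltP (u - i%:R) (-1); first by left.
  have [//|h2] := ltP 2 (u - i%:R); first by right.
  exfalso; move/negP: ik; apply; apply/existsP.
  have iu : i%:R <= u + 1 by lra.
  have u1 : 0 <= u + 1 by rewrite (le_trans _ iu).
  move: kP; rewrite max_r// => /andP[ku uk].
  have ik : (i <= k)%N by rewrite -ltnS -(ltr_nat R) (le_lt_trans iu).
  have ki : (k - i < 4)%N.
    rewrite ltn_subLR// -(ltr_nat R) natrD.
    by apply: (le_lt_trans ku); lra.
  by exists (Ordinal ki); rewrite /= subnKC.
apply: (@le_trans _ _ (\sum_(i < n) \sum_(j < 4) (if (i + j == k)%N then M else 0))).
  by apply: ler_sum => i _; exact: step.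
rewrite exchange_big/=.
apply: (@le_trans _ _ (\sum_(j < 4) M)); last by rewrite sumr_const card_ord mulr_natl.
apply: ler_sum => j _.
rewrite -big_mkcond/=.
have [i ik|ne] := pickP [pred i : 'I_n | (i + j == k)%N]; last first.
  by rewrite big_pred0.
rewrite (big_pred1 i)// => l /=; apply/eqP/eqP => [lk|->]; last exact/eqP.
by apply/val_inj/eqP; rewrite -(eqn_add2r j) lk; move/eqP : ik => <-.
Qed.

Lemma continuous_window_bound (h : R -> R) : continuous h ->
  (forall t, t < -1 \/ 2 < t -> h t = 0) -> exists2 M : R, 0 < M & forall t, `|h t| <= M.
Proof.
move=> ch h0.
have /compact_bounded [M [Mreal hM]] : compact (h @` `[-1, 2]).
  apply: continuous_compact; last exact: segment_compact.
  by apply: continuous_subspaceT.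
exists (`|M| + 1); first by rewrite ltr_wpDl.
move=> t; have [h1|h1] := ltP t (-1).
  by rewrite h0; [rewrite normr0 addr_ge0|left].
have [h2|h2] := ltP 2 t.
  by rewrite h0; [rewrite normr0 addr_ge0|right].
apply: (hM (`|M| + 1)).
  by rewrite (le_lt_trans (ler_norm M))// ltrDl.
by exists t => //=; rewrite in_itv/= h1 h2.
Qed.

Lemma spline_bound : exists2 M : R, 0 < M & forall n u,
  \sum_(i < n) `|spline (u - i%:R)| <= M /\ \sum_(i < n) `|derive1 spline (u - i%:R)| <= M.
Proof.
have [||M1 M10 h1] := @continuous_window_bound spline.
- exact/nderivable_continuous/nderivable_spline.
- by move=> t [/ltW/spline_le|/ltW/spline_ge].
have [||M2 M20 h2] := @continuous_window_bound (derive1 spline).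
- by apply: nderivable_continuous; have [] := nderivable_spline 2.
- by move=> t [/derive1_spline_lt|/derive1_spline_gt].
exists (4 * (M1 + M2)) => [|n u]; first by rewrite mulr_gt0// addr_gt0.
split.
  apply: (@sum_window_bound (fun t => `|spline t|)) => t.
    by rewrite normr_ge0 (le_trans (h1 t))// lerDl ltW.
  by move=> [/ltW/spline_le|/ltW/spline_ge] ->; rewrite normr0.
apply: (@sum_window_bound (fun t => `|derive1 spline t|)) => t.
  by rewrite normr_ge0 (le_trans (h2 t))// lerDr ltW.
by move=> [/derive1_spline_lt|/derive1_spline_gt] ->; rewrite normr0.
Qed.

(** A second difference telescopes to first differences at the two ends. The bounds on [u] place
    these ends where [ramp] is exactly the identity or zero. *)
Lemma sum_spline n u : 1 <= u -> u <= n%:R - 1 -> \sum_(i < n) spline (u - i%:R) = 1.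
Proof.
move=> u1 un; pose a i := ramp (u - i%:R) - ramp (u - i%:R + 1).
have -> : \sum_(i < n) spline (u - i%:R) = \sum_(0 <= i < n) (a i.+1 - a i).
  rewrite big_mkord; apply: eq_bigr => i _; rewrite /spline /a.
  have -> : i.+1%:R = i%:R + 1 :> R by rewrite natr1.
  by rewrite opprD addrA subrK; ring.
rewrite telescope_sumr// /a !subr0 (@ramp_ge1 u)// (@ramp_ge1 (u + 1)); last lra.
by rewrite !ramp_le0; [ring|lra..].
Qed.

(** Summation by parts: the first moment of a second difference also telescopes, and again only the
    affine pieces of [ramp] survive at the ends. *)
Lemma sum_mul_spline n u : 1 <= u -> u <= n%:R - 1 ->
  \sum_(i < n) i%:R * spline (u - i%:R) = u.
Proof.
move=> u1 un.
pose a i : R := i%:R * (ramp (u - i%:R) - ramp (u - i%:R + 1)) - ramp (u - i%:R).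
have -> : \sum_(i < n) i%:R * spline (u - i%:R) = \sum_(0 <= i < n) (a i.+1 - a i).
  rewrite big_mkord; apply: eq_bigr => i _; rewrite /spline /a.
  have -> : i.+1%:R = i%:R + 1 :> R by rewrite natr1.
  by rewrite opprD addrA subrK; ring.
rewrite telescope_sumr// /a mul0r !subr0 (@ramp_ge1 u)//.
by rewrite !ramp_le0; [ring|lra..].
Qed.

Lemma is_derive1_shift f (u c df : R) : is_derive (u - c) 1 f df ->
  is_derive u 1 (fun v => f (v - c)) df.
Proof.
move=> fdf.
have := @is_derive1_comp _ f (fun v : R => v - c) u df (1 - 0) fdf
  (is_deriveB (is_derive_id u (1 : R)) (is_derive_cst c u (1 : R))).
by rewrite subr0 mulr1.
Qed.

Lemma is_derive_spline_shift (u c : R) :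
  is_derive u 1 (fun v => spline (v - c)) (derive1 spline (u - c)).
Proof. by apply: is_derive1_shift; exact: is_derive_spline. Qed.

(** Differentiates the identity of [sum_spline]; the inequalities are strict so that the identity
    holds in a neighbourhood of [u]. *)
Lemma sum_derive1_spline n u : 1 < u -> u < n%:R - 1 ->
  \sum_(i < n) derive1 spline (u - i%:R) = 0.
Proof.
move=> u1 un.
have h : is_derive u 1 (\sum_(i < n) (fun v : R => spline (v - i%:R)))
    (\sum_(i < n) derive1 spline (u - i%:R)).
  by apply: is_derive_sum => i; exact: is_derive_spline_shift.
have h2 : is_derive u 1 (cst 1 : R -> R) (\sum_(i < n) derive1 spline (u - i%:R)).
  apply: near_eq_is_derive h; near=> v; rewrite fct_sumE.
  apply: sum_spline; apply: ltW; near: v; [exact: lt_nbhsr|exact: lt_nbhsl].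
by rewrite -(@derive_val _ _ _ _ _ _ _ h2) derive_cst.
Unshelve. all: end_near. Qed.

Lemma sum_mul_derive1_spline n u : 1 < u -> u < n%:R - 1 ->
  \sum_(i < n) i%:R * derive1 spline (u - i%:R) = 1.
Proof.
move=> u1 un.
have h : is_derive u 1 (\sum_(i < n) ((i%:R : R) *: (fun v : R => spline (v - i%:R))))
    (\sum_(i < n) i%:R * derive1 spline (u - i%:R)).
  by apply: is_derive_sum => i; apply: is_deriveZ; exact: is_derive_spline_shift.
have h2 : is_derive u 1 (id : R -> R) (\sum_(i < n) i%:R * derive1 spline (u - i%:R)).
  apply: near_eq_is_derive h; near=> v; rewrite fct_sumE.
  apply: sum_mul_spline; apply: ltW; near: v; [exact: lt_nbhsr|exact: lt_nbhsl].
by rewrite -(@derive_val _ _ _ _ _ _ _ h2) derive_id.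
Unshelve. all: end_near. Qed.

End smooth_R.

(** * Smooth approximation on row vectors *)

Section continuous_real.
Context {R : realType} {T : topologicalType}.
Implicit Types f g : T -> R.

Lemma continuous_cst (c : R) : continuous (fun _ : T => c).
Proof. by move=> x; exact: cvg_cst. Qed.

Lemma continuous_add f g : continuous f -> continuous g -> continuous (fun x => f x + g x).
Proof. by move=> cf cg x; exact: (continuousD (cf x) (cg x)). Qed.

Lemma continuous_mul f g : continuous f -> continuous g -> continuous (fun x => f x * g x).
Proof. by move=> cf cg x; exact: (continuousM (cf x) (cg x)). Qed.

Lemma continuous_prod (I : Type) (r : seq I) (P : pred I) (F : I -> T -> R) :
  (forall k, continuous (F k)) -> continuous (fun x => \prod_(k <- r | P k) F k x).
Proof.
move=> cF; elim: r => [|k r IH].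
  by under eq_fun do rewrite big_nil; exact: continuous_cst.
under eq_fun do rewrite big_cons; case: (P k) => //.
by apply: continuous_mul; [exact: cF|exact: IH].
Qed.

Lemma continuous_sum (I : Type) (r : seq I) (P : pred I) (F : I -> T -> R) :
  (forall k, continuous (F k)) -> continuous (fun x => \sum_(k <- r | P k) F k x).
Proof.
move=> cF; elim: r => [|k r IH].
  by under eq_fun do rewrite big_nil; exact: continuous_cst.
under eq_fun do rewrite big_cons; case: (P k) => //.
by apply: continuous_add; [exact: cF|exact: IH].
Qed.

Lemma near_eq_continuous f g x : (\forall y \near x, g y = f y) ->
  {for x, continuous g} -> {for x, continuous f}.
Proof.
move=> gf cg; have E : g x = f x := nbhs_singleton gf.
have h : f y @[y --> x] --> g x by apply: cvg_trans cg; apply: (near_eq_cvg gf).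
by rewrite E in h.
Qed.

End continuous_real.

(** * Directional derivatives, classes [Ck] and product functions *)

Section rV_derive.
Context {R : realType} {d : nat}.
Implicit Types (x y z v : 'rV[R]_d) (f g : 'rV[R]_d -> R) (i j : 'I_d).

(** The two difference quotients are the same function of [h]. This transfers the one-variable
    differentiation rules to directional derivatives. *)
Lemma is_derive_lineP f x v df :
  is_derive x v f df <-> is_derive (0 : R) (1 : R) (fun t : R => f (t *: v + x)) df.
Proof.
have E : (fun h : R => h^-1 *: ((f \o shift x) (h *: v) - f x)) =
         (fun h : R => h^-1 *: (((fun t : R => f (t *: v + x)) \o shift (0 : R)) (h *: (1 : R)) - f ((0 : R) *: v + x))).
  apply/funext => h /=; rewrite addr0 scale0r add0r /GRing.scale/= mulr1//.
split=> -[h1 h2]; split.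
- by rewrite /derivable -E.
- by rewrite /derive -E.
- by rewrite /derivable E.
- by rewrite /derive E.
Qed.

Lemma is_derive_line f x v (t : R) df : is_derive (t *: v + x) v f df ->
  is_derive t (1 : R) (fun t : R => f (t *: v + x)) df.
Proof.
move=> /is_derive_lineP h.
have h1 : is_derive ((fun s : R => s - t) t) 1 (fun s : R => f (s *: v + (t *: v + x))) df.
  by rewrite subrr.
have h2 := is_derive1_shift h1.
rewrite [X in is_derive _ _ X _](_ : _ =
  (fun s : R => f ((s - t) *: v + (t *: v + x)))) => [//|].
by apply/funext => s /=; rewrite addrA -scalerDl subrK.
Qed.

Lemma is_derive_comp_rV (p : R -> R) f x v dp df :
  is_derive (f x) (1 : R) p dp -> is_derive x v f df ->
  is_derive x v (fun y => p (f y)) (dp * df).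
Proof.
move=> hp /is_derive_lineP hf; apply/is_derive_lineP.
apply: (is_derive1_comp _ hf).
by rewrite scale0r add0r.
Qed.

Lemma is_derive_coord x i j :
  is_derive x (e_ i) (fun y : 'rV[R]_d => y 0 j) (i == j)%:R.
Proof.
apply/is_derive_lineP.
have h := is_deriveD (is_deriveZ ((i == j)%:R : R) (is_derive_id (0 : R) (1 : R)))
  (is_derive_cst (x 0 j) (0 : R) (1 : R)).
rewrite addr0 [X in is_derive _ _ _ X]mulr1 in h.
rewrite [X in is_derive _ _ X _](_ : _ = (i == j)%:R \*: id + cst (x 0 j))//.
apply/funext => t.
by rewrite !mxE eqxx /= eq_sym; congr (_ + _); rewrite mulrC.
Qed.

(** Walks from [x] to [y] changing one coordinate at a time, so that partial derivatives alone
    control increments. *)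
Lemma rV_coordinate_induction (P : 'rV[R]_d -> Prop) x y :
  P x -> (forall i z, (forall j, z 0 j = x 0 j \/ z 0 j = y 0 j) -> z 0 i = x 0 i ->
     P z -> P (z + (y 0 i - x 0 i) *: e_ i)) -> P y.
Proof.
move=> Px IH.
pose z k : 'rV[R]_d := \row_j if (j < k)%N then y 0 j else x 0 j.
have zE : z d = y by apply/rowP => j; rewrite mxE ltn_ord.
rewrite -zE; suff : forall k, (k <= d)%N -> P (z k) by apply.
elim=> [_|k IHk kd].
  by rewrite (_ : z 0%N = x)//; apply/rowP => j; rewrite mxE.
have := IH (Ordinal kd) (z k) _ _ (IHk (ltnW kd)).
rewrite (_ : z k + _ = z k.+1).
  by apply=> [j|]; rewrite !mxE; [case: ifP; [right|left]|rewrite /= ltnn].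
apply/rowP => j; rewrite !mxE eqxx/= ltnS (leq_eqVlt j k) -val_eqE/=.
case: (eqVneq (j : nat) k) => [jk|jk] /=; last by rewrite mulr0 addr0.
by rewrite jk ltnn mulr1 (_ : Ordinal kd = j) ?subrKC//; exact/val_inj.
Qed.

(* The set [D] is a box in the coordinates: points obtained by mixing the
   coordinates of [x] and [y] and segments between them stay in [D]. *)
Lemma lipschitz_of_partial f (df : 'I_d -> 'rV[R]_d -> R) (D : set 'rV[R]_d) (L : R) x y :
  (forall z, (forall j, Num.min (x 0 j) (y 0 j) <= z 0 j <= Num.max (x 0 j) (y 0 j)) -> D z) ->
  (forall i z, D z -> is_derive z (e_ i) f (df i z) /\ `|df i z| <= L) ->
  `|f y - f x| <= L * \sum_j `|y 0 j - x 0 j|.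
Proof.
move=> Dxy dfL.
pose P (z : 'rV[R]_d) := `|f z - f x| <= L * \sum_j `|z 0 j - x 0 j|.
apply: (@rV_coordinate_induction P x y).
  by rewrite /P subrr normr0 big1 ?mulr0// => j _; rewrite subrr normr0.
move=> i z zj zi Pz; rewrite /P.
set t := y 0 i - x 0 i.
have tE j : (z + t *: e_ i) 0 j = if j == i then y 0 i else z 0 j.
  rewrite !mxE eqxx /=; case: eqP => [->|_]; last by rewrite mulr0 addr0.
  by rewrite mulr1 /t zi subrKC.
have step : `|f (z + t *: e_ i) - f z| <= L * `|t|.
  have Dz s : Num.min 0 t <= s <= Num.max 0 t -> D (s *: e_ i + z).
    move=> /andP[s1 s2]; apply: Dxy => j; rewrite !mxE eqxx/=.
    case: eqP => [->|_] /=; last first.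
      rewrite mulr0 add0r; case: (zj j) => ->; first by rewrite ge_min le_max !lexx.
      by rewrite ge_min le_max !lexx !orbT.
    move: s1 s2; rewrite mulr1 zi /t.
    have [h|/ltW h] := leP (x 0 i) (y 0 i).
      by rewrite min_l ?max_r ?subr_ge0// => *; apply/andP; split; lra.
    by rewrite min_r ?max_l ?subr_le0// => *; apply/andP; split; lra.
  have drv s : Num.min 0 t <= s <= Num.max 0 t ->
      is_derive s (1 : R) (fun s : R => f (s *: e_ i + z)) (df i (s *: e_ i + z)).
    by move=> /Dz Ds; apply: is_derive_line; have [] := dfL i _ Ds.
  have cont a b : Num.min 0 t <= a -> b <= Num.max 0 t ->
      {within `[a, b], continuous (fun s : R => f (s *: e_ i + z))}.
    move=> ta tb; apply: derivable_within_continuous => s; rewrite in_itv/= => /andP[h1 h2].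
    have /drv[] // : Num.min 0 t <= s <= Num.max 0 t.
    by rewrite (le_trans ta h1) (le_trans h2 tb).
  have [t0|t0|t0] := ltgtP 0 t; last by rewrite -t0 scale0r addr0 subrr normr0 mulr0.
  - have [||c ct E] := @MVT _ (fun s : R => f (s *: e_ i + z)) (fun s => df i (s *: e_ i + z)) 0 t t0.
    + move=> s; rewrite in_itv/= => /andP[h1 h2]; apply: drv.
      by rewrite min_l ?max_r ?(ltW t0)// !ltW.
    + by apply: cont; [rewrite min_l// ltW|rewrite max_r// ltW].
    rewrite (addrC z); rewrite scale0r add0r subr0 in E; rewrite E normrM.
    rewrite ler_wpM2r// (proj2 (dfL i _ _))//; apply: Dz.
    by move: ct; rewrite in_itv/= => /andP[h1 h2]; rewrite min_l ?max_r ?(ltW t0)// !ltW.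
  - have [||c ct E] := @MVT _ (fun s : R => f (s *: e_ i + z)) (fun s => df i (s *: e_ i + z)) t 0 t0.
    + move=> s; rewrite in_itv/= => /andP[h1 h2]; apply: drv.
      by rewrite min_r ?max_l ?(ltW t0)// !ltW.
    + by apply: cont; [rewrite min_r// ltW|rewrite max_l// ltW].
    rewrite distrC (addrC z); rewrite scale0r add0r sub0r in E; rewrite E normrM normrN.
    rewrite ler_wpM2r// (proj2 (dfL i _ _))//; apply: Dz.
    by move: ct; rewrite in_itv/= => /andP[h1 h2]; rewrite min_r ?max_l ?(ltW t0)// !ltW.
have -> : \sum_j `|(z + t *: e_ i) 0 j - x 0 j| = `|t| + \sum_j `|z 0 j - x 0 j|.
  rewrite (bigD1 i)//= [in RHS](bigD1 i)//= tE eqxx zi subrr normr0 add0r; congr (_ + _).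
  by apply: eq_bigr => j /negbTE ji; rewrite tE ji.
rewrite mulrDr (le_trans _ (lerD step Pz))// (le_trans _ (ler_normD _ _))//.
by rewrite addrA subrK.
Qed.

Lemma is_derive_bigsum (I : Type) (r : seq I) (F : I -> 'rV[R]_d -> R) x v (dF : I -> R) :
  (forall k, is_derive x v (F k) (dF k)) ->
  is_derive x v (fun y => \sum_(k <- r) F k y) (\sum_(k <- r) dF k).
Proof.
move=> dFk; elim: r => [|k r IH].
  by rewrite big_nil; under eq_fun do rewrite big_nil; exact: is_derive_cst.
rewrite big_cons; under eq_fun do rewrite big_cons.
exact: (is_deriveD (dFk k) IH).
Qed.

Lemma Ck_continuous k f : Ck k f -> continuous f.
Proof. by case: k => [[]|k []]. Qed.

Lemma CkS k f (df : 'I_d -> 'rV[R]_d -> R) : continuous f ->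
  (forall i x, is_derive x (e_ i) f (df i x)) -> (forall i, Ck k (df i)) -> Ck k.+1 f.
Proof.
move=> cf fdf kdf; split=> // i; split; first by move=> x; have [] := fdf i x.
suff -> : partial i f = df i by [].
by apply/funext => x; rewrite /partial; exact: derive_val.
Qed.

Lemma Ck1_is_derive k f x i : Ck k.+1 f -> is_derive x (e_ i) f (partial i f x).
Proof. by move=> [_ /(_ i)[df _]]; exact: DeriveDef. Qed.

Lemma Ck_cst k (c : R) : Ck k (fun _ : 'rV[R]_d => c).
Proof.
elim: k c => [|k IH] c; first by split => //; exact: continuous_cst.
apply: (@CkS _ _ (fun _ _ => 0)) => //; first exact: continuous_cst.

Qed.

Lemma CkD k f g : Ck k f -> Ck k g -> Ck k (fun x => f x + g x).
Proof.
elim: k f g => [|k IH] f g kf kg.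
  by split => //; apply: continuous_add; [exact: (Ck_continuous kf)|exact: (Ck_continuous kg)].
apply: (@CkS _ _ (fun i x => partial i f x + partial i g x)).
- by apply: continuous_add; [exact: (Ck_continuous kf)|exact: (Ck_continuous kg)].
- by move=> i x; apply: is_deriveD; apply: (@Ck1_is_derive k).
- by move=> i; apply: IH; [have [_ /(_ i)[]] := kf|have [_ /(_ i)[]] := kg].
Qed.

Lemma CkZ k (c : R) f : Ck k f -> Ck k (fun x => c * f x).
Proof.
elim: k f => [|k IH] f kf.
  by split => //; apply: continuous_mul; [exact: continuous_cst|exact: (Ck_continuous kf)].
apply: (@CkS _ _ (fun i x => c * partial i f x)).
- by apply: continuous_mul; [exact: continuous_cst|exact: (Ck_continuous kf)].
- by move=> i x; apply: is_deriveZ; exact: (@Ck1_is_derive k).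
- by move=> i; apply: IH; have [_ /(_ i)[]] := kf.
Qed.

Lemma Ck_sum k (I : Type) (r : seq I) (F : I -> 'rV[R]_d -> R) :
  (forall l, Ck k (F l)) -> Ck k (fun x => \sum_(l <- r) F l x).
Proof.
move=> kF; elim: r => [|l r IH].
  by under eq_fun do rewrite big_nil; exact: Ck_cst.
by under eq_fun do rewrite big_cons; exact: CkD.
Qed.

Definition tensor (G : 'I_d -> R -> R) x := \prod_j G j (x 0 j).

Definition upd (G : 'I_d -> R -> R) i (h : R -> R) j := if j == i then h else G j.

Lemma is_derive_tensor (G : 'I_d -> R -> R) i x (h : R -> R) :
  is_derive (x 0 i) (1 : R) (G i) (h (x 0 i)) ->
  is_derive x (e_ i) (tensor G) (tensor (upd G i h) x).
Proof.
move=> Gh.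
have H := is_derive_comp_rV Gh (is_derive_coord x i i).
rewrite eqxx mulr1 in H; apply/is_derive_lineP; move/is_derive_lineP : H => H.
have H2 := is_deriveZ (\prod_(j | j != i) G j (x 0 j)) H.
rewrite /tensor (bigD1 i)//= {1}/upd eqxx mulrC.
rewrite (eq_bigr (fun j => G j (x 0 j))); last by move=> j /negbTE ji; rewrite /upd ji.
rewrite [X in is_derive _ _ X _](_ : _ =
  \prod_(j | j != i) G j (x 0 j) \*: (fun t : R => G i ((t *: e_ i + x) 0 i)))//.
apply/funext => t; rewrite (bigD1 i)//= mulrC; congr (_ * _).
apply: eq_bigr => j ji; congr G; rewrite !mxE eqxx /= (negbTE ji).
by rewrite mulr0 add0r.
Qed.

(** A partial derivative of a product function is again a product function, with one factor
    differentiated; this is what the induction uses. *)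
Lemma Ck_tensor k (G : 'I_d -> R -> R) : (forall j, smoothR (G j)) -> Ck k (tensor G).
Proof.
have ct G' : (forall j, smoothR (G' j)) -> continuous (tensor G').
  move=> sG; apply: continuous_prod => j x.
  apply: (@continuous_comp _ _ _ (fun y : 'rV[R]_d => y 0 j) (G' j)); first exact: coord_continuous.
  exact: (nderivable_continuous (sG j 1%N)).
elim: k G => [|k IH] G sG; first by split=> //; exact: ct.
apply: (@CkS _ _ (fun i => tensor (upd G i (derive1 (G i))))).
- exact: ct.
- move=> i x; apply: is_derive_tensor; exact: (nderivable_is_derive _ (sG i 1%N)).
- move=> i; apply: IH => j l; rewrite /upd; case: eqP => [_|_]; last exact: sG.
  by have [] := sG i l.+1.
Qed.

End rV_derive.

(** * Interpolation on a grid of mesh [eps] by smooth hat functions *)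

Section quasi_interpolant.
Context {R : realType} {d : nat}.
Variables (eps : R) (N n : nat).
Hypothesis eps0 : 0 < eps.
Implicit Types (x y : 'rV[R]_d) (f : 'rV[R]_d -> R) (i j : 'I_d) (z : {ffun 'I_d -> 'I_n}).

(** [N] recentres the grid: the indices start at [0], while the nodes must cover a cube around the
    origin. *)
Definition node z : 'rV[R]_d := \row_j (eps * ((z j : nat)%:R - N%:R)).

(** Position in grid units, in which node [z] has the integer coordinates [z j]. *)
Definition uc x j : R := eps^-1 * x 0 j + N%:R.

Definition hat z : 'rV[R]_d -> R :=
  tensor (fun j t => spline (eps^-1 * t + (N%:R - (z j : nat)%:R))).

Definition dhat i z : 'rV[R]_d -> R := fun x => eps^-1 *
  \prod_j (if j == i then derive1 spline else spline) (uc x j - (z j : nat)%:R).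

(** Gradients of affine functions are reproduced exactly away from the rim of the grid ([sum_dhat]
    and [sum_node_dhat]); this makes gradients converge along with values. *)
Definition qi f x : R := \sum_z f (node z) * hat z x.

Definition dqi f i x : R := \sum_z f (node z) * dhat i z x.

Lemma hatE z x : hat z x = \prod_j spline (uc x j - (z j : nat)%:R).
Proof. by apply: eq_bigr => j _; rewrite /uc addrA. Qed.

Lemma is_derive_hat z i x : is_derive x (e_ i) (hat z) (dhat i z x).
Proof.
have h : is_derive (x 0 i) (1 : R)
    (fun t : R => spline (eps^-1 * t + (N%:R - (z i : nat)%:R)))
    (eps^-1 * derive1 spline (eps^-1 * x 0 i + (N%:R - (z i : nat)%:R))).
  rewrite mulrC.
  have h1 := is_deriveD (is_deriveZ eps^-1 (is_derive_id (x 0 i) (1 : R)))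
    (is_derive_cst (N%:R - (z i : nat)%:R : R) (x 0 i) (1 : R)).
  rewrite addr0 [X in is_derive _ _ _ X]mulr1 in h1.
  apply: (@is_derive1_comp _ spline (fun t : R => eps^-1 * t + (N%:R - (z i : nat)%:R)) _ _ _ _ h1).
  exact: is_derive_spline.
have := is_derive_tensor (h := fun t => eps^-1 * derive1 spline (eps^-1 * t + (N%:R - (z i : nat)%:R)))
  (G := fun j t => spline (eps^-1 * t + (N%:R - (z j : nat)%:R))) h.
move=> /is_derive_eq; apply.
rewrite /tensor /dhat (bigD1 i)//= [in RHS](bigD1 i)//= {1}/upd !eqxx /uc -!addrA -mulrA.
by congr (_ * (_ * _)); apply: eq_bigr => j /negbTE ji; rewrite /upd ji -addrA.
Qed.

Lemma smooth_qi f : smooth (qi f).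
Proof.
move=> k; apply: Ck_sum => z; apply: CkZ; apply: Ck_tensor => j l.
exact/nderivable_affine/nderivable_spline.
Qed.

Lemma is_derive_qi f i x : is_derive x (e_ i) (qi f) (dqi f i x).
Proof.
apply: is_derive_bigsum => z; apply: is_deriveZ; exact: is_derive_hat.
Qed.

Lemma hat_neq0 z x : hat z x != 0 -> forall j, `|x 0 j - node z 0 j| <= 2 * eps.
Proof.
rewrite hatE => h j; have /spline_neq0 : spline (uc x j - (z j : nat)%:R) != 0.
  by apply: contraNneq h => h; rewrite (bigD1 j)//= h mul0r.
rewrite /uc mxE => h1.
rewrite -ler_pdivrMr// -(gtr0_norm eps0) -normfV -normrM mulrC (gtr0_norm eps0).
rewrite mulrBr mulKf ?gt_eqF// opprB ler_norml; move: h1.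
by move: (eps^-1 * _) => v /andP[h1 h2]; apply/andP; split; lra.
Qed.

Lemma dhat_neq0 i z x : dhat i z x != 0 -> forall j, `|x 0 j - node z 0 j| <= 2 * eps.
Proof.
rewrite /dhat => h j.
have h1 : (if j == i then derive1 spline else spline) (uc x j - (z j : nat)%:R) != 0.
  by apply: contraNneq h => h; rewrite (bigD1 j)//= h mul0r mulr0.
have {h1} : -1 <= uc x j - (z j : nat)%:R <= 2.
  rewrite leNgt [X in _ && X]leNgt -negb_or; apply: contra h1 => /orP[] h1.
    by case: ifP => _; rewrite ?derive1_spline_lt ?spline_le// ltW.
  by case: ifP => _; rewrite ?derive1_spline_gt ?spline_ge// ltW.
rewrite /uc mxE => h1.
rewrite -ler_pdivrMr// -(gtr0_norm eps0) -normfV -normrM mulrC (gtr0_norm eps0).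
rewrite mulrBr mulKf ?gt_eqF// opprB ler_norml; move: h1.
by move: (eps^-1 * _) => v /andP[h1 h2]; apply/andP; split; lra.
Qed.

Section partition.
Variable x : 'rV[R]_d.
Hypothesis ux : forall j, 1 < uc x j < n%:R - 1.

(** Distributivity turns the sum over multi-indices of products into a product of one-dimensional
    sums. *)
Lemma sum_hat : \sum_z hat z x = 1.
Proof.
under eq_bigr do rewrite hatE.
rewrite -(bigA_distr_bigA (fun j (m : 'I_n) => spline (uc x j - (m : nat)%:R))).
by rewrite big1// => j _; have /andP[h1 h2] := ux j; rewrite sum_spline// ltW.
Qed.

Lemma sum_dhat i : \sum_z dhat i z x = 0.
Proof.
rewrite -mulr_sumr.
rewrite -(bigA_distr_bigA (fun j (m : 'I_n) =>
  (if j == i then derive1 spline else spline) (uc x j - (m : nat)%:R))).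
have /andP[h1 h2] := ux i.
by rewrite (bigD1 i)//= eqxx sum_derive1_spline// mul0r mulr0.
Qed.

(** First moments of the derived hats. For [i = k] the factor of index [i] is the first moment of
    [derive1 spline]; otherwise it is its plain sum, which vanishes. *)
Lemma sum_node_dhat i k : \sum_z (node z 0 k - x 0 k) * dhat i z x = (i == k)%:R.
Proof.
pose F j (m : 'I_n) := (if j == k then (m : nat)%:R - uc x k else 1) *
  (if j == i then derive1 spline else spline) (uc x j - (m : nat)%:R).
rewrite (eq_bigr (fun z : {ffun 'I_d -> 'I_n} => \prod_j F j (z j))); last first.
  move=> z _; rewrite /F big_split/= (bigD1 k)//= eqxx big1 ?mulr1; last first.
    by move=> j /negbTE ->.
  rewrite /dhat mulrA; congr (_ * _); rewrite mxE /uc; field; by rewrite gt_eqF.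
rewrite -(bigA_distr_bigA F) /F.
have E0 j : \sum_(m < n) derive1 spline (uc x j - (m : nat)%:R) = 0 :> R.
  by have /andP[h1 h2] := ux j; rewrite sum_derive1_spline.
have E1 j : \sum_(m < n) spline (uc x j - (m : nat)%:R) = 1 :> R.
  by have /andP[h1 h2] := ux j; rewrite sum_spline// ltW.
have [<-|ik] := eqVneq i k.
  rewrite (bigD1 i)//= eqxx (eq_bigr (fun m : 'I_n => (m : nat)%:R * derive1 spline (uc x i - (m : nat)%:R) -
    uc x i * derive1 spline (uc x i - (m : nat)%:R))); last by move=> m _; rewrite mulrBl.
  rewrite sumrB -mulr_sumr E0 mulr0 subr0.
  rewrite [X in _ * X]big1 ?mulr1; last first.
    move=> j /negbTE ->; under eq_bigr do rewrite mul1r. exact: E1.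
  by have /andP[h1 h2] := ux i; rewrite sum_mul_derive1_spline.
rewrite (bigD1 i)//= eqxx (negbTE ik).
by under eq_bigr do rewrite mul1r; rewrite E0 mul0r.
Qed.

End partition.

End quasi_interpolant.

(** A bounded number of nodes per axis sees a given point, so the constant is independent of the
    mesh, the offset and the number of nodes. *)
Lemma hat_bound {R : realType} (d : nat) : exists2 C : R, 0 < C &
  forall eps N n (x : 'rV[R]_d), 0 < eps ->
  \sum_(z : {ffun 'I_d -> 'I_n}) `|hat eps N z x| <= C /\
  forall i, \sum_(z : {ffun 'I_d -> 'I_n}) `|dhat eps N i z x| <= eps^-1 * C.
Proof.
have [M M0 hM] := @spline_bound R.
exists (M ^+ d) => [|eps N n x e0]; first by rewrite exprn_gt0.
have prodM (F : 'I_d -> 'I_n -> R) : (forall j m, 0 <= F j m) -> (forall j, \sum_m F j m <= M) ->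
    \sum_(z : {ffun 'I_d -> 'I_n}) \prod_j F j (z j) <= M ^+ d.
  move=> F0 FM; rewrite -bigA_distr_bigA.
  rewrite -[X in _ <= M ^+ X]card_ord -prodr_const; apply: ler_prod => j _.
  by rewrite sumr_ge0//=.
split.
  under eq_bigr do rewrite hatE normr_prod.
  apply: (prodM (fun j (m : 'I_n) => `|spline (uc eps N x j - (m : nat)%:R)|)) => // j.
  exact: (proj1 (hM n _)).
move=> i; under eq_bigr do rewrite /dhat normrM normr_prod gtr0_norm ?invr_gt0//.
rewrite -mulr_sumr ler_pM2l ?invr_gt0//.
apply: (prodM (fun j (m : 'I_n) => `|(if j == i then derive1 spline else spline) (uc eps N x j - (m : nat)%:R)|)) => // j.
case: ifP => _; [exact: (proj2 (hM n _))|exact: (proj1 (hM n _))].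
Qed.

(** * Compactness and uniform radii in row vectors *)

Section rV_compactness.
Context {R : realType} {d : nat}.
Implicit Types (x y : 'rV[R]_d) (D K : set 'rV[R]_d).

Lemma ball_rV_sub x y (e : R) : 0 < e -> (forall i, `|x 0 i - y 0 i| < e) -> ball x e y.
Proof. by move=> e0 h; apply/ball_rVP; split. Qed.

Lemma ball_coord x y (e : R) i : ball x e y -> `|x 0 i - y 0 i| < e.
Proof. by move=> /ball_rVP[_]. Qed.

Lemma bounded_rVP D : bounded_set D -> exists2 B : R, 0 < B & forall x i, D x -> `|x 0 i| <= B.
Proof.
move=> [M [_ hM]]; exists (`|M| + 2) => [|x i Dx]; first by rewrite ltr_wpDl.
have xM : `|x| <= `|M| + 1.
  by apply: hM => //; rewrite (le_lt_trans (ler_norm M))// ltrDl.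
have : ball (0 : 'rV[R]_d) (`|M| + 2) x.
  rewrite -ball_normE/= sub0r normrN (le_lt_trans xM)//; lra.
by move=> /(@ball_coord _ _ _ i); rewrite mxE sub0r normrN => /ltW.
Qed.

Lemma closure_coord_le D (B : R) : (forall x i, D x -> `|x 0 i| <= B) ->
  forall x i, closure D x -> `|x 0 i| <= B.
Proof.
move=> DB x i Dx; apply/ler_addgt0Pr => e e0.
have [y [Dy xy]] := Dx _ (nbhsx_ballx x e e0).
rewrite -[x 0 i](subrK (y 0 i)) (le_trans (ler_normD _ _))// addrC lerD//; first exact: DB.
exact/ltW/ball_coord.
Qed.

Lemma compact_rV D (B : R) : closed D -> (forall x i, D x -> `|x 0 i| <= B) -> compact D.
Proof.
move=> cD DB; apply: (@subclosed_compact _ _ [set v : 'rV[R]_d | forall i, `[- B, B]%classic (v ord0 i)]) => //.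
  by apply: (@rV_compact R d (fun=> `[- B, B]%classic)) => i; exact: segment_compact.
by move=> x Dx i /=; rewrite in_itv/= -ler_norml; exact: DB.
Qed.

Lemma compact_closure_rV D : bounded_set D -> compact (closure D).
Proof.
move=> /bounded_rVP[B B0 DB]; apply: (@compact_rV _ B).
  exact: closed_closure.
exact: closure_coord_le.
Qed.

(* Lebesgue-number argument: a local property that is stable under shrinking
   the radius holds with a uniform radius on a compact set. *)
Lemma compact_uniform_radius K (P : R -> 'rV[R]_d -> Prop) : compact K ->
  (forall x, K x -> exists2 r : R, 0 < r &
     forall y, ball x r y -> forall s, 0 < s -> s <= r -> P s y) ->
  exists2 r : R, 0 < r & forall s, 0 < s -> s <= r -> forall y, K y -> P s y.
Proof.
move=> /compact_near_coveringP cK KP.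
have /(_ _)/= h := cK R (0 : R)^'+ P (@at_right_proper_filter R 0).
have {}h : \forall s \near (0 : R)^'+, K `<=` P s.
  apply: h => x /KP[r r0 xr].
  exists (ball x r, [set s : R | 0 < s <= r]) => /=; last first.
    by move=> [y s] /= [xry /andP[s0 sr]]; exact: xr.
  split; first exact: nbhsx_ballx.
  by near=> s; apply/andP; split; [near: s; exact: nbhs_right_gt|near: s; exact: nbhs_right_le].
move: h => [r /= r0 h]; exists (r / 2); first by rewrite divr_gt0.
move=> s s0 sr y Ky; apply: (h s) => //=.
rewrite sub0r normrN gtr0_norm//; lra.
Unshelve. all: end_near. Qed.

Lemma open_compact_radius K D : compact K -> open D -> K `<=` D ->
  exists2 r : R, 0 < r & forall y, K y -> ball y r `<=` D.
Proof.
move=> cK oD KD.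
have [|r r0 h] := @compact_uniform_radius K (fun r y => ball y r `<=` D) cK.
  move=> x /KD Dx.
  have /nbhs_ballP[r /= r0 xr] : nbhs x D by apply: open_nbhs_nbhs; split.
  exists (r / 2); first by rewrite divr_gt0.
  move=> y xy s s0 sr z yz; apply: xr.
  apply: (@le_ball _ _ _ (r / 2 + s)); first lra.
  exact: ball_triangle xy yz.
by exists r => // y Ky; apply: (h r).
Qed.

Lemma continuous_compact_uniform K (f : 'rV[R]_d -> R) (e : R) : compact K ->
  continuous f -> 0 < e ->
  exists2 r : R, 0 < r & forall x y, K x -> ball x r y -> `|f y - f x| <= e.
Proof.
move=> cK cf e0.
have [|r r0 h] := @compact_uniform_radius K
    (fun r x => forall y, ball x r y -> `|f y - f x| <= e) cK.
  move=> x _; have e2 : 0 < e / 2 by rewrite divr_gt0.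
  have /nbhs_ballP[r /= r0 xr] := cf x _ (nbhsx_ballx (f x) _ e2).
  exists (r / 2); first by rewrite divr_gt0.
  move=> y xy s s0 sr z yz.
  have fy : ball (f x) (e / 2) (f y) by apply: xr; apply: le_ball xy; lra.
  have fz : ball (f x) (e / 2) (f z).
    apply: xr; apply: (@le_ball _ _ _ (r / 2 + s)); first lra.
    exact: ball_triangle xy yz.
  rewrite -(subrK (f x) (f z)) -addrA (le_trans (ler_normD _ _))//.
  move: fy fz; rewrite /ball/= => h1 h2; rewrite (distrC (f z)); lra.
by exists r => // x y Kx xy; apply: (h r r0 _ x Kx).
Qed.

Lemma continuous_within_bounded K (f : 'rV[R]_d -> R) : compact K ->
  {within K, continuous f} -> exists2 M : R, 0 < M & forall x, K x -> `|f x| <= M.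
Proof.
move=> cK cf.
have /compact_bounded [M [_ hM]] : compact (f @` K) by exact: continuous_compact.
exists (`|M| + 1); first by rewrite ltr_wpDl.
move=> x Kx; apply: (hM (`|M| + 1)); last by exists x.
by rewrite (le_lt_trans (ler_norm M))// ltrDl.
Qed.

End rV_compactness.

(** * Test functions approximate compactly supported C^1 functions *)

Section qi_approximation.
Context {R : realType} {d : nat}.
Variables (Om : set 'rV[R]_d).
Hypothesis bOm : bounded_set Om.
Implicit Types (f : 'rV[R]_d -> R).

Lemma qi_neq0 (eps : R) N n f x : 0 < eps -> qi eps N n f x != 0 ->
  exists2 y, f y != 0 & forall j, `|x 0 j - y 0 j| <= 2 * eps.
Proof.
move=> e0 h.
have [z zh] : exists z, f (@node R d eps N n z) * hat eps N z x != 0.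
  apply: contra_neqP h => h; rewrite /qi big1// => z _.
  by apply/eqP; apply: contra_notT h => h; exists z.
move: zh; rewrite mulf_eq0 negb_or => /andP[fz hz].
by exists (node eps N z) => //; exact: hat_neq0.
Qed.

(** The interpolant spreads the support by [2 * eps], and the closure costs [eps] more, which stays
    below [del]. *)
Lemma test_function_qi (eps del : R) N n f : 0 < eps -> 4 * eps <= del ->
  (forall y, f y != 0 -> ball y del `<=` Om) -> test_function Om (qi eps N n f).
Proof.
move=> e0 ed fOm.
have sub : closure [set x | qi eps N n f x != 0] `<=` Om.
  move=> x /(_ _ (nbhsx_ballx x eps e0)) [y [/= /(qi_neq0 e0)[z fz yz] xy]].
  apply: (fOm z fz); apply: ball_rV_sub; first lra.
  move=> j; have := yz j; have := ball_coord j xy.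
  move=> h1 h2; rewrite distrC -[x 0 j](subrK (y 0 j)) -addrA (le_lt_trans (ler_normD _ _))//; lra.
split => //; first exact: smooth_qi.
have [B B0 hB] := bounded_rVP bOm.
apply: (@compact_rV _ _ _ B); first exact: closed_closure.
by move=> x i /sub; exact: hB.
Qed.

Lemma qi_range (eps : R) : 0 < eps -> exists N, forall x j, Om x ->
  1 < uc eps N x j < (N + N.+1)%:R - 1.
Proof.
move=> e0; have [B B0 hB] := bounded_rVP bOm.
pose N := (Num.trunc (eps^-1 * B + 1)).+1; exists N => x j Ox.
have h : eps^-1 * B + 1 < N%:R by exact: truncnS_gt.
have : `|eps^-1 * x 0 j| <= eps^-1 * B.
  by rewrite normrM gtr0_norm ?invr_gt0// ler_pM2l ?invr_gt0// hB.
rewrite ler_norml /uc natrD -natr1 => /andP[h1 h2].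
by move: (eps^-1 * x 0 j) h1 h2 => v h1 h2; apply/andP; split; lra.
Qed.

(** The gradient is carried as data, so that sums, products and compositions come with an explicit
    derivative. One derivative is enough for this class; [C1c_approx] returns to test functions. *)
Definition C1c f (df : 'I_d -> 'rV[R]_d -> R) :=
  [/\ continuous f, forall i x, is_derive x (e_ i) f (df i x),
      forall i, continuous (df i) &
      exists K, [/\ compact K, K `<=` Om & forall x, ~ K x -> f x = 0]].

Lemma test_function_is_derive phi x i : test_function Om phi ->
  is_derive x (e_ i) phi (partial i phi x).
Proof. by move=> [s _ _]; exact: (@Ck1_is_derive _ _ 0 _ _ _ (s 1%N)). Qed.

Lemma test_function_C1c phi : test_function Om phi -> C1c phi (fun i => partial i phi).
Proof.
move=> tphi; have [s c sub] := tphi; split.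
- exact: (Ck_continuous (s 0%N)).
- by move=> i x; exact: test_function_is_derive.
- by move=> i; have [_ /(_ i)[_ [] ]] := s 1%N.
- exists (closure [set x | phi x != 0]); split => // x h.
  by apply/eqP; apply: contra_notT h => h; exact: subset_closure.
Qed.

Lemma C1c_derive0 f df i x : C1c f df -> ~ Om x -> df i x = 0.
Proof.
move=> [cf dff _ [K [cK KO K0]]] nO.
have dfx := dff i x.
have h : is_derive x (e_ i) (cst 0 : 'rV[R]_d -> R) (df i x).
  apply: near_eq_is_derive dfx.
  have : nbhs x (~` K).
    apply: open_nbhs_nbhs; split; last by move=> /KO.
    by apply: closed_openC; apply: compact_closed => //; exact: norm_hausdorff.
  by apply: filterS => y; exact: K0.
by rewrite -(@derive_val _ _ _ _ _ _ _ h) derive_cst.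
Qed.

(** Both errors are sums of increments weighted by [hat] or [dhat]. The weights [dhat] add up to
    order [eps^-1], which is compensated by increments of order [eps], so the mesh cancels. *)
Lemma C1c_approx f df (e : R) : open Om -> C1c f df -> 0 < e ->
  exists2 phi, test_function Om phi &
    forall x, Om x -> `|phi x - f x| <= e /\ forall i, `|partial i phi x - df i x| <= e.
Proof.
move=> oOm [cf dff cdf [K [cK KO K0]]] e0.
have [C C0 hC] := @hat_bound R d.
have [del del0 hdel] := open_compact_radius cK oOm KO.
pose D := closure Om.
have cD : compact D by exact: compact_closure_rV.
(* Admissible oscillation of [f] and of its gradient. [C] pays for the weights, and the second entry
   also absorbs the factor [2 * d] of the gradient estimate, with [+ 1] for a positive
   denominator. *)
pose w := Num.min (e / C) (e / C / (2 * d%:R + 1)).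
have d1 : 0 < 2 * d%:R + 1 :> R by rewrite ltr_wpDl// mulr_ge0.
have w0 : 0 < w by rewrite lt_min !divr_gt0.
have [r0 r00 hr0] := continuous_compact_uniform cD cf w0.
have [r1 r10 hr1] : exists2 r : R, 0 < r & forall i x y, D x -> ball x r y -> `|df i y - df i x| <= w.
  have /choice[r hr] : forall i, exists r : R, 0 < r /\ forall x y, D x -> ball x r y -> `|df i y - df i x| <= w.
    by move=> i; have [r ? ?] := continuous_compact_uniform cD (cdf i) w0; exists r.
  exists (\big[Num.min/1]_i r i).
    by apply: lt_bigmin => // i _; have [] := hr i.
  move=> i x y Dx xy; apply: (proj2 (hr i)) => //; apply: le_ball xy.
  exact: bigmin_le_cond.
pose eps := Num.min (Num.min (r0 / 4) (r1 / 4)) (del / 4).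
have eps0 : 0 < eps by rewrite !lt_min !divr_gt0.
have [er0 er1 ed] : [/\ 4 * eps <= r0, 4 * eps <= r1 & 4 * eps <= del].
  have : eps <= eps by [].
  by rewrite {2}/eps !le_min => /andP[/andP[? ?] ?]; split; lra.
have [N hN] := qi_range eps0.
exists (@qi R d eps N (N + N.+1) f).
  apply: (test_function_qi _ _ eps0 ed) => y fy; apply: hdel.
  by apply: contrapT => /K0 fy0; rewrite fy0 eqxx in fy.
move=> x Ox.
have ux j : 1 < uc eps N x j < (N + N.+1)%:R - 1 by exact: hN.
have Dx : D x by exact: subset_closure.
have [S1 S2] := hC eps N (N + N.+1)%N x eps0.
have nodeball (z : 'rV[R]_d) s : 4 * eps <= s -> (forall j, `|x 0 j - z 0 j| <= 2 * eps) -> ball x s z.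
  by move=> es h; apply: ball_rV_sub; [lra|move=> j; have := h j; lra].
split.
  have -> : qi eps N (N + N.+1) f x - f x = \sum_z (f (@node R d eps N (N + N.+1) z) - f x) * hat eps N z x.
    rewrite /qi -[X in _ - X]mulr1 -[in X in _ - X](sum_hat ux) mulr_sumr -sumrB.
    by apply: eq_bigr => z _; rewrite mulrBl.
  apply: (@le_trans _ _ (\sum_z w * `|@hat R d eps N (N + N.+1) z x|)).
    rewrite (le_trans (ler_norm_sum _ _ _))//; apply: ler_sum => z _; rewrite normrM.
    have [->|hz] := eqVneq (hat eps N z x) 0; first by rewrite normr0 !mulr0.
    rewrite ler_wpM2r// hr0//; apply: nodeball => //; exact: hat_neq0.
  rewrite -mulr_sumr (@le_trans _ _ (w * C))// ?ler_pM2l// -ler_pdivlMr//.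
  by rewrite ge_min lexx.
move=> i; rewrite (_ : partial i _ x = dqi eps N (N + N.+1) f i x); last first.
  exact: (@derive_val _ _ _ _ _ _ _ (is_derive_qi _ _ _ f i x)).
(* Removes from [f] the linear part of its tangent at [x], whose gradient is reproduced exactly.
   What remains has gradient [df y - df x], small near [x]. *)
pose T (y : 'rV[R]_d) := f y - \sum_k (y 0 k - x 0 k) * df k x.
have TE : dqi eps N (N + N.+1) f i x - df i x =
    \sum_z (T (@node R d eps N (N + N.+1) z) - T x) * dhat eps N i z x.
  have -> : \sum_z (T (@node R d eps N (N + N.+1) z) - T x) * dhat eps N i z x =
      dqi eps N (N + N.+1) f i x - (\sum_k df k x * \sum_z (@node R d eps N (N + N.+1) z 0 k - x 0 k) * dhat eps N i z x) - f x * \sum_z @dhat R d eps N (N + N.+1) i z x.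
    under [in X in _ - X - _]eq_bigr do rewrite mulr_sumr.
    rewrite exchange_big/= mulr_sumr -!sumrB; apply: eq_bigr => z _.
    have -> : T x = f x.
      by rewrite /T big1 ?subr0// => k _; rewrite subrr mul0r.
    rewrite /T !mulrBl mulr_suml; congr (_ - _ - _); apply: eq_bigr => k _.
    by rewrite mulrA (mulrC (df k x)).
  rewrite (sum_dhat ux) mulr0 subr0; congr (_ - _).
  under eq_bigr do rewrite (sum_node_dhat eps0 ux).
  by rewrite (bigD1 i)//= eqxx mulr1 big1 ?addr0// => k /negbTE; rewrite eq_sym => ->; rewrite mulr0.
have dT k (y : 'rV[R]_d) : is_derive y (e_ k) T (df k y - df k x).
  apply: is_deriveB => //.
  have := @is_derive_bigsum R d 'I_d (index_enum 'I_d) (fun l (y : 'rV[R]_d) => (y 0 l - x 0 l) * df l x)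
    y (e_ k) (fun l => df l x * (k == l)%:R).
  rewrite (bigD1 k)//= eqxx mulr1 big1 ?addr0; last first.
    by move=> l /negbTE; rewrite eq_sym => ->; rewrite mulr0.
  apply => l.
  have := is_deriveZ (df l x) (is_deriveB (is_derive_coord y k l) (is_derive_cst (x 0 l) y (e_ k))).
  rewrite subr0; congr is_derive; apply/funext => u; rewrite mulrC//.
have LT (z : 'rV[R]_d) : (forall j, `|x 0 j - z 0 j| <= 2 * eps) -> `|T z - T x| <= w * (d%:R * (2 * eps)).
  move=> zx; apply: (@le_trans _ _ (w * \sum_j `|z 0 j - x 0 j|)); last first.
    rewrite ler_pM2l//.
    have -> : d%:R * (2 * eps) = \sum_(j < d) 2 * eps by rewrite sumr_const card_ord mulr_natl.
    by apply: ler_sum => j _; rewrite distrC.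
  apply: (@lipschitz_of_partial _ _ T (fun k y => df k y - df k x) [set u | forall j, `|x 0 j - u 0 j| <= 2 * eps]).
    move=> u hu j; have := hu j; have := zx j.
    rewrite !ler_norml /Num.min /Num.max => /andP[h1 h2].
    by case: ltP => h3 /andP[h4 h5]; apply/andP; split; lra.
  by move=> k u hu; split => //; apply: hr1 => //; exact: nodeball.
rewrite TE.
apply: (@le_trans _ _ (\sum_z w * (d%:R * (2 * eps)) * `|@dhat R d eps N (N + N.+1) i z x|)).
  rewrite (le_trans (ler_norm_sum _ _ _))//; apply: ler_sum => z _; rewrite normrM.
  have [->|hz] := eqVneq (dhat eps N i z x) 0; first by rewrite normr0 !mulr0.
  rewrite ler_wpM2r// LT//; exact: dhat_neq0 hz.
rewrite -mulr_sumr.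
apply: (@le_trans _ _ (w * (d%:R * (2 * eps)) * (eps^-1 * C))).
  by rewrite ler_wpM2l// ?mulr_ge0// ltW.
have -> : w * (d%:R * (2 * eps)) * (eps^-1 * C) = (w * C) * (2 * d%:R).
  by field; rewrite gt_eqF.
apply: (@le_trans _ _ ((w * C) * (2 * d%:R + 1))).
  by rewrite ler_pM2l ?mulr_gt0// lerDl.
by rewrite -ler_pdivlMr// -ler_pdivlMr// mulrAC ge_min lexx orbT.
Qed.

End qi_approximation.

(** * Square-integrable functions *)

Section square_integrable.
Context {disp : measure_display} {T : measurableType disp} {R : realType}.
Variables (mu : {measure set T -> \bar R}) (D : set T).
Hypothesis mD : measurable D.
Implicit Types (u v w : T -> R).

Definition sqint u := measurable_fun D u /\ (\int[mu]_(x in D) ((u x) ^+ 2)%:E < +oo)%E.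

Definition L2_ip u v : R := \int[mu]_(x in D) (u x * v x).

Local Notation ip := L2_ip.

Lemma integrable_sqr u : sqint u -> mu.-integrable D (fun x => ((u x) ^+ 2)%:E).
Proof.
move=> [mu_ fu]; apply/integrableP; split.
  by apply/measurable_EFinP; exact: measurable_funX.
under eq_integral do rewrite gee0_abs ?lee_fin ?sqr_ge0//.
exact: fu.
Qed.

Lemma sqint_integrable u : measurable_fun D u ->
  mu.-integrable D (fun x => ((u x) ^+ 2)%:E) -> sqint u.
Proof.
move=> mu_ /integrableP[_ h]; split => //; apply: le_lt_trans h.
rewrite le_eqVlt; apply/orP; left; apply/eqP; apply: eq_integral => x _.
by rewrite gee0_abs// lee_fin sqr_ge0.
Qed.

Lemma sqint_le u v : measurable_fun D u -> sqint v ->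
  {ae mu, forall x, D x -> `|u x| <= `|v x|} -> sqint u.
Proof.
move=> mu_ sv uv; split => //; have [mv fv] := sv; apply: le_lt_trans fv.
apply: ae_ge0_le_integral => //.
- by move=> x _; rewrite lee_fin sqr_ge0.
- by apply/measurable_EFinP; exact: measurable_funX.
- by move=> x _; rewrite lee_fin sqr_ge0.
- by apply/measurable_EFinP; exact: measurable_funX.
apply: filterS uv => x h /h; rewrite lee_fin.
by rewrite -(real_normK (num_real (u x))) -(real_normK (num_real (v x))) => uv; rewrite lerXn2r ?nnegrE.
Qed.

Lemma sqintM_integrable u v : sqint u -> sqint v ->
  mu.-integrable D (fun x => (u x * v x)%:E).
Proof.
move=> su sv; have [mu_ _] := su; have [mv _] := sv.
apply: (@le_integrable _ _ _ mu D mD _ (fun x => ((u x) ^+ 2 + (v x) ^+ 2)%:E)).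
- by apply/measurable_EFinP; exact: measurable_funM.
- move=> x _; rewrite lee_fin normrM (ger0_norm (addr_ge0 (sqr_ge0 _) (sqr_ge0 _))).
  rewrite -(real_normK (num_real (u x))) -(real_normK (num_real (v x))).
  have := sqr_ge0 (`|u x| - `|v x|); have := normr_ge0 (u x); have := normr_ge0 (v x).
  by move: (`|u x|) (`|v x|) => a b *; nra.
- under eq_fun do rewrite EFinD.
  by apply: integrableD => //; exact: integrable_sqr.
Qed.

Lemma sqintD u v : sqint u -> sqint v -> sqint (fun x => u x + v x).
Proof.
move=> su sv; have [mu_ _] := su; have [mv _] := sv.
apply: sqint_integrable; first exact: measurable_funD.
under eq_fun do rewrite sqrrD EFinD EFinD.
apply: integrableD => //; last exact: integrable_sqr.
apply: integrableD => //; first exact: integrable_sqr.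
under eq_fun do rewrite -mulr_natl EFinM.
by apply: integrableZl => //; exact: sqintM_integrable.
Qed.

Lemma sqintZ (k : R) u : sqint u -> sqint (fun x => k * u x).
Proof.
move=> su; have [mu_ _] := su.
apply: sqint_integrable; first by apply: measurable_funM => //; exact: measurable_cst.
under eq_fun do rewrite exprMn EFinM.
by apply: integrableZl => //; exact: integrable_sqr.
Qed.

Lemma sqintN u : sqint u -> sqint (fun x => - u x).
Proof. by move=> /(sqintZ (-1)); under eq_fun do rewrite mulN1r. Qed.

Lemma sqintB u v : sqint u -> sqint v -> sqint (fun x => u x - v x).
Proof. by move=> su sv; apply: sqintD => //; exact: sqintN. Qed.

Lemma sqint0 : sqint (fun=> 0).
Proof.
split; first exact: measurable_cst.
by under eq_integral do rewrite expr0n; rewrite integral0.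
Qed.

Lemma sqint_bounded (M : R) u : (mu D < +oo)%E -> measurable_fun D u ->
  {ae mu, forall x, D x -> `|u x| <= M} -> sqint u.
Proof.
move=> Doo mu_ uM; apply: (@sqint_le _ (fun=> M)) => //.
  split; first exact: measurable_cst.
  rewrite integral_cst// lte_mul_pinfty// lee_fin sqr_ge0//.
apply: filterS uM => x h Dx; rewrite (le_trans (h Dx))// ler_norm//.
Qed.

Lemma sqint_mul_bounded (M : R) u v : measurable_fun D u ->
  {ae mu, forall x, D x -> `|u x| <= M} -> sqint v -> sqint (fun x => u x * v x).
Proof.
move=> mu_ uM sv; have [mv _] := sv.
apply: (@sqint_le _ (fun x => M * v x)) => //; first exact: measurable_funM.
  exact: sqintZ.
apply: filterS uM => x h Dx; rewrite !normrM ler_wpM2r// (le_trans (h Dx))// ler_norm//.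
Qed.

Lemma ipC u v : ip u v = ip v u.
Proof. by apply: eq_Rintegral => x _; rewrite mulrC. Qed.

Lemma eq_ip u u' v v' : (forall x, D x -> u x * v x = u' x * v' x) -> ip u v = ip u' v'.
Proof. by move=> h; apply: eq_Rintegral => x /[!inE]; exact: h. Qed.

Lemma ipDl u u' v : sqint u -> sqint u' -> sqint v ->
  ip (fun x => u x + u' x) v = ip u v + ip u' v.
Proof.
move=> su su' sv; rewrite /ip -RintegralD//; try exact: sqintM_integrable.
by apply: eq_Rintegral => x _; rewrite mulrDl.
Qed.

Lemma ipZl (k : R) u v : sqint u -> sqint v -> ip (fun x => k * u x) v = k * ip u v.
Proof.
move=> su sv; rewrite /ip -RintegralZl//; last exact: sqintM_integrable.
by apply: eq_Rintegral => x _; rewrite mulrA.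
Qed.

Lemma ipNl u v : sqint u -> sqint v -> ip (fun x => - u x) v = - ip u v.
Proof.
by move=> su sv; rewrite -mulN1r -ipZl//; congr ip; apply/funext => x; rewrite mulN1r.
Qed.

Lemma ipBl u u' v : sqint u -> sqint u' -> sqint v ->
  ip (fun x => u x - u' x) v = ip u v - ip u' v.
Proof. by move=> su su' sv; rewrite ipDl ?ipNl//; exact: sqintN. Qed.

Lemma ipDr u v v' : sqint u -> sqint v -> sqint v' ->
  ip u (fun x => v x + v' x) = ip u v + ip u v'.
Proof. by move=> su sv sv'; rewrite !(ipC u) ipDl. Qed.

Lemma ipZr (k : R) u v : sqint u -> sqint v -> ip u (fun x => k * v x) = k * ip u v.
Proof. by move=> su sv; rewrite !(ipC u) ipZl. Qed.

Lemma ipBr u v v' : sqint u -> sqint v -> sqint v' ->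
  ip u (fun x => v x - v' x) = ip u v - ip u v'.
Proof. by move=> su sv sv'; rewrite !(ipC u) ipBl. Qed.

Lemma ip0l v : ip (fun=> 0) v = 0.
Proof. by rewrite /ip; under eq_Rintegral do rewrite mul0r; rewrite /Rintegral integral0. Qed.

Lemma Rintegral_ae_ge0 (f : T -> R) : measurable_fun D f ->
  {ae mu, forall x, D x -> 0 <= f x} -> 0 <= \int[mu]_(x in D) f x.
Proof.
move=> mf f0; rewrite /Rintegral (ae_eq_integral (fun x => `|f x|%:E)) //.
- by rewrite fine_ge0// integral_ge0// => x _; rewrite lee_fin.
- exact/measurable_EFinP.
- by apply/measurable_EFinP; exact: measurableT_comp.
- by apply: filterS f0 => x h Dx; rewrite ger0_norm// h.
Qed.

Lemma sqintM_measurable u v : sqint u -> sqint v -> measurable_fun D (fun x => u x * v x).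
Proof. by move=> [? _] [? _]; exact: measurable_funM. Qed.

Lemma ip_ae_le u v u' v' : sqint u -> sqint v -> sqint u' -> sqint v' ->
  {ae mu, forall x, D x -> u x * v x <= u' x * v' x} -> ip u v <= ip u' v'.
Proof.
move=> su sv su' sv' h; rewrite -subr_ge0 /ip -RintegralB//; try exact: sqintM_integrable.
apply: Rintegral_ae_ge0; first by apply: measurable_funB; exact: sqintM_measurable.
by apply: filterS h => x h Dx; rewrite subr_ge0 h.
Qed.

Lemma ip_ae_ge0 u v : sqint u -> sqint v ->
  {ae mu, forall x, D x -> 0 <= u x * v x} -> 0 <= ip u v.
Proof.
by move=> su sv h; apply: Rintegral_ae_ge0 => //; exact: sqintM_measurable.
Qed.

Lemma ip_ae_eq u v u' v' : sqint u -> sqint v -> sqint u' -> sqint v' ->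
  {ae mu, forall x, D x -> u x * v x = u' x * v' x} -> ip u v = ip u' v'.
Proof.
move=> su sv su' sv' h; apply/eqP; rewrite eq_le; apply/andP; split; apply: ip_ae_le => //.
  by apply: filterS h => x h /h ->.
by apply: filterS h => x h /h ->.
Qed.

Lemma ip_ge0 u : 0 <= ip u u.
Proof. by apply: Rintegral_ge0 => x _; rewrite -expr2 sqr_ge0. Qed.

Lemma ip_fine u : sqint u -> (\int[mu]_(x in D) ((u x) ^+ 2)%:E = (ip u u)%:E)%E.
Proof.
move=> [mu_ fu]; rewrite /ip /Rintegral fineK.
  by apply: eq_integral => x _; rewrite expr2.
rewrite ge0_fin_numE.
  by under eq_integral do rewrite -expr2.
by apply: integral_ge0 => x _; rewrite lee_fin -expr2 sqr_ge0.
Qed.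

Lemma ip_eq0 u : sqint u -> ip u u = 0 -> {ae mu, forall x, D x -> u x = 0}.
Proof.
move=> su u0; have [mu_ _] := su.
have : ae_eq mu D (fun x => ((u x) ^+ 2)%:E) (cst 0%E).
  apply/ae_eq_integral_abs => //.
    by apply/measurable_EFinP; exact: measurable_funX.
  under eq_integral do rewrite gee0_abs ?lee_fin ?sqr_ge0//.
  by rewrite ip_fine// u0.
by apply: filterS => x h /h [] /eqP; rewrite sqrf_eq0 => /eqP.
Qed.

Lemma ip_ae0 u : sqint u -> {ae mu, forall x, D x -> u x = 0} -> ip u u = 0.
Proof.
move=> su h; rewrite -(ip0l u); apply: ip_ae_eq => //; try exact: sqint0.
by apply: filterS h => x h /h ->; rewrite mul0r.
Qed.

Lemma ip_sqrD u v : sqint u -> sqint v ->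
  ip (fun x => u x + v x) (fun x => u x + v x) = ip u u + 2 * ip u v + ip v v.
Proof.
move=> su sv; rewrite ipDl ?ipDr//; try exact: sqintD.
by rewrite (ipC v u); ring.
Qed.

Lemma ip_sqrB u v : sqint u -> sqint v ->
  ip (fun x => u x - v x) (fun x => u x - v x) = ip u u - 2 * ip u v + ip v v.
Proof.
move=> su sv; rewrite (ip_sqrD su (sqintN sv)).
have -> : ip u (fun x => - v x) = - ip u v by rewrite ipC ipNl// ipC.
have -> : ip (fun x => - v x) (fun x => - v x) = ip v v.
  by apply: eq_ip => x _; rewrite mulrNN.
by rewrite mulrN.
Qed.

Lemma ip_sqrZ (k : R) u : sqint u -> ip (fun x => k * u x) (fun x => k * u x) = k ^+ 2 * ip u u.
Proof. by move=> su; rewrite ipZl ?ipZr//; [ring|exact: sqintZ]. Qed.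

Lemma ip_sqrD_le u v : sqint u -> sqint v ->
  ip (fun x => u x + v x) (fun x => u x + v x) <= 2 * ip u u + 2 * ip v v.
Proof.
move=> su sv; rewrite ip_sqrD//; have := ip_ge0 (fun x => u x - v x).
by rewrite ip_sqrB//; move: (ip u u) (ip u v) (ip v v) => a b c; lra.
Qed.

(** Nonnegativity of the polynomial [t |-> |u + t v|^2], evaluated at its minimum when the leading
    coefficient is positive. *)
Lemma cauchy_schwarz u v : sqint u -> sqint v -> (ip u v) ^+ 2 <= ip u u * ip v v.
Proof.
move=> su sv.
have H t : 0 <= ip u u + 2 * t * ip u v + t ^+ 2 * ip v v.
  have := ip_ge0 (fun x => u x + t * v x); rewrite (ip_sqrD su (sqintZ t sv)).
  by rewrite ipZr// ip_sqrZ// mulrA.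
move: H (ip_ge0 u) (ip_ge0 v).
move: (ip u u) (ip u v) (ip v v) => a b c H a0 c0.
have [c00|cn0] := eqVneq c 0; last first.
  have cp : 0 < c by rewrite lt_neqAle eq_sym cn0.
  have := H (- b / c).
  have -> : a + 2 * (- b / c) * b + (- b / c) ^+ 2 * c = a - b ^+ 2 / c by field.
  by rewrite subr_ge0 ler_pdivrMr.
rewrite {}c00 in H *; rewrite mulr0.
have [->|b0] := eqVneq b 0; first by rewrite expr0n.
(* With leading coefficient [0] the polynomial is affine; a nonzero slope would give the value [-1]
   at this point. *)
have := H (- (a + 1) / (2 * b)).
have -> : a + 2 * (- (a + 1) / (2 * b)) * b + (- (a + 1) / (2 * b)) ^+ 2 * 0 = -1 by field.
by rewrite lerNr oppr0 ler10.
Qed.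

(** After squaring, the gap to [cauchy_schwarz] is the square of [k * ip u u - k^-1 * ip v v]. *)
Lemma ip_le_young (k : R) u v : 0 < k -> sqint u -> sqint v ->
  2 * `|ip u v| <= k * ip u u + k^-1 * ip v v.
Proof.
move=> k0 su sv; have CS := cauchy_schwarz su sv.
have a0 := ip_ge0 u; have c0 := ip_ge0 v.
rewrite -(real_normK (num_real (ip u v))) in CS.
have : (2 * `|ip u v|) ^+ 2 <= (k * ip u u + k^-1 * ip v v) ^+ 2.
  apply: (@le_trans _ _ (4 * (ip u u * ip v v))); first by rewrite exprMn; lra.
  rewrite -subr_ge0.
  have -> : (k * ip u u + k^-1 * ip v v) ^+ 2 - 4 * (ip u u * ip v v) =
    (k * ip u u - k^-1 * ip v v) ^+ 2 by field; rewrite gt_eqF.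
  exact: sqr_ge0.
move=> h; rewrite -ler_sqr ?nnegrE ?mulr_ge0//.
by rewrite addr_ge0// mulr_ge0// ?invr_ge0 ltW.
Qed.

End square_integrable.

(** * Convergence in [L^2] and completeness *)

Section L2_convergence.
Context {disp : measure_display} {T : measurableType disp} {R : realType}.
Variables (mu : {measure set T -> \bar R}) (D : set T).
Hypothesis mD : measurable D.
Implicit Types (u v w : T -> R) (us : (T -> R)^nat).

Local Notation sqint := (sqint mu D).
Local Notation ip := (L2_ip mu D).

Definition dist2 u v := ip (fun x => u x - v x) (fun x => u x - v x).

Definition cvgL2 us u := dist2 (us n) u @[n --> \oo] --> (0 : R).

Lemma dist2_ge0 u v : 0 <= dist2 u v. Proof. exact: ip_ge0. Qed.

Lemma dist2C u v : dist2 u v = dist2 v u.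
Proof. by apply: eq_ip => x _; ring. Qed.

Lemma dist2_tri u v w : sqint u -> sqint v -> sqint w ->
  dist2 u w <= 2 * dist2 u v + 2 * dist2 v w.
Proof.
move=> su sv sw; have := ip_sqrD_le mD (sqintB mD su sv) (sqintB mD sv sw).
rewrite /dist2; congr (_ <= _); apply: eq_ip => x _; ring.
Qed.

Lemma cvg0_le (f g : R^nat) (k : R) : (forall n, 0 <= f n) -> (forall n, f n <= k * g n) ->
  g n @[n --> \oo] --> (0 : R) -> f n @[n --> \oo] --> (0 : R).
Proof.
move=> f0 fg g0; apply: (@squeeze_cvgr _ _ _ _ (fun=> 0) (fun n => k * g n)).
- by apply: nearW => n; rewrite f0 fg.
- exact: cvg_cst.
- by rewrite -[X in _ --> X](mulr0 k); apply: cvgM => //; exact: cvg_cst.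
Qed.

Lemma cvg_sqr0 (f : R^nat) : (f n) ^+ 2 @[n --> \oo] --> (0 : R) -> f n @[n --> \oo] --> (0 : R).
Proof.
move=> h; apply/cvgr0Pnorm_le => e e0.
have /cvgr0Pnorm_le/(_ _ (exprn_gt0 2 e0)) := h.
apply: filterS => n; rewrite normrX => h1; rewrite -ler_sqr ?nnegrE//; exact: ltW.
Qed.

Lemma cvgL2_ip us u v : (forall n, sqint (us n)) -> sqint u -> sqint v ->
  cvgL2 us u -> ip (us n) v @[n --> \oo] --> ip u v.
Proof.
move=> su_ su sv cu; apply/subr_cvg0; apply: cvg_sqr0.
apply: (@cvg0_le _ (fun n => dist2 (us n) u) (ip v v)) => // n; first exact: sqr_ge0.
by rewrite -ipBl// mulrC; apply: cauchy_schwarz => //; exact: sqintB.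
Qed.

(** The explicit rate is needed as well as the limit: once squared, it bounds the pointwise error by
    an integrable function. *)
Lemma cvg_geometric_steps (a : R^nat) (s : R) :
  (forall n, `|a n.+1 - a n| <= s * 2^-1 ^+ n) ->
  exists2 l, a n @[n --> \oo] --> l & forall n, `|l - a n| <= 2 * s * 2^-1 ^+ n.
Proof.
move=> as_.
have s0 : 0 <= s by have := le_trans (normr_ge0 _) (as_ 0%N); rewrite expr0 mulr1.
have H i m : `|a (m + i)%N - a i| <= 2 * s * 2^-1 ^+ i - 2 * s * 2^-1 ^+ (m + i).
  elim: m => [|m IH]; first by rewrite !subrr normr0.
  rewrite -(subrK (a (m + i)%N) (a (m.+1 + i)%N)) -addrA (le_trans (ler_normD _ _))//.
  have := as_ (m + i)%N; rewrite addSn exprS => h.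
  by move: (2^-1 ^+ (m + i)) h IH => t; lra.
have H2 i n : (i <= n)%N -> `|a n - a i| <= 2 * s * 2^-1 ^+ i.
  move=> /subnK <-; rewrite (le_trans (H _ _))// gerBl mulr_ge0 ?mulr_ge0// exprn_ge0// invr_ge0//.
have : cvg (a n @[n --> \oo]).
  apply/cauchy_cvgP/cauchy_exP => e e0.
  have [i hi] : exists i : nat, 2 * s * 2^-1 ^+ i < e.
    have : (2 * s * 2^-1 ^+ i) @[i --> \oo] --> (0 : R).
      rewrite -[X in _ --> X](mulr0 (2 * s)); apply: cvgM; first exact: cvg_cst.
      by apply: cvg_expr; rewrite ger0_norm ?invr_ge0// invf_lt1// ltr1n.
    move=> /cvgr_lt/(_ _ e0)[i _ /(_ i (leqnn i))]; by exists i.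
  exists (a i); exists i => // n /= ni.
  by rewrite /ball/= distrC (le_lt_trans (H2 _ _ ni)).
move=> /cvg_ex[l al]; exists l => // n; apply/ler_addgt0Pr => e e0.
have /cvgr_dist_le/(_ _ e0)[m _ hm] := al.
have := hm (maxn m n) (leq_maxl _ _) => /= h1.
rewrite -(subrK (a (maxn m n)) l) -addrA (le_trans (ler_normD _ _))// [X in _ <= X]addrC lerD//.
exact/H2/leq_maxr.
Qed.

(** Riesz-Fischer: a fast subsequence converges almost everywhere and in [L^2], and the Cauchy
    property carries the whole sequence along. *)
Lemma L2_complete us : (forall n, sqint (us n)) ->
  (forall e, 0 < e -> exists N, forall n m, (N <= n)%N -> (N <= m)%N -> dist2 (us n) (us m) <= e) ->
  exists2 u, sqint u & cvgL2 us u.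
Proof.
move=> su_ cau.
have e8 j : 0 < 8^-1 ^+ j :> R by rewrite exprn_gt0// invr_gt0.
have /choice[N_ hN] : forall j, exists N, forall n m, (N <= n)%N -> (N <= m)%N ->
    dist2 (us n) (us m) <= 8^-1 ^+ j by move=> j; exact: cau.
pose k j := (\sum_(i < j.+1) N_ i)%N.
have kN j : (N_ j <= k j)%N by rewrite /k (bigD1 ord_max)//= leq_addr.
have kS j : (k j <= k j.+1)%N by rewrite [X in (_ <= X)%N]/k big_ord_recr/= leq_addr.
pose v j := us (k j).
have sv j : sqint (v j) by exact: su_.
have dv j : dist2 (v j.+1) (v j) <= 8^-1 ^+ j.
  by apply: hN; [rewrite (leq_trans (kN j))|exact: kN].
(* The weight [4 ^+ j] against distances [8^-1 ^+ j] leaves integrals of order [2^-1 ^+ j], which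
   are summable, while [a j x <= S x] still forces steps of size [2^-1 ^+ j] times the root of
   [S x]. *)
pose a j x := 4 ^+ j * (v j.+1 x - v j x) ^+ 2.
have a0 j x : 0 <= a j x by rewrite mulr_ge0 ?sqr_ge0 ?exprn_ge0.
have ma j : measurable_fun D (a j).
  apply: measurable_funM; first exact: measurable_cst.
  by apply: measurable_funX; have [] := sqintB mD (sv j.+1) (sv j).
pose S x : \bar R := (\sum_(j <oo) (a j x)%:E)%E.
have S0 x : (0 <= S x)%E by apply: nneseries_ge0 => j _ _; rewrite lee_fin.
have aS j x : ((a j x)%:E <= S x)%E.
  apply: (@le_trans _ _ (\sum_(0 <= i < j.+1) (a i x)%:E)%E).
    by rewrite big_nat_recr//= leeDr// sume_ge0// => i _; rewrite lee_fin.
  by apply: nneseries_lim_ge => i _ _; rewrite lee_fin.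
have mS : measurable_fun D S.
  apply: ge0_emeasurable_sum => [i x Dx _|i _]; first by rewrite lee_fin.
  exact/measurable_EFinP.
have iS : (\int[mu]_(x in D) S x <= 2%:E)%E.
  rewrite integral_nneseries//; last 2 first.
  - by move=> j; exact/measurable_EFinP.
  - by move=> *; rewrite lee_fin.
  apply: (@le_trans _ _ (\sum_(j <oo) (0 + (2 / (2 ^ j.+1)%:R)%:E))%E); last first.
    rewrite (le_trans (epsilon_trick _ _ _))//.
    by rewrite eseries0// add0e.
  apply: lee_nneseries => [j _ _|j _].
    by apply: integral_ge0 => x _; rewrite lee_fin.
  rewrite add0e.
  under eq_integral do rewrite /a EFinM.
  rewrite ge0_integralZl//; last 2 first.
  - by apply/measurable_EFinP/measurable_funX; have [] := sqintB mD (sv j.+1) (sv j).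
  - by move=> x _; rewrite lee_fin sqr_ge0.
  rewrite (ip_fine (sqintB mD (sv j.+1) (sv j))) -EFinM lee_fin.
  apply: (@le_trans _ _ (4 ^+ j * 8^-1 ^+ j)).
    by rewrite ler_wpM2l ?exprn_ge0//; exact: dv.
  rewrite -exprMn natrX exprS invfM mulrA divff// mul1r -exprVn.
  by rewrite (_ : 4 * 8^-1 = 2^-1 :> R)//; field.
have E_ae : {ae mu, forall x, D x -> (S x < +oo)%E}.
  have : mu.-integrable D S.
    apply/integrableP; split => //; under eq_integral do rewrite gee0_abs//.
    by rewrite (le_lt_trans iS)// ltry.
  move=> /(integrable_ae mD); apply: filterS => x h Dx; have := h Dx.
  by rewrite ge0_fin_numE.
pose E := D `&` [set x | (S x < +oo)%E].
have mE : measurable E by exact: emeasurable_fun_infty_o.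
have lim x : exists l, E x -> (v n x @[n --> \oo] --> l /\
     forall n, (((l - v n x) ^+ 2)%:E <= (4 * 4^-1 ^+ n)%:E * S x)%E).
  have [Ex|nEx] := pselect (E x); last by exists 0.
  have [s2 s20 Es2] : exists2 s2 : R, 0 <= s2 & S x = s2%:E.
    exists (fine (S x)); first exact: fine_ge0.
    by rewrite fineK// ge0_fin_numE//; case: Ex.
  have P4 n : (2^-1 ^+ n) ^+ 2 = (4 ^+ n)^-1 :> R.
    by rewrite exprAC -exprVn; congr (_ ^+ _); field.
  have [l vl hl] : exists2 l, v n x @[n --> \oo] --> l &
      forall n, `|l - v n x| <= 2 * Num.sqrt s2 * 2^-1 ^+ n.
    apply: cvg_geometric_steps => n.
    rewrite -ler_sqr ?nnegrE ?mulr_ge0 ?sqrtr_ge0 ?exprn_ge0 ?invr_ge0//.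
    rewrite real_normK ?num_real// exprMn sqr_sqrtr// P4.
    by have := aS n x; rewrite Es2 lee_fin /a ler_pdivlMr ?exprn_gt0// mulrC.
  exists l => _; split => // n; rewrite Es2 -EFinM lee_fin.
  rewrite -(real_normK (num_real _)).
  apply: (@le_trans _ _ ((2 * Num.sqrt s2 * 2^-1 ^+ n) ^+ 2)).
    by rewrite ler_sqr ?nnegrE ?mulr_ge0 ?sqrtr_ge0 ?exprn_ge0 ?invr_ge0//.
  rewrite !exprMn sqr_sqrtr// P4 -exprVn.
  move: (4^-1 ^+ n) => t.
  have -> : 2 ^+ 2 * s2 * t = 4 * t * s2 by ring.
  exact: lexx.
have /choice[l hl] := lim.
(* Cutting off outside [E] turns the chosen limits into a measurable function; by [E_ae] the part of
   [D] outside [E] is null. *)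
pose u x := l x * \1_E x.
have mu_ : measurable_fun D u.
  apply: (@measurable_fun_cvg _ _ _ D (fun n x => v n x * \1_E x)).
    move=> n; apply: measurable_funM; first by have [] := sv n.
    exact: measurable_indic.
  move=> x Dx; rewrite /u indicE; case: (pselect (E x)) => [Ex|nEx].
    rewrite mem_set//=; apply: cvgM; last exact: cvg_cst.
    by have [] := hl x Ex.
  rewrite memNset//= mulr0; under eq_fun do rewrite mulr0; exact: cvg_cst.
have uE x : E x -> u x = l x by move=> Ex; rewrite /u indicE mem_set// mulr1.
have du n : (\int[mu]_(x in D) ((u x - v n x) ^+ 2)%:E <= (8 * 4^-1 ^+ n)%:E)%E.
  apply: (@le_trans _ _ (\int[mu]_(x in D) ((4 * 4^-1 ^+ n)%:E * S x))%E).
    apply: ae_ge0_le_integral => //.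
    - by move=> x _; rewrite lee_fin sqr_ge0.
    - by apply/measurable_EFinP/measurable_funX/measurable_funB => //; have [] := sv n.
    - by move=> x _; rewrite mule_ge0// lee_fin mulr_ge0// exprn_ge0// invr_ge0.
    - by apply: emeasurable_funM => //; exact: measurable_cst.
    apply: filterS E_ae => x h Dx.
    have Ex : E x by split => //; exact: h.
    by rewrite uE//; have [_] := hl x Ex; exact.
  rewrite ge0_integralZl//.
  rewrite (_ : 8 * 4^-1 ^+ n = 4 * 4^-1 ^+ n * 2); last by ring.
  by rewrite [X in (_ <= X)%E]EFinM lee_pmul// ?integral_ge0// lee_fin mulr_ge0// exprn_ge0// invr_ge0.
have suv n : sqint (fun x => u x - v n x).
  split; first by apply: measurable_funB => //; have [] := sv n.
  by rewrite (le_lt_trans (du n))// ltry.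
have su : sqint u.
  have := sqintD mD (suv 0%N) (sv 0%N).
  by under eq_fun do rewrite subrK.
have d2 n : dist2 u (v n) <= 8 * 4^-1 ^+ n.
  by rewrite -lee_fin /dist2 -ip_fine.
exists u => //; rewrite /cvgL2; apply/cvgr0Pnorm_le => e e0.
have [j hj] : exists j : nat, 2 * 8^-1 ^+ j + 16 * 4^-1 ^+ j <= e.
  have : (2 * 8^-1 ^+ j + 16 * 4^-1 ^+ j) @[j --> \oo] --> (0 : R).
    rewrite (_ : (0 : R) = 2 * 0 + 16 * 0); last by ring.
    by apply: cvgD; (apply: cvgM; [exact: cvg_cst|apply: cvg_expr;
      rewrite ger0_norm ?invr_ge0// invf_lt1// ltr1n]).
  move=> /cvgr_le/(_ _ e0)[i _ /(_ i (leqnn i))]; by exists i.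
exists (k j) => // n /= kn; rewrite ger0_norm ?dist2_ge0//.
rewrite (le_trans (dist2_tri (su_ n) (sv j) su))// (le_trans _ hj)//.
have h1 : dist2 (us n) (v j) <= 8^-1 ^+ j by apply: hN; [exact: leq_trans (kN j) kn|exact: kN].
have := d2 j; rewrite dist2C => h2.
by move: (dist2 (us n) _) (dist2 (v j) u) (8^-1 ^+ j) (4^-1 ^+ j) h1 h2 => *; lra.
Qed.

End L2_convergence.

Section density.
Context {disp : measure_display} {T : measurableType disp} {R : realType}.
Variables (mu : {measure set T -> \bar R}) (f : T -> \bar R).
Hypotheses (mf : measurable_fun setT f) (f0 : forall x, (0 <= f x)%E).

(** Packaged as a measure so that uniqueness of measures on boxes can be applied to the positive and
    negative parts of an integrable function. *)
Definition density (A : set T) : \bar R := (\int[mu]_(x in A) f x)%E.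

Let density0 : density set0 = 0%E. Proof. exact: integral_set0. Qed.

Let density_ge0 A : (0 <= density A)%E.
Proof. by apply: integral_ge0 => x _; exact: f0. Qed.

Let density_sigma_additive : semi_sigma_additive density.
Proof. exact: semi_sigma_additive_nng_induced. Qed.

HB.instance Definition _ :=
  isMeasure.Build _ _ _ density density0 density_ge0 density_sigma_additive.

Definition density_measure : {measure set T -> \bar R} := density.

End density.

(** * Weak derivatives and Sobolev spaces *)

Section fundamental_lemma.
Context {R : realType} {d : nat}.
Variables (Om : set 'rV[R]_d).
Hypotheses (oOm : open Om) (bOm : bounded_set Om).
Implicit Types (u : 'rV[R]_d -> R) (a b x : 'rV[R]_d).

Lemma measurable_Om : measurable Om. Proof. exact: open_measurable_rV. Qed.

Lemma leb_Om_lty : (leb d Om < +oo)%E.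
Proof.
have [B B0 OB] := bounded_rVP bOm.
apply: (@le_lt_trans _ _ (leb d (box (const_mx (- (B + 1))) (const_mx (B + 1))))).
  apply: le_measure; rewrite ?inE; [exact: measurable_Om|exact: measurable_box|].
  move=> x Ox i; rewrite !mxE -ltr_norml (le_lt_trans (OB x i Ox))// ltrDl//.
exact: leb_box_lty.
Qed.

Lemma closed_cbox a b : closed (cbox a b).
Proof.
move=> x cx i; apply/andP; split; apply/ler_addgt0Pr => e e0.
  have [y [/(_ i)/andP[h1 h2] /(@ball_coord _ _ _ _ _ i)]] := cx _ (nbhsx_ballx x e e0).
  by rewrite ltr_norml => /andP[h3 h4]; lra.
have [y [/(_ i)/andP[h1 h2] /(@ball_coord _ _ _ _ _ i)]] := cx _ (nbhsx_ballx x e e0).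
by rewrite ltr_norml => /andP[h3 h4]; lra.
Qed.

(** As [n] grows, each factor tends to [1] inside the open box, while the product is [0] outside it:
    the bumps converge boundedly to the indicator of the box. *)
Definition box_bump a b (n : nat) : 'rV[R]_d -> R :=
  tensor (fun i t => inv_expR 0 (n.+1%:R * t + - (n.+1%:R * a 0 i)) *
                     inv_expR 0 (- n.+1%:R * t + n.+1%:R * b 0 i)).

Lemma inv_expR_le1 (t : R) : 0 <= inv_expR 0 t <= 1.
Proof.
rewrite inv_expR_ge0/= /inv_expR; case: ltP => // t0.
by rewrite expr0 invr1 mul1r -expR0 ler_expR oppr_le0 invr_ge0 ltW.
Qed.

Lemma box_bump_range a b n x : 0 <= box_bump a b n x <= 1.
Proof.
rewrite /box_bump /tensor prodr_ge0/=; last by move=> i _; rewrite mulr_ge0 ?inv_expR_ge0.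
apply: (@le_trans _ _ (\prod_(i < d) 1)); last by rewrite big1.
apply: ler_prod => i _; rewrite mulr_ge0 ?inv_expR_ge0//=.
have /andP[h1 h2] := inv_expR_le1 (n.+1%:R * x 0 i + - (n.+1%:R * a 0 i)).
have /andP[h3 h4] := inv_expR_le1 (- n.+1%:R * x 0 i + n.+1%:R * b 0 i).
exact: mulr_ile1.
Qed.

Lemma box_bump_out a b n x : ~ box a b x -> box_bump a b n x = 0.
Proof.
move=> /existsNP[i /negP]; rewrite negb_and -!leNgt => h.
rewrite /box_bump /tensor (bigD1 i)//=.
case/orP : h => h.
  by rewrite (@inv_expR_le0 _ _ (_ + _)) ?mul0r// subr_le0 ler_pM2l.
rewrite [X in _ * X * _]inv_expR_le0 ?mulr0 ?mul0r//.
by rewrite mulNr addrC subr_le0 ler_pM2l.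
Qed.

Lemma cvg_inv_expR (c : R) : 0 < c -> inv_expR 0 (n.+1%:R * c) @[n --> \oo] --> (1 : R).
Proof.
move=> c0; rewrite /inv_expR.
under eq_fun do rewrite mulr_gt0// expr0 invr1 mul1r.
suff h : expR (- (n.+1%:R * c)^-1) @[n --> \oo] --> expR (- (0 * c^-1)).
  by rewrite mul0r oppr0 expR0 in h.
apply: continuous_cvg; first exact: continuous_expR.
apply: cvgN; under eq_fun do rewrite invfM.
by apply: cvgM; [exact: cvg_harmonic|exact: cvg_cst].
Qed.

Lemma cvg_box_bump a b x : box_bump a b n x @[n --> \oo] --> (\1_(box a b) x : R).
Proof.
rewrite indicE; have [xab|xab] := pselect (box a b x); last first.
  by rewrite memNset//; under eq_fun do rewrite box_bump_out//; exact: cvg_cst.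
rewrite mem_set//= /box_bump /tensor.
suff h : \prod_(i < d) (inv_expR 0 (n.+1%:R * x 0 i + - (n.+1%:R * a 0 i)) *
    inv_expR 0 (- n.+1%:R * x 0 i + n.+1%:R * b 0 i)) @[n --> \oo] --> \prod_(i < d) ((1 : R) * 1).
  by rewrite big1 in h => // i _; rewrite mulr1.
apply: cvg_big => [|i _]; first exact: mul_continuous.
have /andP[h1 h2] := xab i.
apply: cvgM.
  by under eq_fun do rewrite -mulrBr; apply: cvg_inv_expR; rewrite subr_gt0.
under eq_fun do rewrite mulNr addrC -mulrBr; apply: cvg_inv_expR; rewrite subr_gt0//.
Qed.

Lemma smooth_box_bump a b n : smooth (box_bump a b n).
Proof.
move=> k; apply: Ck_tensor => j l; apply: nderivableM; exact/nderivable_affine/nderivable_inv_expR.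
Qed.

Lemma test_function_box_bump a b n : cbox a b `<=` Om -> test_function Om (box_bump a b n).
Proof.
move=> abO.
have sub : closure [set x | box_bump a b n x != 0] `<=` cbox a b.
  rewrite closureE; apply: smallest_sub; first exact: closed_cbox.
  move=> x /= h; apply: box_cbox; apply: contra_neqP h => h; exact: box_bump_out.
split; first exact: smooth_box_bump.
  have [B B0 hB] := bounded_rVP bOm.
  apply: (@compact_rV _ _ _ B); first exact: closed_closure.
  by move=> x i /sub/abO; exact: hB.
exact: subset_trans sub abO.
Qed.

(** Tests with the bumps of the box and passes to the limit by dominated convergence. *)
Lemma integral_box_eq0 u a b : (leb d).-integrable Om (EFin \o u) ->
  (forall phi, test_function Om phi -> \int[leb d]_(x in Om) (u x * phi x) = 0) ->
  cbox a b `<=` Om -> (\int[leb d]_(x in box a b) (u x)%:E = 0)%E.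
Proof.
move=> iu u0 abO; have mO := measurable_Om.
have mu_ : measurable_fun Om u by apply/measurable_EFinP; exact: measurable_int iu.
have mb n : measurable_fun Om (box_bump a b n).
  by apply: continuous_measurable_rV => // x _; exact: (Ck_continuous (smooth_box_bump a b n 0%N)).
have H := @dominated_convergence _ _ _ (leb d) Om mO
  (fun n x => (u x * box_bump a b n x)%:E) (fun x => (u x * \1_(box a b) x)%:E)
  (fun x => (`|u x|)%:E).
have [|||||_ _ H2] := H.
- by move=> n; apply/measurable_EFinP; exact: measurable_funM.
- apply/measurable_EFinP; apply: measurable_funM => //.
  by apply: measurable_indic; exact: measurable_box.
- apply: aeW => x _; apply: cvg_EFin; first by near=> n.
  by apply: cvgM; [exact: cvg_cst|exact: cvg_box_bump].
- by have := integrable_abse iu.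
- apply: aeW => x n _; rewrite lee_fin normrM ler_piMr//.
  by have /andP[h1 h2] := box_bump_range a b n x; rewrite ger0_norm.
have E n : (\int[leb d]_(x in Om) (u x * box_bump a b n x)%:E = 0)%E.
  have := u0 _ (test_function_box_bump n abO); rewrite /Rintegral => h.
  rewrite -[LHS]fineK ?h//.
  apply: integrable_fin_num => //.
  apply: (le_integrable mO _ _ iu).
    by apply/measurable_EFinP; exact: measurable_funM.
  move=> x _ /=; rewrite lee_fin normrM ler_piMr//.
  by have /andP[h1 h2] := box_bump_range a b n x; rewrite ger0_norm.
have -> : (\int[leb d]_(x in box a b) (u x)%:E = \int[leb d]_(x in Om) (u x * \1_(box a b) x)%:E)%E.
  rewrite [LHS]integral_mkcond [RHS]integral_mkcond; apply: eq_integral => x _.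
  rewrite /patch indicE; have [xab|xab] := pselect (box a b x).
    by rewrite !mem_set//= ?mulr1//; exact/abO/box_cbox.
  by rewrite (memNset xab)/= mulr0; case: ifP.
apply/esym; apply: (cvg_unique _ _ H2) => //=.
by under eq_fun do rewrite E; exact: cvg_cst.
Unshelve. all: end_near. Qed.

(** On a box, the positive and negative parts of [u] are densities of two finite measures.
    [integral_box_eq0] makes these agree on boxes, hence everywhere, so [u] has integral zero on
    every measurable part of the box. *)
Lemma fundamental_lemma u : (leb d).-integrable Om (EFin \o u) ->
  (forall phi, test_function Om phi -> \int[leb d]_(x in Om) (u x * phi x) = 0) ->
  \forall x \ae leb d, Om x -> u x = 0.
Proof.
move=> iu u0; have mO := measurable_Om.
have mu_ : measurable_fun Om u by apply/measurable_EFinP; exact: measurable_int iu.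
have H a b : cbox a b `<=` Om -> \forall x \ae leb d, box a b x -> u x = 0.
  move=> abO; have bO : box a b `<=` Om by exact: subset_trans (@box_cbox _ _ _ _) abO.
  have mb := measurable_box a b.
  have iub : (leb d).-integrable (box a b) (EFin \o u) by exact: integrableS iu.
  suff : ae_eq (leb d) (box a b) (EFin \o u) (cst 0%E).
    by apply: filterS => x /= h /h [].
  apply: (integral_ae_eq mb iub) => [|E Eb mE]; first exact: measurable_cst.
  rewrite [RHS]integral0.
  pose v := ((EFin \o u) \_ (box a b))%E.
  have mv : measurable_fun [set: 'rV[R]_d] v.
    by apply/(measurable_restrictT _ mb); exact: measurable_int iub.
  have mp : measurable_fun [set: 'rV[R]_d] v^\+%E by exact: measurable_funepos.
  have mn : measurable_fun [set: 'rV[R]_d] v^\-%E by exact: measurable_funeneg.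
  have iv : (leb d).-integrable setT v by apply/integrable_restrict; rewrite ?setTI.
  have fin (g : 'rV[R]_d -> \bar R) A : measurable A -> (leb d).-integrable setT g -> (\int[leb d]_(x in A) g x)%E \is a fin_num.
    by move=> mA ig; apply: integrable_fin_num => //; exact: integrableS ig.
  have ivp : (leb d).-integrable setT v^\+%E by exact: integrable_funepos.
  have ivn : (leb d).-integrable setT v^\-%E by exact: integrable_funeneg.
  pose m1 := density_measure (leb d) mp (funepos_ge0 v).
  pose m2 := density_measure (leb d) mn (funeneg_ge0 v).
  have int_v A : measurable A -> (\int[leb d]_(x in A `&` box a b) (u x)%:E = m1 A - m2 A)%E.
    move=> mA; rewrite integral_mkcondr integralE//.
  have m12 A : measurable A -> m1 A = m2 A.
    apply: rV_measure_unique => a' b'; last first.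
      have mab := measurable_box a' b'.
      by rewrite -ge0_fin_numE; [exact: fin|exact: measure_ge0].
    have mab := measurable_box a' b'.
    have := int_v _ mab; rewrite box_setI integral_box_eq0//; last first.
      move=> x xab; apply: abO => i; have := xab i; rewrite !mxE.
      by rewrite ge_max le_min => /andP[/andP[_ ->] /andP[_ ->]].
    by move=> /esym/eqP; rewrite sube_eq ?add0e ?fin_num_adde_defl//; [move/eqP| exact: fin| exact: fin].
  have := int_v _ mE; rewrite (m12 _ mE) subee; last exact: fin.
  by rewrite (setIidl Eb).
(* [Om] is covered by countably many rational boxes, so the exceptional sets together form a null
   set. *)
rewrite (open_bigcup_rat_box oOm).
pose P (p : 'rV[rat]_d * nat) x := cbox (@rat_box R d p).1 (rat_box p).2 `<=` Om -> box (@rat_box R d p).1 (rat_box p).2 x -> u x = 0.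
have : \forall x \ae leb d, forall n, if unpickle n is Some p then P p x else True.
  apply/ae_foralln => n; case: unpickle => [p|]; last exact: aeW.
  have [pO|pO] := pselect (cbox (@rat_box R d p).1 (rat_box p).2 `<=` Om); last first.
    by apply: aeW => x /pO.
  by apply: filterS (H _ _ pO) => x h _.
apply: filterS => x h [p /= pO xp].
by have := h (pickle p); rewrite pickleK; apply.
Qed.

End fundamental_lemma.

(** * Integration by parts against compactly supported C^1 functions *)

Section integration_by_parts.
Context {R : realType} {d : nat}.
Variables (Om : set 'rV[R]_d).
Hypotheses (oOm : open Om) (bOm : bounded_set Om).
Implicit Types (f g u phi : 'rV[R]_d -> R) (x : 'rV[R]_d).

Lemma C1c_out f df x : C1c Om f df -> ~ Om x -> f x = 0.
Proof. by move=> [_ _ _ [K [_ KO K0]]] nO; apply: K0 => /KO. Qed.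

Lemma continuous_supported_bound g : continuous g -> (forall x, ~ Om x -> g x = 0) ->
  exists2 M : R, 0 < M & forall x, `|g x| <= M.
Proof.
move=> cg g0.
have [M M0 hM] := continuous_within_bounded (compact_closure_rV bOm) (continuous_subspaceT cg).
exists M => // x; have [Ox|nOx] := pselect (Om x); first exact/hM/subset_closure.
by rewrite g0// normr0 ltW.
Qed.

Lemma continuous_supported_integrable g : continuous g -> (forall x, ~ Om x -> g x = 0) ->
  (leb d).-integrable setT (EFin \o g).
Proof.
move=> cg g0; have [M M0 hM] := continuous_supported_bound cg g0.
have mO := measurable_Om oOm.
have mg : measurable_fun [set: 'rV[R]_d] g.
  by apply: continuous_measurable_rV; [exact: openT|move=> x _; exact: cg].
apply: (@le_integrable _ _ _ (leb d) setT measurableT _ (fun x => (M * \1_Om x)%:E)).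
- exact/measurable_EFinP.
- move=> x _ /=; rewrite lee_fin indicE; have [Ox|nOx] := pselect (Om x).
    by rewrite mem_set//= mulr1 (le_trans (hM x))// ler_norm.
  by rewrite g0// normr0.
- under eq_fun do rewrite EFinM; apply: integrableZl => //.
  apply/integrableP; split; first exact/measurable_EFinP/measurable_indic.
  under eq_integral do rewrite gee0_abs ?lee_fin//.
  by rewrite integral_indic// setIT; exact: leb_Om_lty.
Qed.

Lemma continuous_addl (v : 'rV[R]_d) : continuous (fun x : 'rV[R]_d => v + x).
Proof.
move=> x A /nbhs_ballP[e /= e0 eA]; apply/nbhs_ballP; exists e => //= y xy.
apply: eA; apply: ball_rV_sub => // j; rewrite !mxE opprD addrACA subrr add0r.
exact: ball_coord.
Qed.

Lemma C1c_lipschitz f df x i (h : R) M : C1c Om f df -> (forall x i, `|df i x| <= M) ->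
  `|f (h *: e_ i + x) - f x| <= M * `|h|.
Proof.
move=> [cf dff cdf _] dM.
have -> : `|h| = \sum_j `|(h *: e_ i + x) 0 j - x 0 j|.
  rewrite (bigD1 i)//= !mxE !eqxx/= mulr1 addrK big1 ?addr0// => j /negbTE ji.
  by rewrite !mxE eqxx/= ji mulr0 add0r subrr normr0.
exact: (@lipschitz_of_partial _ _ f df setT).
Qed.

Lemma C1c_derivative_bound f df : C1c Om f df ->
  exists2 M : R, 0 < M & forall x i, `|df i x| <= M.
Proof.
move=> fdf; have /choice[M hM] : forall i, exists M : R, 0 < M /\ forall x, `|df i x| <= M.
  move=> i; have [_ _ cdf _] := fdf.
  have [|M M0 hM] := continuous_supported_bound (cdf i); last by exists M.
  by move=> x; exact: C1c_derive0 fdf.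
exists (1 + \sum_i M i).
  by rewrite ltr_wpDr// sumr_ge0// => i _; have [/ltW] := hM i.
move=> x i; rewrite (le_trans (proj2 (hM i) x))// (bigD1 i)//= addrCA lerDl addr_ge0//.
by rewrite sumr_ge0// => j _; have [/ltW] := hM j.
Qed.

Lemma cvg_difference_quotient f x v df : is_derive x v f df ->
  n.+1%:R * (f (n.+1%:R^-1 *: v + x) - f x) @[n --> \oo] --> df.
Proof.
move=> [/cvg_ex[l hl] dE].
have <- : l = df by rewrite -dE; apply/esym/cvg_lim.
have h : (n.+1%:R^-1 : R) @[n --> \oo] --> (0 : R)^'.
  move=> A /= hA.
  have h : \forall n \near \oo, (n.+1%:R^-1 : R) != 0 -> A n.+1%:R^-1 := cvg_harmonic hA.
  change (\forall n \near \oo, A (n.+1%:R^-1 : R)).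
  by apply: filterS h => n; apply; rewrite invr_eq0 pnatr_eq0.
have := cvg_comp _ _ h hl.
apply: cvg_trans; apply: near_eq_cvg; apply: nearW => n /=.
by rewrite invrK.
Qed.

Lemma integrable_shift (v : 'rV[R]_d) (g : 'rV[R]_d -> \bar R) :
  measurable_fun [set: 'rV[R]_d] g -> (leb d).-integrable setT g ->
  (leb d).-integrable setT (fun x => g (v + x)).
Proof.
move=> mg /integrableP[_ ig]; apply/integrableP; split.
  under eq_fun do rewrite addrC.
  by apply: (measurableT_comp mg); exact: measurable_shift.
under eq_integral do rewrite addrC.
rewrite (@ge0_integral_shift R d v (fun x => `|g x|%E))//.
exact: measurableT_comp.
Qed.

(** By translation invariance every difference quotient has integral [0]. The quotients are
    uniformly bounded with support near [Om], so dominated convergence reaches the derivative. *)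
Lemma integral_partial_C1c f df i : C1c Om f df -> \int[leb d]_(x in Om) df i x = 0.
Proof.
move=> fdf; have [cf dff cdf _] := fdf.
have mO := measurable_Om oOm.
have f0 x : ~ Om x -> f x = 0 by move=> nx; exact: C1c_out fdf nx.
have df0 j x : ~ Om x -> df j x = 0 by move=> nx; exact: C1c_derive0 fdf nx.
have [M M0 dM] := C1c_derivative_bound fdf.
have iF : (leb d).-integrable setT (EFin \o f) by exact: continuous_supported_integrable.
have mcont (g : 'rV[R]_d -> R) : continuous g -> measurable_fun [set: 'rV[R]_d] g.
  by move=> cg; apply: continuous_measurable_rV; [exact: openT|move=> x _; exact: cg].
have [B B0 hB] := bounded_rVP bOm.
(* The margin [2] contains [Om] together with all shifts of length at most [1], so the quotients
   vanish outside [W]. *)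
pose W := box (const_mx (- (B + 2)) : 'rV[R]_d) (const_mx (B + 2)).
have mW : measurable W by exact: measurable_box.
pose q n x := n.+1%:R * (f (n.+1%:R^-1 *: e_ i + x) - f x).
have csh n : continuous (fun x => f (n.+1%:R^-1 *: e_ i + x)).
  move=> x; apply: (@continuous_comp _ _ _ (fun x => n.+1%:R^-1 *: e_ i + x) f); last exact: cf.
  exact: continuous_addl.
have cq n : continuous (q n).
  apply: continuous_mul; first exact: continuous_cst.
  by apply: continuous_add => // x; exact: (continuousN (cf x)).
have qW n x : `|q n x| <= M * \1_W x.
  rewrite indicE; have [xW|xW] := pselect (W x).
    rewrite mem_set//= mulr1 /q normrM ger0_norm//.
    rewrite -ler_pdivlMl// (le_trans (C1c_lipschitz _ _ _ fdf dM))//.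
    by rewrite ger0_norm// mulrC.
  rewrite memNset//= mulr0.
  have h x' : (forall j, `|x' 0 j - x 0 j| <= 1) -> f x' = 0.
    move=> hx; apply: f0 => Ox'; apply: xW => j; rewrite !mxE -ltr_norml.
    have := hx j; have := hB x' j Ox'; rewrite !ler_norml ltr_norml => /andP[h1 h2] /andP[h3 h4].
    by apply/andP; split; lra.
  rewrite /q !h ?subrr ?mulr0 ?normr0// => j; first by rewrite subrr normr0.
  rewrite !mxE addrK eqxx/= normrM ger0_norm// mulr_ile1 ?invr_ge0//.
    by rewrite invf_le1// ler1n.
  by case: (_ == _); rewrite ?normr1 ?normr0.
have iW : (leb d).-integrable setT (fun x => (M * \1_W x)%:E).
  under eq_fun do rewrite EFinM; apply: integrableZl => //.
  apply/integrableP; split; first exact/measurable_EFinP/measurable_indic.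
  under eq_integral do rewrite gee0_abs ?lee_fin//.
  by rewrite integral_indic// setIT; exact: leb_box_lty.
have [|||||_ _ H] := @dominated_convergence _ _ _ (leb d) setT measurableT
  (fun n x => (q n x)%:E) (fun x => (df i x)%:E) (fun x => (M * \1_W x)%:E).
- by move=> n; apply/measurable_EFinP; exact: mcont.
- by apply/measurable_EFinP; exact: mcont.
- apply: aeW => x _; apply: cvg_EFin; first exact: nearW.
  exact: cvg_difference_quotient.
- exact: iW.
- by apply: aeW => x n _; rewrite lee_fin; exact: qW.
have q0 n : (\int[leb d]_x (q n x)%:E = 0)%E.
  have ish : (leb d).-integrable setT (fun x => (f (n.+1%:R^-1 *: e_ i + x))%:E).
    apply: (@integrable_shift (n.+1%:R^-1 *: e_ i) (EFin \o f)) => //.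
    by apply/measurable_EFinP; exact: mcont.
  rewrite /q; under eq_integral do rewrite EFinM.
  rewrite integralZl//; last first.
    by under eq_fun do rewrite EFinB; apply: integrableB.
  under eq_integral do rewrite EFinB.
  rewrite integralB//.
  under eq_integral do rewrite addrC.
  rewrite (@integral_shift R d (n.+1%:R^-1 *: e_ i) (EFin \o f)).
    by rewrite subee ?mule0//; apply: integrable_fin_num.
  by apply/measurable_EFinP; exact: mcont.
have : (\int[leb d]_x (df i x)%:E = 0)%E.
  apply/esym; apply: (cvg_unique _ _ H) => //=.
  by under eq_fun do rewrite q0; exact: cvg_cst.
rewrite /Rintegral integral_mkcond.
have -> : ((fun x => (df i x)%:E) \_ Om) = (fun x => (df i x)%:E) :> (_ -> \bar R).
  apply/funext => x; rewrite patchE; case: ifPn => //; rewrite notin_setE => /df0 ->//.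
by move=> ->.
Qed.

Definition C1_on u (du : 'I_d -> 'rV[R]_d -> R) := forall x, Om x ->
  {for x, continuous u} /\
  forall i, is_derive x (e_ i) u (du i x) /\ {for x, continuous (du i)}.

(** Extension by zero: a product of a function controlled only on [Om] with a compactly supported
    one becomes globally C^1. *)
Definition ext0 (g : 'rV[R]_d -> R) x := if pselect (Om x) then g x else 0.

Lemma ext0E g x : Om x -> ext0 g x = g x.
Proof. by rewrite /ext0; case: pselect. Qed.

Lemma ext0_out g x : ~ Om x -> ext0 g x = 0.
Proof. by rewrite /ext0; case: pselect. Qed.

Lemma near_ext0 g x : Om x -> \near x, ext0 g x = g x.
Proof.
move=> Ox; have : nbhs x Om by apply: open_nbhs_nbhs; split.
by apply: filterS => y; exact: ext0E.
Qed.

(** The complement of [K] is open, so near a point outside [Om] the extension vanishes identically,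
    while near a point of [Om] it coincides with [f]. *)
Lemma C1c_ext0 f df K : compact K -> K `<=` Om -> C1_on f df ->
  (forall x, Om x -> ~ K x -> f x = 0 /\ forall i, df i x = 0) ->
  C1c Om (ext0 f) (fun i => ext0 (df i)).
Proof.
move=> cK KO fC1 fK.
have nK x : ~ Om x -> \near x, ~ K x.
  move=> nOx; apply: open_nbhs_nbhs; split; last by move=> /KO.
  by apply: closed_openC; apply: compact_closed => //; exact: norm_hausdorff.
have z0 g x : (forall y, Om y -> ~ K y -> g y = 0) -> ~ Om x -> \near x, ext0 g x = 0.
  move=> g0 /nK; apply: filterS => y Ky; rewrite /ext0; case: pselect => // Oy; exact: g0.
have f0 y : Om y -> ~ K y -> f y = 0 by move=> Oy Ky; have [] := fK y Oy Ky.
have df0 i y : Om y -> ~ K y -> df i y = 0 by move=> Oy Ky; have [_] := fK y Oy Ky.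
have cext g : (forall x, Om x -> {for x, continuous g}) -> (forall y, Om y -> ~ K y -> g y = 0) ->
    continuous (ext0 g).
  move=> cg g0 x; have [Ox|nOx] := pselect (Om x).
    have E : \forall y \near x, g y = ext0 g y by have := near_ext0 g Ox; apply: filterS => y ->.
    exact: near_eq_continuous E (cg x Ox).
  apply: (@near_eq_continuous _ _ (ext0 g) (fun=> 0)); last exact: continuous_cst.
  by have := z0 g x g0 nOx; apply: filterS => y ->.
split.
- by apply: cext => // x Ox; have [] := fC1 x Ox.
- move=> i x; have [Ox|nOx] := pselect (Om x).
    rewrite ext0E//; have [_ /(_ i)[h _]] := fC1 x Ox.
    apply: near_eq_is_derive h; apply: filterS (near_ext0 f Ox) => y ->//.
  rewrite ext0_out//.
  apply: near_eq_is_derive (is_derive_cst (0 : R) x (e_ i)).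
  by apply: filterS (z0 _ _ f0 nOx) => y ->.
- by move=> i; apply: cext => [x Ox|]; [have [_ /(_ i)[]] := fC1 x Ox|exact: df0].
- exists K; split => // x Kx; have [Ox|nOx] := pselect (Om x); last exact: ext0_out.
  by rewrite ext0E//; exact: f0.
Qed.

Lemma C1c_C1_on f df : C1c Om f df -> C1_on f df.
Proof. by move=> [cf dff cdf _] x _; split; [exact: cf|move=> i; split; [exact: dff|exact: cdf]]. Qed.

Lemma C1_onM u du f df : C1_on u du -> C1_on f df ->
  C1_on (fun x => u x * f x) (fun i x => u x * df i x + f x * du i x).
Proof.
move=> uC fC x Ox; have [cu du_] := uC x Ox; have [cf df_] := fC x Ox.
split; first exact: (continuousM cu cf).
move=> i; have [d1 c1] := du_ i; have [d2 c2] := df_ i; split; first exact: is_deriveM.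
exact: (continuousD (continuousM cu c2) (continuousM cf c1)).
Qed.

Lemma C1_onD u du f df : C1_on u du -> C1_on f df ->
  C1_on (fun x => u x + f x) (fun i x => du i x + df i x).
Proof.
move=> uC fC x Ox; have [cu du_] := uC x Ox; have [cf df_] := fC x Ox.
split; first exact: (continuousD cu cf).
move=> i; have [d1 c1] := du_ i; have [d2 c2] := df_ i; split; first exact: is_deriveD.
exact: (continuousD c1 c2).
Qed.

Lemma C1_onN u du : C1_on u du -> C1_on (fun x => - u x) (fun i x => - du i x).
Proof.
move=> uC x Ox; have [cu du_] := uC x Ox; split; first exact: (continuousN cu).
move=> i; have [d1 c1] := du_ i; split; first exact: is_deriveN.
exact: (continuousN c1).
Qed.

Lemma C1_on_comp (p dp : R -> R) u du : C1_on u du ->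
  (forall x, Om x -> is_derive (u x) (1 : R) p (dp (u x)) /\ {for u x, continuous dp}) ->
  C1_on (fun x => p (u x)) (fun i x => dp (u x) * du i x).
Proof.
move=> uC pC x Ox; have [cu du_] := uC x Ox; have [dpx cdp] := pC x Ox.
split.
  apply: (@continuous_comp _ _ _ u p) => //.
  by apply: differentiable_continuous; apply/derivable1_diffP; case: dpx.
move=> i; have [d1 c1] := du_ i; split; first exact: is_derive_comp_rV.
by apply: (continuousM _ c1); exact: (@continuous_comp _ _ _ u dp).
Qed.

Lemma C1c_mul u du f df : C1_on u du -> C1c Om f df ->
  C1c Om (ext0 (fun x => u x * f x)) (fun i => ext0 (fun x => u x * df i x + f x * du i x)).
Proof.
move=> uC fC; have [cf dff cdf [K [cK KO K0]]] := fC.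
apply: (C1c_ext0 cK KO) => [|x Ox nK]; first exact/C1_onM/C1c_C1_on.
rewrite K0// mulr0; split=> // i.
suff -> : df i x = 0 by rewrite mulr0 mul0r addr0.
have h : is_derive x (e_ i) (cst 0 : 'rV[R]_d -> R) (df i x).
  apply: near_eq_is_derive (dff i x).
  have : nbhs x (~` K).
    apply: open_nbhs_nbhs; split => //.
    by apply: closed_openC; apply: compact_closed => //; exact: norm_hausdorff.
  by apply: filterS => y; exact: K0.
by rewrite -(@derive_val _ _ _ _ _ _ _ h) derive_cst.
Qed.

Lemma Rintegral_ext0 g : \int[leb d]_(x in Om) ext0 g x = \int[leb d]_(x in Om) g x.
Proof. by apply: eq_Rintegral => x /[!inE] Ox; rewrite ext0E. Qed.

Lemma sqint_C1c f df : C1c Om f df ->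
  sqint (leb d) Om f /\ forall i, sqint (leb d) Om (df i).
Proof.
move=> fdf; have [cf dff cdf _] := fdf.
have H g : continuous g -> (forall x, ~ Om x -> g x = 0) -> sqint (leb d) Om g.
  move=> cg g0; have [M M0 hM] := continuous_supported_bound cg g0.
  apply: (@sqint_bounded _ _ _ _ _ _ M).
  - exact: measurable_Om.
  - exact: leb_Om_lty.
  - by apply: continuous_measurable_rV => // x _; exact: cg.
  - by apply: aeW => x _; exact: hM.
split; first by apply: H => // x nx; exact: C1c_out fdf nx.
by move=> i; apply: H => // x nx; exact: C1c_derive0 fdf nx.
Qed.

(** [integral_partial_C1c] applied to the zero extension of [u * f]. *)
Lemma integration_by_parts u du f df i : C1_on u du -> C1c Om f df ->
  sqint (leb d) Om u -> sqint (leb d) Om (du i) ->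
  L2_ip (leb d) Om u (df i) = - L2_ip (leb d) Om (du i) f.
Proof.
move=> uC fC su sdu; have [sf sdf] := sqint_C1c fC.
have := integral_partial_C1c i (C1c_mul uC fC); rewrite Rintegral_ext0.
have mO := measurable_Om oOm.
rewrite RintegralD//; [|exact: sqintM_integrable|exact: sqintM_integrable].
move/eqP; rewrite addr_eq0 => /eqP h; rewrite /L2_ip h; congr (- _).
by apply: eq_Rintegral => x _; rewrite mulrC.
Qed.

End integration_by_parts.

(** * Weak gradients, [H^1], [H^1_0] and the Poincare inequality *)

Section sobolev_space.
Context {R : realType} {d : nat}.
Variables (Om : set 'rV[R]_d).
Hypotheses (oOm : open Om) (bOm : bounded_set Om).
Implicit Types (f g u v w phi : 'rV[R]_d -> R) (du dv dw : 'I_d -> 'rV[R]_d -> R) (x : 'rV[R]_d).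

Local Notation mu := (leb d).
Local Notation sq := (sqint mu Om).
Local Notation ip := (L2_ip mu Om).
Local Notation dist2 := (dist2 mu Om).
Local Notation cvgL2 := (cvgL2 mu Om).
Let mO : measurable Om := measurable_Om oOm.
Let Ooo : (mu Om < +oo)%E := leb_Om_lty oOm bOm.

Lemma sqint_cst (c : R) : sq (fun=> c).
Proof. by apply: (@sqint_bounded _ _ _ _ _ mO `|c|) => //; apply: aeW. Qed.

Lemma sqint_Rintegrable u : sq u -> mu.-integrable Om (EFin \o u).
Proof.
move=> su; have := sqintM_integrable mO su (sqint_cst 1).
by under eq_fun do rewrite mulr1.
Qed.

Lemma sqint_continuous_bounded (M : R) u : (forall x, Om x -> {for x, continuous u}) ->
  (forall x, Om x -> `|u x| <= M) -> sq u.
Proof.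
move=> cu uM; apply: (@sqint_bounded _ _ _ _ _ mO M) => //; last exact: aeW.
by apply: continuous_measurable_rV => // x; rewrite inE; exact: cu.
Qed.

Lemma weak_partial_unique i u v v' : sq v -> sq v' ->
  weak_partial Om i u v -> weak_partial Om i u v' -> \forall x \ae mu, Om x -> v x = v' x.
Proof.
move=> sv sv' uv uv'.
have := @fundamental_lemma R d Om oOm bOm (fun x => v x - v' x) (sqint_Rintegrable (sqintB mO sv sv')).
move=> h; have {}h : \forall x \ae mu, Om x -> v x - v' x = 0.
  apply: h => phi tphi; have [sphi _] := sqint_C1c oOm bOm (test_function_C1c tphi).
  have := ipBl mO sv sv' sphi; rewrite {1}/ip => ->.
  have := uv phi tphi; rewrite (uv' phi tphi) => /oppr_inj h.
  by rewrite /ip h subrr.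
by apply: filterS h => x h /h /eqP; rewrite subr_eq0 => /eqP.
Qed.

(** Pairs a function with an explicit weak gradient: [wD] is an arbitrary representative, compatible
    with sums and limits only up to null sets. [sob_wD] translates back. *)
Definition sob u du := sq u /\ forall i, sq (du i) /\ weak_partial Om i u (du i).

Lemma sob_sq u du : sob u du -> sq u. Proof. by case. Qed.

Lemma sob_sqd u du i : sob u du -> sq (du i). Proof. by move=> [_ /(_ i)[]]. Qed.

Lemma sobP u du : sq u -> (forall i, sq (du i)) ->
  (forall i phi, test_function Om phi -> ip u (partial i phi) = - ip (du i) phi) -> sob u du.
Proof. by move=> su sdu h; split => // i; split => // phi tphi; exact: h. Qed.

Lemma sob_ip u du i phi : sob u du -> test_function Om phi -> ip u (partial i phi) = - ip (du i) phi.
Proof. by move=> [_ /(_ i)[_ h]] tphi; exact: h. Qed.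

Lemma test_sq phi : test_function Om phi -> sq phi /\ forall i, sq (partial i phi).
Proof. by move=> /test_function_C1c /(sqint_C1c oOm bOm). Qed.

Lemma sobD u du v dv : sob u du -> sob v dv -> sob (fun x => u x + v x) (fun i x => du i x + dv i x).
Proof.
move=> su sv; apply: sobP => [|i|i phi tphi].
- by apply: sqintD => //; [exact: sob_sq su|exact: sob_sq sv].
- by apply: sqintD => //; [exact: sob_sqd su|exact: sob_sqd sv].
have [sp sdp] := test_sq tphi.
rewrite (ipDl mO (sob_sq su) (sob_sq sv) (sdp i)) (sob_ip i su tphi) (sob_ip i sv tphi).
by rewrite (ipDl mO (sob_sqd i su) (sob_sqd i sv) sp) opprD.
Qed.

Lemma sobZ (k : R) u du : sob u du -> sob (fun x => k * u x) (fun i x => k * du i x).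
Proof.
move=> su; apply: sobP => [|i|i phi tphi].
- by apply: sqintZ => //; exact: sob_sq su.
- by apply: sqintZ => //; exact: sob_sqd su.
have [sp sdp] := test_sq tphi.
rewrite (ipZl mO k (sob_sq su) (sdp i)) (sob_ip i su tphi).
by rewrite (ipZl mO k (sob_sqd i su) sp) mulrN.
Qed.

Lemma sobB u du v dv : sob u du -> sob v dv -> sob (fun x => u x - v x) (fun i x => du i x - dv i x).
Proof.
move=> su /(sobZ (-1)) sv; have := sobD su sv.
have -> : (fun x => u x + -1 * v x) = (fun x => u x - v x) by apply/funext => x; rewrite mulN1r.
by have -> : (fun i x => du i x + -1 * dv i x) = (fun i x => du i x - dv i x)
  by apply/funext => i; apply/funext => x; rewrite mulN1r.
Qed.

Lemma sob_C1 u du : C1_on Om u du -> sq u -> (forall i, sq (du i)) -> sob u du.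
Proof.
move=> uC su sdu; apply: sobP => // i phi tphi.
exact: (integration_by_parts oOm bOm uC (test_function_C1c tphi)).
Qed.

Lemma sob_C1c f df : C1c Om f df -> sob f df.
Proof.
move=> fC; have [sf sdf] := sqint_C1c oOm bOm fC.
by apply: sob_C1 => //; exact: C1c_C1_on.
Qed.

Lemma sob_test phi : test_function Om phi -> sob phi (fun i => partial i phi).
Proof. by move=> /test_function_C1c /sob_C1c. Qed.

Lemma sob_H1 u du : sob u du -> H1 Om u.
Proof. by move=> [su h]; split => // i; have [] := h i; exists (du i). Qed.

Lemma H1_sob u : H1 Om u -> sob u (wD Om ^~ u).
Proof.
move=> [su h]; split => // i; have [v sv uv] := h i.
by have := @xgetPex _ (fun=> 0) [set v | L2 Om v /\ weak_partial Om i u v] (ex_intro _ v (conj sv uv)).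
Qed.

Lemma sob_wD u du i : sob u du -> \forall x \ae mu, Om x -> wD Om i u x = du i x.
Proof.
move=> su; have [_ /(_ i)[s1 w1]] := H1_sob (sob_H1 su); have [_ /(_ i)[s2 w2]] := su.
exact: weak_partial_unique w1 w2.
Qed.

Lemma dist2_ae u v u' v' : sq u -> sq v -> sq u' -> sq v' ->
  (\forall x \ae mu, Om x -> u x = u' x) -> (\forall x \ae mu, Om x -> v x = v' x) ->
  dist2 u v = dist2 u' v'.
Proof.
move=> su sv su' sv' uu vv; apply: ip_ae_eq => //; try exact: sqintB.
by apply: filterS2 uu vv => x h1 h2 Ox; rewrite h1// h2.
Qed.

(** Real-valued counterpart of [H1_dist2] for explicit gradients; [H1_dist2_sob] identifies the
    two. *)
Definition hd u du v dv : R := dist2 u v + \sum_i dist2 (du i) (dv i).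

Lemma hd_ge0 u du v dv : 0 <= hd u du v dv.
Proof. by apply: addr_ge0; rewrite ?dist2_ge0// sumr_ge0// => i _; exact: dist2_ge0. Qed.

Lemma hd_le0 u du v dv : dist2 u v <= hd u du v dv.
Proof. by rewrite lerDl sumr_ge0// => i _; exact: dist2_ge0. Qed.

Lemma hd_led i u du v dv : dist2 (du i) (dv i) <= hd u du v dv.
Proof.
rewrite /hd (bigD1 i)//= addrCA lerDl addr_ge0 ?dist2_ge0// sumr_ge0// => j _; exact: dist2_ge0.
Qed.

Lemma H1_dist2_sob u du v dv : sob u du -> sob v dv -> H1_dist2 Om u v = (hd u du v dv)%:E.
Proof.
move=> su sv.
have H1u := H1_sob (sob_H1 su); have H1v := H1_sob (sob_H1 sv).
rewrite /H1_dist2 /hd EFinD; congr (_ + _)%E.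
  exact: (ip_fine (sqintB mO (sob_sq su) (sob_sq sv))).
rewrite -sumEFin; apply: eq_bigr => i _.
rewrite (@dist2_ae (du i) (dv i) (wD Om i u) (wD Om i v)).
- exact: (ip_fine (sqintB mO (sob_sqd i H1u) (sob_sqd i H1v))).
- exact: sob_sqd su.
- exact: sob_sqd sv.
- exact: sob_sqd H1u.
- exact: sob_sqd H1v.
- by apply: filterS (sob_wD i su) => x h /h.
- by apply: filterS (sob_wD i sv) => x h /h.
Qed.

Lemma H1_dist2_cvgP us dus u du : (forall n, sob (us n) (dus n)) -> sob u du ->
  H1_dist2 Om (us n) u @[n --> \oo] --> 0%E <-> hd (us n) (dus n) u du @[n --> \oo] --> (0 : R).
Proof.
move=> sus su; under eq_fun do rewrite (H1_dist2_sob (sus _) su).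
by split => [/fine_cvg//|h]; apply: cvg_EFin => //; exact: nearW.
Qed.

Lemma hd_cvgL2 us dus u du : hd (us n) (dus n) u du @[n --> \oo] --> (0 : R) ->
  cvgL2 us u /\ forall i, cvgL2 (fun n => dus n i) (du i).
Proof.
move=> h; split => [|i].
  by apply: (@cvg0_le _ _ _ 1 _ _ h) => n; rewrite ?dist2_ge0// mul1r hd_le0.
by apply: (@cvg0_le _ _ _ 1 _ _ h) => n; rewrite ?dist2_ge0// mul1r hd_led.
Qed.

Lemma cvg_sum0 (F : 'I_d -> R^nat) : (forall i, F i n @[n --> \oo] --> (0 : R)) ->
  \sum_i F i n @[n --> \oo] --> (0 : R).
Proof.
move=> h; suff : \sum_i F i n @[n --> \oo] --> \sum_(i < d) (0 : R) by rewrite big1.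
by apply: cvg_big => //; exact: add_continuous.
Qed.

Lemma cvgL2_hd us dus u du : cvgL2 us u -> (forall i, cvgL2 (fun n => dus n i) (du i)) ->
  hd (us n) (dus n) u du @[n --> \oo] --> (0 : R).
Proof.
move=> h hd_; rewrite -[X in _ --> X]addr0; apply: cvgD; first exact: h.
exact: (@cvg_sum0 (fun i n => dist2 (dus n i) (du i))).
Qed.

(** Both sides of the identity defining a weak derivative are continuous for [L^2] convergence. *)
Lemma sob_closed us dus u du : (forall n, sob (us n) (dus n)) -> sq u -> (forall i, sq (du i)) ->
  hd (us n) (dus n) u du @[n --> \oo] --> (0 : R) -> sob u du.
Proof.
move=> sus su sdu /hd_cvgL2[cu cdu]; apply: sobP => // i phi tphi.
have [sp sdp] := test_sq tphi.
have h1 := cvgL2_ip mO (fun n => sob_sq (sus n)) su (sdp i) cu.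
have h2 : (- ip (dus n i) phi) @[n --> \oo] --> - ip (du i) phi.
  apply: cvgN; exact: (cvgL2_ip mO (fun n => sob_sqd i (sus n)) (sdu i) sp (cdu i)).
rewrite (funext (fun n => sob_ip i (sus n) tphi)) in h1.
exact: (cvg_unique (@norm_hausdorff R _) h1 h2).
Qed.

Definition sob0 u du := sob u du /\
  exists2 phis : ('rV[R]_d -> R)^nat, (forall n, test_function Om (phis n)) &
    hd (phis n) (fun i => partial i (phis n)) u du @[n --> \oo] --> (0 : R).

Lemma sob0_H10 u du : sob0 u du -> H10 Om u.
Proof.
move=> [su [phis tphis cphis]]; split; first exact: sob_H1 su.
exists phis => //; apply/(@H1_dist2_cvgP phis (fun n i => partial i (phis n)) u du) => // n.
exact: sob_test.
Qed.

Lemma H10_sob0 u : H10 Om u -> sob0 u (wD Om ^~ u).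
Proof.
move=> [/H1_sob su [phis tphis cphis]]; split => //; exists phis => //.
apply/(@H1_dist2_cvgP phis (fun n i => partial i (phis n)) u (wD Om ^~ u)) => // n.
exact: sob_test.
Qed.

Lemma sob0_sob u du : sob0 u du -> sob u du. Proof. by case. Qed.

Lemma dist2_uniform (e : R) u v : sq u -> sq v -> 0 <= e ->
  (forall x, Om x -> `|u x - v x| <= e) -> dist2 u v <= e ^+ 2 * ip (fun=> 1) (fun=> 1).
Proof.
move=> su sv e0 h; rewrite -(ip_sqrZ mO e (sqint_cst 1)).
apply: ip_ae_le => //; try exact: sqintB; try exact: sqintZ (sqint_cst 1).
apply: aeW => x Ox; rewrite !mulr1 -!expr2 -(real_normK (num_real (_ - _))).
by rewrite ler_sqr ?nnegrE// h.
Qed.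

Lemma C1c_hd_approx f df (e : R) : C1c Om f df -> 0 < e ->
  exists2 phi, test_function Om phi & hd phi (fun i => partial i phi) f df <= e.
Proof.
move=> fC e0.
pose V := ip (fun=> 1) (fun=> 1); have V0 : 0 <= V by exact: ip_ge0.
(* A uniform error [s] costs at most [s ^+ 2 * V] in each of the [1 + d] terms of [hd]; the last
   [+ 1] keeps [k] positive. *)
pose k := (1 + d%:R) * V + 1.
have k0 : 0 < k by rewrite ltr_wpDl// mulr_ge0// addr_ge0.
pose s := Num.sqrt (e / k).
have s0 : 0 < s by rewrite sqrtr_gt0 divr_gt0.
have [phi tphi hphi] := C1c_approx bOm oOm fC s0.
exists phi => //.
have [sp sdp] := test_sq tphi; have [sf sdf] := sqint_C1c oOm bOm fC.
have s2 : s ^+ 2 = e / k by rewrite sqr_sqrtr// ltW// divr_gt0.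
have h0 : dist2 phi f <= e / k * V.
  rewrite -s2; apply: dist2_uniform => //; first exact: ltW.
  by move=> x Ox; have [] := hphi x Ox.
have h1 i : dist2 (partial i phi) (df i) <= e / k * V.
  rewrite -s2; apply: dist2_uniform => //; first exact: ltW.
  by move=> x Ox; have [_] := hphi x Ox.
apply: (@le_trans _ _ (e / k * V + \sum_(i < d) (e / k * V))).
  by rewrite lerD// ler_sum.
rewrite sumr_const card_ord -mulr_natl.
have -> : e / k * V + d%:R * (e / k * V) = e / k * ((1 + d%:R) * V) by ring.
by rewrite mulrAC ler_pdivrMr// ler_pM2l// lerDl.
Qed.

(** Membership in [H^1_0] asks for smooth approximants; [C1c_hd_approx] upgrades C^1 ones. *)
Lemma sob0_approx u du : sq u -> (forall i, sq (du i)) ->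
  (forall e : R, 0 < e -> exists f df, C1c Om f df /\ hd f df u du <= e) -> sob0 u du.
Proof.
move=> su sdu H.
have /choice[phis hphis] : forall n : nat, exists phi, test_function Om phi /\
    hd phi (fun i => partial i phi) u du <= n.+1%:R^-1.
  (* A quarter, because [|x + y|^2 <= 2 |x|^2 + 2 |y|^2] doubles each of the two errors. *)
  move=> n; have e0 : 0 < n.+1%:R^-1 / 4 :> R by rewrite divr_gt0 ?invr_gt0.
  have [f [df [fC fu]]] := H _ e0.
  have [phi tphi pf] := C1c_hd_approx fC e0.
  exists phi; split => //.
  have [sp sdp] := test_sq tphi; have [sf sdf] := sqint_C1c oOm bOm fC.
  apply: (@le_trans _ _ (2 * hd phi (fun i => partial i phi) f df + 2 * hd f df u du)); last first.
    by move: (n.+1%:R^-1) (hd _ _ _ _) (hd _ _ _ _) fu pf => t r s; lra.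
  rewrite /hd !mulrDr addrACA lerD ?dist2_tri//.
  by rewrite !mulr_sumr -big_split/=; apply: ler_sum => i _; exact: dist2_tri.
have tp n : test_function Om (phis n) by have [] := hphis n.
have cp : hd (phis n) (fun i => partial i (phis n)) u du @[n --> \oo] --> (0 : R).
  apply: (@squeeze_cvgr _ _ _ _ (fun=> 0) (fun n => n.+1%:R^-1)).
  - by apply: nearW => n; rewrite hd_ge0; have [] := hphis n.
  - exact: cvg_cst.
  - exact: cvg_harmonic.
split; last by exists phis.
by apply: (sob_closed _ su sdu cp) => n; exact: sob_test.
Qed.

Lemma C1c_sob0 f df : C1c Om f df -> sob0 f df.
Proof.
move=> fC; have [sf sdf] := sqint_C1c oOm bOm fC.
apply: sob0_approx => // e e0; exists f, df; split => //.
rewrite /hd /dist2 big1 ?addr0; last by move=> i _; apply: ip_ae0 => //; [exact: sqintB|apply: aeW => x _; rewrite subrr].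
by rewrite ip_ae0 ?ltW//; [exact: sqintB|apply: aeW => x _; rewrite subrr].
Qed.

(** Integrating [x_i] against the derivative of [f ^+ 2] gives [\int f^2 = - 2 \int x_i f d_i f],
    and Young's inequality absorbs half of the left-hand side. *)
Lemma poincare_C1c (B : R) f df i : 0 < B -> (forall x, Om x -> `|x 0 i| <= B) ->
  C1c Om f df -> ip f f <= 4 * B ^+ 2 * ip (df i) (df i).
Proof.
move=> B0 OB fC; have [sf sdf] := sqint_C1c oOm bOm fC.
have mx : measurable_fun Om (fun x : 'rV[R]_d => x 0 i).
  by apply: continuous_measurable_rV => // x _; exact: coord_continuous.
have xB : {ae mu, forall x : 'rV[R]_d, Om x -> `|x 0 i| <= B} by exact: aeW.
have sxf : sq (fun x => x 0 i * f x) by exact: (sqint_mul_bounded mO mx xB).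
have sxd j : sq (fun x => x 0 i * df j x) by exact: (sqint_mul_bounded mO mx xB).
have xC : C1_on Om (fun x : 'rV[R]_d => x 0 i) (fun j _ => (j == i)%:R).
  move=> x _; split; first exact: coord_continuous.
  by move=> j; split; [exact: is_derive_coord|exact: continuous_cst].
have sg : sq (fun x => x 0 i * df i x + f x * (i == i)%:R).
  apply: sqintD => //; have := sqintZ mO (i == i)%:R sf.
  by under eq_fun do rewrite mulrC.
have E := integration_by_parts oOm bOm (C1_onM xC (C1c_C1_on fC)) fC sxf sg.
have E1 : ip (fun x => x 0 i * df i x + f x * (i == i)%:R) f =
    ip (fun x => x 0 i * f x) (df i) + ip f f.
  have -> : ip (fun x => x 0 i * f x) (df i) = ip (fun x => x 0 i * df i x) f.
    by apply: eq_Rintegral => x _; rewrite mulrAC.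
  by rewrite -ipDl//; apply: eq_Rintegral => x _; rewrite eqxx mulr1.
rewrite E1 in E.
(* With [|x_i| <= B], this weight makes the first Young term at most [ip f f / 2]. *)
have B2 : 0 < B ^- 2 / 2 by rewrite divr_gt0// invr_gt0 exprn_gt0.
have Y := ip_le_young mO B2 sxf (sdf i).
have X : ip (fun x => x 0 i * f x) (fun x => x 0 i * f x) <= B ^+ 2 * ip f f.
  rewrite -(ip_sqrZ mO B sf); apply: ip_ae_le => //; try exact: sqintZ.
  apply: aeW => x Ox; rewrite -!expr2 !exprMn ler_wpM2r ?sqr_ge0//.
  by rewrite -(real_normK (num_real (x 0 i))) ler_sqr ?nnegrE ?OB// ltW.
have F0 : 0 <= ip f f by exact: ip_ge0.
move: E Y X F0; move: (ip (fun x => x 0 i * f x) (df i)) (ip f f) => p q.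
move: (ip _ _) (ip (df i) (df i)) => r s E Y X F0.
have -> : 4 * B ^+ 2 * s = 2 * ((B ^- 2 / 2)^-1 * s) by field; rewrite gt_eqF.
have : B ^- 2 / 2 * r <= q / 2.
  by rewrite mulrAC ler_pM2r ?invr_gt0// mulrC ler_pdivrMr ?exprn_gt0// mulrC.
have pq : 2 * p = - q by lra.
have p0 : p <= 0 by lra.
rewrite ler0_norm// in Y.
by move: ((B ^- 2 / 2)^-1 * s) (B ^- 2 / 2 * r) Y => t v Y Z; lra.
Qed.

Lemma sob0_ip_limit u du : sob0 u du -> exists phis : ('rV[R]_d -> R)^nat,
  [/\ forall n, test_function Om (phis n),
      cvgL2 phis u & forall i, cvgL2 (fun n => partial i (phis n)) (du i)].
Proof. by move=> [_ [phis tp /hd_cvgL2[h1 h2]]]; exists phis; split. Qed.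

Lemma ip_le_dist2 u v : sq u -> sq v -> ip u u <= 2 * dist2 u v + 2 * ip v v.
Proof.
move=> su sv; have := ip_sqrD_le mO (sqintB mO su sv) sv.
by congr (_ <= _); apply: eq_ip => x _; rewrite subrK.
Qed.

(** [16] instead of [4]: a squared norm is doubled once for [u] and once for its derivative when the
    limit is replaced by an approximation. *)
Lemma poincare_sob0 (B : R) u du i : 0 < B -> (forall x, Om x -> `|x 0 i| <= B) ->
  sob0 u du -> ip u u <= 16 * B ^+ 2 * ip (du i) (du i).
Proof.
move=> B0 OB s0; have [phis [tp cp cdp]] := sob0_ip_limit s0.
have su := sob_sq (sob0_sob s0); have sdu := sob_sqd i (sob0_sob s0).
apply/ler_addgt0Pr => e e0.
pose k := 2 + 16 * B ^+ 2.
have k0 : 0 < k by rewrite ltr_pwDl// mulr_ge0// sqr_ge0.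
have ek : 0 < e / k by rewrite divr_gt0.
have [n h1 h2] : exists2 n, dist2 (phis n) u <= e / k & dist2 (partial i (phis n)) (du i) <= e / k.
  have /cvgr_le/(_ _ ek)[N1 _ hN1] := cp; have /cvgr_le/(_ _ ek)[N2 _ hN2] := cdp i.
  exists (maxn N1 N2); [apply: hN1|apply: hN2] => /=; [exact: leq_maxl|exact: leq_maxr].
have [sp sdp] := test_sq (tp n).
have P := poincare_C1c B0 OB (test_function_C1c (tp n)).
have h3 := ip_le_dist2 su sp; rewrite dist2C in h3.
have h4 := ip_le_dist2 (sdp i) sdu.
apply: (le_trans h3); rewrite (@le_trans _ _ (2 * (e / k) + 2 * (4 * B ^+ 2 * (2 * (e / k) + 2 * ip (du i) (du i)))))//.
  have B4 : 0 <= 4 * B ^+ 2 by rewrite mulr_ge0// sqr_ge0.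
  rewrite lerD// ?ler_pM2l// (le_trans P)// ler_wpM2l//.
  by rewrite (le_trans h4)// lerD2r ler_pM2l.
have -> : 2 * (e / k) + 2 * (4 * B ^+ 2 * (2 * (e / k) + 2 * ip (du i) (du i))) =
  16 * B ^+ 2 * ip (du i) (du i) + (e / k) * k by rewrite /k; ring.
by rewrite divfK ?gt_eqF.
Qed.

End sobolev_space.

(** * Existence for bounded Lipschitz reactions *)

Section minimization.
Context {R : realType} {V : lmodType R}.
Variables (S : set V) (J : V -> R) (L : V -> V -> R) (Q : V -> R) (al be c0 : R).
Hypotheses (S0 : S 0) (SZ : forall (t : R) u v, S u -> S v -> S (u + t *: v)).
Hypothesis al0 : 0 < al.
Hypothesis LZ : forall (t : R) u v, S u -> S v -> L u (t *: v) = t * L u v.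
Hypothesis QZ : forall (t : R) v, S v -> Q (t *: v) = t ^+ 2 * Q v.
Hypothesis Q0 : forall v, S v -> 0 <= Q v.
Hypothesis Jlo : forall u v, S u -> S v -> J u + L u v + al * Q v <= J (u + v).
Hypothesis Jhi : forall u v, S u -> S v -> J (u + v) <= J u + L u v + be * Q v.
Hypothesis L0 : forall v, S v -> - L 0 v <= al * Q v + c0.

Let Sz (t : R) u : S u -> S (t *: u).
Proof. by move=> Su; have := SZ t S0 Su; rewrite add0r. Qed.

(* [J] is the functional, [L u] its derivative at [u] and [Q] the squared norm:
   [Jlo] is uniform convexity and [Jhi] smoothness.  The vector space carries no
   topology, hence the conclusion speaks of a sequence only. *)
Lemma minimizing_sequence : exists us : V^nat,
  [/\ forall n, S (us n),
      forall e, 0 < e -> exists N, forall n m, (N <= n)%N -> (N <= m)%N -> Q (us n - us m) <= e &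
      forall v, S v -> L (us n) v @[n --> \oo] --> (0 : R)].
Proof.
pose E := [set J u | u in S].
have lE : has_lbound E.
  exists (J 0 - c0) => _ [u Su <-]; have := Jlo S0 Su; have := L0 Su; rewrite add0r.
  by move: (al * Q u) => q; lra.
have iE : has_inf E by split => //; exists (J 0), 0.
pose m := inf E.
have Jm u : S u -> m <= J u by move=> Su; apply: ge_inf => //; exists u.
have /choice[us hus] : forall n : nat, exists u, S u /\ J u < m + n.+1%:R^-1.
  move=> n; have e0 : 0 < n.+1%:R^-1 :> R by rewrite invr_gt0.
  by have [_ [u Su <-] h] := inf_adherent e0 iE; exists u.
have Su n : S (us n) by have [] := hus n.
have small (e : R) : 0 < e -> exists N, forall n, (N <= n)%N -> J (us n) < m + e.
  move=> e0; have [N hN] : exists N : nat, e^-1 < N%:R by eexists; exact: truncnS_gt.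
  exists N => n Nn; have [_ /lt_trans] := hus n; apply.
  rewrite ltrD2l invf_plt ?posrE// (lt_le_trans hN)// ler_nat; exact: leq_trans (leqnSn n).
exists us; split => //.
- move=> e e0; have ee : 0 < al * e / 4 by rewrite !mulr_gt0.
  have [N hN] := small _ ee; exists N => n k /hN hn /hN hk.
  (* Uniform convexity at the midpoint [u] in the directions [v] and [- v]: the linear terms cancel,
     and near-minimality bounds [Q] of the difference. *)
  pose v := 2^-1 *: (us n - us k); pose u := us k + v.
  have Sd : S (us n - us k) by rewrite -scaleN1r; exact: SZ.
  have Sv : S v by exact: Sz.
  have Suu : S u by rewrite /u -[v]scale1r; exact: SZ.
  have un : u + v = us n.
    by rewrite /u /v -addrA -scalerDl (_ : 2^-1 + 2^-1 = 1 :> R) ?scale1r ?subrKC//; lra.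
  have uk : u + (-1) *: v = us k by rewrite scaleN1r /u addrK.
  have h1 := Jlo Suu Sv; have := Jlo Suu (Sz (-1) Sv); rewrite LZ// QZ// uk => h2.
  have mu_ := Jm _ Suu; rewrite un /v QZ// in h1.
  rewrite /v QZ// in h2.
  have : al * Q (us n - us k) <= al * e.
    move: hn hk h1 h2 mu_; move: (Q _) (J _) (J _) (J _) (L _ _) => q j1 j2 j3 l; nra.
  by rewrite ler_pM2l.
- move=> v Sv; apply/cvgr0Pnorm_le => e e0.
  have Qv := Q0 Sv.
  pose k := `|be| * Q v + 1; have k0 : 0 < k by rewrite ltr_wpDl// mulr_ge0.
  (* So small that the quadratic remainder is below [t * (e / 2)]. A point minimising up to
     [t * (e / 2)] then has slope at most [e] in the directions [v] and [- v]. *)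
  pose t := e / 2 / k; have t0 : 0 < t by rewrite !divr_gt0.
  have te : be * (t ^+ 2 * Q v) <= t * (e / 2).
    have -> : be * (t ^+ 2 * Q v) = t * (t * (be * Q v)) by ring.
    rewrite ler_pM2l// {1}/t mulrAC ler_pdivrMr// ler_pM2l ?divr_gt0//.
    by rewrite /k ler_wpDr// ler_wpM2r// ler_norm.
  have ee : 0 < t * (e / 2) by rewrite mulr_gt0// divr_gt0.
  have [N hN] := small _ ee; exists N => // n /hN hn.
  have h1 := Jhi (Su n) (Sz t Sv); have h2 := Jhi (Su n) (Sz (- t) Sv).
  have m1 := Jm _ (SZ t (Su n) Sv); have m2 := Jm _ (SZ (- t) (Su n) Sv).
  rewrite !LZ// !QZ// sqrrN in h1 h2.
  have h3 : t * L (us n) v <= t * e by lra.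
  have h4 : t * - L (us n) v <= t * e by rewrite mulrN -mulNr; lra.
  rewrite ler_pM2l// in h3; rewrite ler_pM2l// in h4.
  by rewrite ler_norml h3 andbT lerNl.
Qed.

End minimization.

(** * The weak form and the energy of the truncated problem *)

Section weak_form.
Context {R : realType} {d : nat}.
Variables (Om : set 'rV[R]_d).
Hypotheses (oOm : open Om) (bOm : bounded_set Om).
Variables (a : 'rV[R]_d -> R) (K0 K1 : R).
Hypotheses (K00 : 0 < K0) (ma : measurable_fun Om (a : 'rV[R]_d -> measurableTypeR R)).
Hypothesis aK : forall x, Om x -> K0 <= a x <= K1.
Implicit Types (f g u v w N : 'rV[R]_d -> R) (df du dv dw : 'I_d -> 'rV[R]_d -> R) (x : 'rV[R]_d).

Local Notation mu := (leb d).
Local Notation sq := (sqint mu Om).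
Local Notation ip := (L2_ip mu Om).
Local Notation dist2 := (dist2 mu Om).
Local Notation cvgL2 := (cvgL2 mu Om).
Let mO : measurable Om := measurable_Om oOm.

Definition energy du df : R := \sum_i ip (fun x => a x * du i x) (df i).

Definition weak_form du N f df : R := energy du df + ip N f.

Lemma sq_a u : sq u -> sq (fun x => a x * u x).
Proof.
apply: (@sqint_mul_bounded _ _ _ _ _ mO K1) => //; apply: aeW => x Ox.
by have /andP[h1 h2] := aK Ox; rewrite ger0_norm// (le_trans (ltW K00)).
Qed.

Lemma energyC du df : energy du df = energy df du.
Proof. by apply: eq_bigr => i _; apply: eq_ip => x _; ring. Qed.

Lemma energy_ge du : (forall i, sq (du i)) -> K0 * \sum_i ip (du i) (du i) <= energy du du.
Proof.
move=> su; rewrite mulr_sumr; apply: ler_sum => i _; rewrite -(ipZl mO)//.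
apply: ip_ae_le => //; [exact: sqintZ|exact: sq_a|].
apply: aeW => x Ox; rewrite -!mulrA ler_wpM2r//; last by have /andP[] := aK Ox.
by rewrite -expr2 sqr_ge0.
Qed.

Lemma energy_le du : (forall i, sq (du i)) -> energy du du <= K1 * \sum_i ip (du i) (du i).
Proof.
move=> su; rewrite mulr_sumr; apply: ler_sum => i _; rewrite -(ipZl mO)//.
apply: ip_ae_le => //; [exact: sq_a|exact: sqintZ|].
apply: aeW => x Ox; rewrite -!mulrA ler_wpM2r//; last by have /andP[] := aK Ox.
by rewrite -expr2 sqr_ge0.
Qed.

Lemma energyDl du dv df : (forall i, sq (du i)) -> (forall i, sq (dv i)) -> (forall i, sq (df i)) ->
  energy (fun i x => du i x + dv i x) df = energy du df + energy dv df.
Proof.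
move=> su sv sf; rewrite /energy -big_split; apply: eq_bigr => i _ /=.
by rewrite -(ipDl mO) ?sq_a//; [apply: eq_ip => x _; ring|exact: sq_a|exact: sq_a].
Qed.

Lemma energyZl (k : R) du df : (forall i, sq (du i)) -> (forall i, sq (df i)) ->
  energy (fun i x => k * du i x) df = k * energy du df.
Proof.
move=> su sf; rewrite /energy mulr_sumr; apply: eq_bigr => i _.
by rewrite -(ipZl mO)//; [apply: eq_ip => x _; ring|exact: sq_a].
Qed.

Lemma energyZr (k : R) du df : (forall i, sq (du i)) -> (forall i, sq (df i)) ->
  energy du (fun i x => k * df i x) = k * energy du df.
Proof. by move=> su sf; rewrite energyC energyZl// energyC. Qed.

Lemma energyDD du df : (forall i, sq (du i)) -> (forall i, sq (df i)) ->
  energy (fun i x => du i x + df i x) (fun i x => du i x + df i x) =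
  energy du du + 2 * energy du df + energy df df.
Proof.
move=> su sf; have sD i : sq (fun x => du i x + df i x) by exact: sqintD.
rewrite energyDl// (energyC du) (energyC df) !energyDl// (energyC df du); ring.
Qed.

Lemma cvg_energy dus du df : (forall n i, sq (dus n i)) -> (forall i, sq (du i)) -> (forall i, sq (df i)) ->
  (forall i, cvgL2 (fun n => dus n i) (du i)) -> energy (dus n) df @[n --> \oo] --> energy du df.
Proof.
move=> sus su sf h; apply: cvg_big => // [|i _]; first exact: add_continuous.
have E v : ip (fun x => a x * v x) (df i) = ip v (fun x => a x * df i x).
  by apply: eq_ip => x _; ring.
by rewrite E; under eq_fun do rewrite E; apply: cvgL2_ip => //; exact: sq_a.
Qed.

Lemma lipschitz_measurable (p : R -> R) (L : R) : (forall s t, `|p t - p s| <= L * `|t - s|) ->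
  measurable_fun setT p.
Proof.
move=> pL; apply: continuous_measurable_fun => s; apply/cvgrPdist_le => e e0.
have L1 : 0 < `|L| + 1 by rewrite ltr_wpDl.
near=> t; rewrite distrC (le_trans (pL _ _))//.
apply: (@le_trans _ _ ((`|L| + 1) * `|t - s|)).
  by rewrite ler_wpM2r// (le_trans (ler_norm L))// lerDl.
rewrite mulrC -ler_pdivlMr// distrC; near: t; apply: cvgr_dist_le; last by rewrite divr_gt0.
exact: cvg_id.
Unshelve. all: by end_near. Qed.

Lemma C1c_comb (t : R) f df g dg : C1c Om f df -> C1c Om g dg ->
  C1c Om (fun x => f x + t * g x) (fun i x => df i x + t * dg i x).
Proof.
move=> [cf ff cdf [A [cA AO A0]]] [cg gg cdg [A' [cA' AO' A0']]]; split.
- by apply: continuous_add => //; apply: continuous_mul => //; exact: continuous_cst.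
- by move=> i x; apply: is_deriveD; exact: is_deriveZ.
- by move=> i; apply: continuous_add => //; apply: continuous_mul => //; exact: continuous_cst.
- exists (A `|` A'); split; first exact: compactU.
    by move=> x [/AO|/AO'].
  by move=> x /not_orP[nA nA']; rewrite A0// A0'// mulr0 addr0.
Qed.

Lemma poincare (i0 : 'I_d) : exists2 P : R, 0 < P &
  forall u du, sob0 Om u du -> ip u u <= P * \sum_i ip (du i) (du i).
Proof.
have [D D0 OD] := bounded_rVP bOm; exists (16 * D ^+ 2); first by rewrite mulr_gt0// exprn_gt0.
move=> u du s0; have [h _] := s0.
apply: (le_trans (poincare_sob0 oOm bOm D0 (fun x => OD x i0) s0)).
rewrite ler_wpM2l//; first by rewrite mulr_ge0// sqr_ge0.
by rewrite (bigD1 i0)//= lerDl sumr_ge0// => i _; exact: ip_ge0.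
Qed.

Section existence.
Variables (b c : 'rV[R]_d -> R) (B C : R).
Hypotheses (mb : measurable_fun Om (b : 'rV[R]_d -> measurableTypeR R))
  (mc : measurable_fun Om (c : 'rV[R]_d -> measurableTypeR R)).
Hypothesis bB : \forall x \ae mu, Om x -> 0 <= b x <= B.
Hypothesis cC : \forall x \ae mu, Om x -> - C <= c x <= 0.
Variables (k K : R -> R) (M L : R).
Hypotheses (kM : forall t, `|k t| <= M) (kL : forall s t, `|k t - k s| <= L * `|t - s|).
(** [K] is a concave primitive of [k], expressed by a two-sided tangent bound. The left inequality
    is concavity, which the factor [c <= 0] turns into convexity of the energy; the right one gives
    smoothness. *)
Hypothesis Kk : forall s t, 0 <= K s + k s * (t - s) - K t <= L * (t - s) ^+ 2.

Let M0 : 0 <= M. Proof. by rewrite (le_trans _ (kM 0)). Qed.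
Let L0 : 0 <= L.
Proof. by have := kL 0 1; rewrite subr0 normr1 mulr1; apply: le_trans. Qed.

(** [Kk] at [(s, t)] and at [(t, s)] bounds the increment from both sides by tangents of slope at
    most [M]. *)
Let K_lip s t : `|K t - K s| <= M * `|t - s|.
Proof.
have /andP[h1 _] := Kk s t; have /andP[h2 _] := Kk t s.
have g1 : k s * (t - s) <= M * `|t - s| by rewrite (le_trans (ler_norm _))// normrM ler_wpM2r.
have g2 : k t * (s - t) <= M * `|t - s|.
  by rewrite (le_trans (ler_norm _))// normrM (distrC t s) ler_wpM2r.
rewrite ler_norml; lra.
Qed.

Lemma sq_b u : sq u -> sq (fun x => b x * u x).
Proof.
apply: (@sqint_mul_bounded _ _ _ _ _ mO B) => //; apply: filterS bB => x h Ox.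
by have /andP[h1 h2] := h Ox; rewrite ger0_norm.
Qed.

Lemma sq_c u : sq u -> sq (fun x => c x * u x).
Proof.
apply: (@sqint_mul_bounded _ _ _ _ _ mO C) => //; apply: filterS cC => x h Ox.
by have /andP[h1 h2] := h Ox; rewrite ler0_norm// lerNl.
Qed.

Let sq_c1 : sq c.
Proof. by have := sq_c (sqint_cst oOm bOm 1); under eq_fun do rewrite mulr1. Qed.

Lemma sq_k u : sq u -> sq (fun x => k (u x)).
Proof.
move=> [mu_ _]; apply: (@sqint_bounded _ _ _ _ _ mO M) => //; first exact: leb_Om_lty.
  by apply: (measurableT_comp _ mu_); exact: (lipschitz_measurable kL).
by apply: aeW => x _; exact: kM.
Qed.

Let sq_K u : sq u -> sq (fun x => K (u x)).
Proof.
move=> su; have mK : measurable_fun setT K by exact: (lipschitz_measurable K_lip).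
have h : sq (fun x => K (u x) - K 0).
  apply: (sqint_le mO _ (sqintZ mO M su)).
    by apply: measurable_funB => //; apply: (measurableT_comp mK); have [] := su.
  by apply: aeW => x _; rewrite normrM (ger0_norm M0) (le_trans (K_lip _ _))// subr0.
have := sqintD mO h (sqint_cst oOm bOm (K 0)).
by under eq_fun do rewrite subrK.
Qed.

Definition reaction u x := b x * u x + c x * k (u x).

Lemma sq_reaction u : sq u -> sq (reaction u).
Proof. by move=> su; apply: sqintD => //; [exact: sq_b|exact/sq_c/sq_k]. Qed.

(** The linear part is an inner product with [b * f]; in the other part the Lipschitz bound on [k]
    preserves [L^2] convergence. *)
Lemma cvgL2_reaction us u f : (forall n, sq (us n)) -> sq u -> sq f ->
  cvgL2 us u -> ip (reaction (us n)) f @[n --> \oo] --> ip (reaction u) f.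
Proof.
move=> sus su sf cu.
have E v : sq v -> ip (reaction v) f = ip v (fun x => b x * f x) + ip (fun x => k (v x)) (fun x => c x * f x).
  move=> sv; rewrite (ipDl mO)//; [|exact: sq_b|exact/sq_c/sq_k].
  by congr (_ + _); apply: eq_ip => x _; ring.
rewrite E//; under eq_fun do rewrite E//.
apply: cvgD; first by apply: cvgL2_ip => //; exact: sq_b.
apply: cvgL2_ip => //; [by move=> n; exact: sq_k|exact: sq_k|exact: sq_c|].
apply: (@cvg0_le _ _ _ (L ^+ 2)) cu => n; first exact: dist2_ge0.
rewrite /dist2 -(ip_sqrZ mO); last exact: sqintB.
apply: ip_ae_le => //; try (by apply: sqintB => //; exact: sq_k); try (by apply: sqintZ => //; exact: sqintB).
apply: aeW => x _; rewrite -!expr2 -[leLHS]real_normK ?num_real// -[leRHS]real_normK ?num_real//.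
by rewrite ler_sqr ?nnegrE// normrM (ger0_norm L0) kL.
Qed.

(** The functional whose derivative is [weak_form], as the expansion [potentialD] shows. *)
Definition potential u du : R :=
  2^-1 * energy du du + 2^-1 * ip (fun x => b x * u x) u + ip c (fun x => K (u x)).

(** Gap between the concave [K] and its tangent. Paired with [- c >= 0] it is the contribution of
    the singular term to convexity. *)
Let defect u f x := K (u x) + k (u x) * f x - K (u x + f x).

Let sq_kM u f : sq u -> sq f -> sq (fun x => k (u x) * f x).
Proof.
move=> su sf; apply: (@sqint_mul_bounded _ _ _ _ _ mO M) => //; first by have [] := sq_k su.
by apply: aeW => x _.
Qed.

Let defect_bound u f x : 0 <= defect u f x <= L * (f x) ^+ 2.
Proof. by have := Kk (u x) (u x + f x); rewrite [u x + f x - u x]addrC addKr. Qed.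

Let sq_defect u f : sq u -> sq f -> sq (defect u f).
Proof.
move=> su sf; apply: sqintB => //; last by exact/sq_K/sqintD.
by apply: sqintD => //; [exact: sq_K|exact: sq_kM].
Qed.

Let potentialD u du f df : sq u -> (forall i, sq (du i)) -> sq f -> (forall i, sq (df i)) ->
  potential (fun x => u x + f x) (fun i x => du i x + df i x) =
  potential u du + weak_form du (reaction u) f df +
  (2^-1 * energy df df + 2^-1 * ip (fun x => b x * f x) f + ip (fun x => - c x) (defect u f)).
Proof.
move=> su sdu sf sdf; rewrite /potential /weak_form energyDD//.
have sbu := sq_b su; have sbf := sq_b sf; have sku := sq_c (sq_k su).
have -> : ip (fun x => b x * (u x + f x)) (fun x => u x + f x) =
    ip (fun x => b x * u x) u + 2 * ip (fun x => b x * u x) f + ip (fun x => b x * f x) f.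
  rewrite (@eq_ip _ _ _ _ _ _ (fun x => b x * u x + b x * f x) _ (fun x => u x + f x)); last first.
    by move=> x _; ring.
  rewrite (ipDl mO)//; last exact: sqintD.
  rewrite !(ipDr mO)// (@eq_ip _ _ _ _ _ (fun x => b x * f x) (fun x => b x * u x) u f); last first.
    by move=> x _; ring.
  ring.
have -> : ip (reaction u) f = ip (fun x => b x * u x) f + ip (fun x => c x * k (u x)) f.
  by rewrite (ipDl mO).
have -> : ip c (fun x => K (u x + f x)) = ip c (fun x => K (u x)) +
    ip (fun x => c x * k (u x)) f + ip (fun x => - c x) (defect u f).
  have sKu := sq_K su; have sD := sq_defect su sf.
  have sN : sq (fun x => - c x) by exact: sqintN.
  have skf := sq_kM su sf; have sKD := sq_K (sqintD mO su sf).
  rewrite (ipNl mO)// (ipBr mO)//; last exact: sqintD.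
  rewrite (ipDr mO)//.
  have -> : ip c (fun x => k (u x) * f x) = ip (fun x => c x * k (u x)) f by apply: eq_ip => x _; ring.
  ring.
by lra.
Qed.

Let cD0 u f : sq u -> sq f -> 0 <= ip (fun x => - c x) (defect u f).
Proof.
move=> su sf; apply: ip_ae_ge0 => //; [exact: sqintN|exact: sq_defect|].
apply: filterS cC => x h Ox; have /andP[_ c0] := h Ox; rewrite mulr_ge0 ?oppr_ge0//.
by have /andP[] := defect_bound u f x.
Qed.

Let cD1 u f : sq u -> sq f -> ip (fun x => - c x) (defect u f) <= C * L * ip f f.
Proof.
move=> su sf; rewrite -(ipZl mO)//.
apply: ip_ae_le => //; [exact: sqintN|exact: sq_defect|exact: sqintZ|].
apply: filterS cC => x h Ox; have /andP[c1 c0] := h Ox.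
have /andP[d0 d1] := defect_bound u f x.
by rewrite -!mulrA ler_pM ?oppr_ge0// 1?lerNl// -expr2.
Qed.

Hypotheses (B0 : 0 <= B) (C0 : 0 <= C).

(** The minimisation runs over compactly supported C^1 perturbations of [h]; only the limit of the
    minimising sequence lives in [H^1_0]. *)
Lemma weak_solution_exists (i0 : 'I_d) h dh : sob Om h dh -> exists w dw, sob0 Om w dw /\
  forall f df, sob0 Om f df ->
    weak_form (fun i x => dh i x + dw i x) (reaction (fun x => h x + w x)) f df = 0.
Proof.
move=> hs; have [P P0 hP] := poincare i0.
have sh := sob_sq hs; have sdh i := sob_sqd i hs.
(* [None] holds the function and [Some i] its i-th derivative: a plain function space, so the module
   structure is available at once. *)
pose V : lmodType R := option 'I_d -> 'rV[R]_d -> R.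
pose f1 (p : V) := p None; pose f2 (p : V) i := p (Some i).
pose S : set V := [set p | C1c Om (f1 p) (f2 p)].
have Ss (p : V) : S p -> sq (f1 p) /\ forall i, sq (f2 p i) by move=> /(sqint_C1c oOm bOm).
pose U (p : V) x := h x + (f1 p x); pose dU (p : V) i x := dh i x + (f2 p i) x.
have sU p : S p -> sq (U p) by move=> /Ss[? _]; exact: sqintD.
have sdU p : S p -> forall i, sq (dU p i) by move=> /Ss[_ ?] i; exact: sqintD.
pose J p := potential (U p) (dU p).
pose L' p (q : V) := weak_form (dU p) (reaction (U p)) (f1 q) (f2 q).
pose Q (p : V) := \sum_i ip (f2 p i) (f2 p i).
have E1 (t : R) (v : V) : f1 (t *: v) = fun x => t * (f1 v x) by [].
have E2 (t : R) (v : V) : f2 (t *: v) = fun i x => t * (f2 v i) x by [].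
pose al := K0 / 2; have al0 : 0 < al by rewrite divr_gt0.
(* Bounds the second-order part from above: [K1 / 2] from the gradient, the rest from [b] and the
   defect, converted into gradients by the Poincare inequality. *)
pose be := K1 / 2 + (B / 2 + C * L) * P.
have JD p q : S p -> S q -> J (p + q) = J p + L' p q +
    (2^-1 * energy (f2 q) (f2 q) + 2^-1 * ip (fun x => b x * (f1 q x)) (f1 q) +
     ip (fun x => - c x) (defect (U p) (f1 q))).
  move=> Sp Sq; have [sq1 sq2] := Ss q Sq.
  rewrite -potentialD//; [|exact: sU|exact: sdU].
  by rewrite /J; congr potential; [apply/funext => x|apply/funext => i; apply/funext => x];
    rewrite /U /dU addrA.
have bq (p : V) : S p -> 0 <= ip (fun x => b x * (f1 p x)) (f1 p) <= B * ip (f1 p) (f1 p).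
  move=> /Ss[sp _]; apply/andP; split.
    apply: ip_ae_ge0 => //; first exact: sq_b.
    by apply: filterS bB => x hx /hx/andP[? _]; rewrite -mulrA mulr_ge0// -expr2 sqr_ge0.
  rewrite -(ipZl mO)//; apply: ip_ae_le => //; [exact: sq_b|exact: sqintZ|].
  by apply: filterS bB => x hx /hx/andP[_ ?]; rewrite -!mulrA ler_wpM2r// -expr2 sqr_ge0.
have PQ (p : V) : S p -> ip (f1 p) (f1 p) <= P * Q p by move=> /(C1c_sob0 oOm bOm)/hP.
(* The last constant comes from Young's inequality: the gradient and the reaction terms of the
   derivative at [h] each use up half of [al * Q]. *)
have [|||||||||us [Sus Qus Lus]] := @minimizing_sequence R V S J L' Q al be
    (al^-1 / 2 * (\sum_i ip (fun x => a x * dh i x) (fun x => a x * dh i x)) +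
     (al / P)^-1 / 2 * ip (reaction h) (reaction h)).
- by split; [exact: continuous_cst|move=> i x; exact: is_derive_cst|
    move=> i; exact: continuous_cst|exists set0; split => //; exact: compact0].
- by move=> t u v; exact: C1c_comb.
- exact: al0.
- move=> t u v Su Sv; have [s1 s2] := Ss _ Sv; rewrite /L' /weak_form E1 E2 mulrDr; congr (_ + _).
    by rewrite -energyZr//; exact: sdU.
  by rewrite -(ipZr mO)//; apply: sq_reaction; exact: sU.
- move=> t v Sv; have [s1 s2] := Ss _ Sv; rewrite /Q E2 mulr_sumr; apply: eq_bigr => i _.
  exact: (ip_sqrZ mO t (s2 i)).
- by move=> v Sv; apply: sumr_ge0 => i _; exact: ip_ge0.
- move=> u v Su Sv; have [s1 s2] := Ss _ Sv; rewrite JD// lerD2l.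
  have := energy_ge s2; have /andP[h2 _] := bq _ Sv; have := cD0 (sU _ Su) s1.
  by rewrite /al -/(Q v); move: (ip (fun x => - c x) _) => t; lra.
- move=> u v Su Sv; have [s1 s2] := Ss _ Sv; rewrite JD// lerD2l.
  have h1 := energy_le s2; have /andP[_ h2] := bq _ Sv; have h3 := cD1 (sU _ Su) s1.
  have h4 : (B / 2 + C * L) * ip (f1 v) (f1 v) <= (B / 2 + C * L) * (P * Q v).
    by rewrite ler_wpM2l ?PQ// addr_ge0 ?divr_ge0// mulr_ge0.
  move: h1 h2 h3 h4; rewrite /be -/(Q v).
  move: (ip (fun x => - c x) _) (ip _ _) (ip (f1 v) (f1 v)) (energy _ _) => t r s e; lra.
- move=> v Sv; have [s1 s2] := Ss _ Sv.
  have U0 : U 0 = h by apply/funext => x; rewrite /U addr0.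
  have dU0 : dU 0 = dh by apply/funext => i; apply/funext => x; rewrite /dU addr0.
  rewrite /L' /weak_form U0 dU0 opprD.
  have h1 : - energy dh (f2 v) <= al / 2 * Q v +
      al^-1 / 2 * (\sum_i ip (fun x => a x * dh i x) (fun x => a x * dh i x)).
    rewrite /energy -sumrN /Q !mulr_sumr -big_split /=; apply: ler_sum => i _.
    have ai0 : 0 < al^-1 by rewrite invr_gt0.
    have := ip_le_young mO ai0 (sq_a (sdh i)) (s2 i); rewrite invrK.
    have := ler_norm (- ip (fun x => a x * dh i x) (f2 v i)); rewrite normrN.
    move: (ip _ _) (ip _ _) (ip _ _) => r s t; lra.
  have h2 : - ip (reaction h) (f1 v) <= al / 2 * Q v + (al / P)^-1 / 2 * ip (reaction h) (reaction h).
    have ai0 : 0 < (al / P)^-1 by rewrite invr_gt0 divr_gt0.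
    have := ip_le_young mO ai0 (sq_reaction sh) s1; rewrite invrK.
    have := ler_norm (- ip (reaction h) (f1 v)); rewrite normrN.
    have : al / P * ip (f1 v) (f1 v) <= al * Q v.
      by rewrite -mulrA ler_pM2l// mulrC ler_pdivrMr// mulrC PQ.
    move: (ip (reaction h) _) (ip (reaction h) _) (al / P * _) => r s t; lra.
  by apply: (le_trans (lerD h1 h2)); rewrite addrACA -mulrDl -splitr.
have su n : sq (f1 (us n)) by have [] := Ss _ (Sus n).
have sdu n i : sq (f2 (us n) i) by have [] := Ss _ (Sus n).
have SB n m : S (us n - us m) by have := C1c_comb (-1) (Sus n) (Sus m); congr C1c;
  [apply/funext => x|apply/funext => i; apply/funext => x]; rewrite /= mulN1r.
have [w sw cw] : exists2 u, sq u & cvgL2 (fun n => f1 (us n)) u.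
  apply: L2_complete => // e e0; have [N hN] := Qus (e / P) (divr_gt0 e0 P0).
  exists N => n m Nn Nm; rewrite /dist2 (le_trans (PQ _ (SB n m)))// mulrC -ler_pdivlMr//.
  exact: hN.
have /choice[dw hdw] : forall i, exists v, sq v /\ cvgL2 (fun n => f2 (us n) i) v.
  move=> i; have [|v sv cv] := L2_complete mO (sdu ^~ i); last by exists v.
  move=> e e0; have [N hN] := Qus e e0; exists N => n m Nn Nm.
  rewrite /dist2 (le_trans _ (hN n m Nn Nm))// /Q (bigD1 i)//= lerDl sumr_ge0// => j _; exact: ip_ge0.
have sdw i : sq (dw i) by have [] := hdw i.
have cdw i : cvgL2 (fun n => f2 (us n) i) (dw i) by have [] := hdw i.
have ch := cvgL2_hd cw cdw.
exists w, dw; split.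
  apply: sob0_approx => // e e0; have /cvgr_le/(_ _ e0)[N _ hN] := ch.
  by exists (f1 (us N)), (f2 (us N)); split; [exact: Sus|apply: hN => /=].
have sW : sq (fun x => h x + w x) by exact: sqintD.
have sdW i : sq (fun x => dh i x + dw i x) by exact: sqintD.
have cW : cvgL2 (fun n => U (us n)) (fun x => h x + w x).
  rewrite /cvgL2; under eq_fun => n.
    by rewrite /dist2 (_ : (fun x => _) = (fun x => f1 (us n) x - w x)); [over|apply/funext => x; rewrite /U; ring].
  exact: cw.
have cdW i : cvgL2 (fun n => dU (us n) i) (fun x => dh i x + dw i x).
  rewrite /cvgL2; under eq_fun => n.
    by rewrite /dist2 (_ : (fun x => _) = (fun x => f2 (us n) i x - dw i x)); [over|apply/funext => x; rewrite /dU; ring].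
  exact: cdw.
(* The sequence gives the equation against C^1 functions; density then extends it to [H^1_0]. *)
have W0 f df : C1c Om f df -> weak_form (fun i x => dh i x + dw i x) (reaction (fun x => h x + w x)) f df = 0.
  move=> fC; have [sf sdf] := sqint_C1c oOm bOm fC.
  pose fdf : V := fun o => if o is Some i then df i else f; have h2 := Lus fdf fC; apply: (cvg_unique _ _ h2) => //.
  apply: cvgD; first by apply: cvg_energy => // n; exact: sdU.
  by apply: cvgL2_reaction => // n; exact: sU.
move=> f df /[dup] [[fs _]] /sob0_ip_limit[phis [tp cp cdp]].
have sf := sob_sq fs; have sdf i := sob_sqd i fs.
have sp n : sq (phis n) by have [] := test_sq oOm bOm (tp n).
have sdp n i : sq (partial i (phis n)) by have [] := test_sq oOm bOm (tp n).
have h0 : weak_form (fun i x => dh i x + dw i x) (reaction (fun x => h x + w x)) (phis n)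
    (fun i => partial i (phis n)) @[n --> \oo] --> (0 : R).
  have W1 n := W0 _ _ (test_function_C1c (tp n)).
  by under eq_fun do rewrite W1; exact: cvg_cst.
apply: (cvg_unique _ _ h0) => //.
  apply: cvgD; first by under eq_fun do rewrite energyC; rewrite energyC; exact: cvg_energy.
  by under eq_fun do rewrite ipC; rewrite ipC; apply: cvgL2_ip => //; exact: sq_reaction.
Qed.

End existence.

End weak_form.

(** * Comparison with an exponential subsolution *)

Section truncation.
Context {R : realType}.
Implicit Types (s t : R).

Lemma lipschitz_derive (p dp : R -> R) (L : R) : (forall x, is_derive x (1 : R) p (dp x)) ->
  (forall x, `|dp x| <= L) -> forall s t, `|p t - p s| <= L * `|t - s|.
Proof.
move=> pdp dpL.
have H s t : s <= t -> `|p t - p s| <= L * `|t - s|.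
  move=> st; have [|c _ ->] := MVT_segment st (fun x _ => pdp x).
    apply: continuous_subspaceT => x; apply: differentiable_continuous.
    by apply/derivable1_diffP; have [] := pdp x.
  by rewrite normrM ler_wpM2r.
move=> s t; have [st|/ltW ts] := leP s t; first exact: H.
by rewrite distrC (distrC t); exact: H.
Qed.

Lemma is_derive_inv_expR0 t : is_derive t (1 : R) (inv_expR 0) (inv_expR 2 t).
Proof. by have := is_derive_inv_expR 0 t; rewrite mul0r subr0. Qed.

(** For [t <= 1] this is [inv_expR_bound] with [3! = 6]; beyond [1] both factors are at most [1]. *)
Lemma inv_expR2_le t : inv_expR 2 t <= 6.
Proof.
have [t0|t0] := leP t 0; first by rewrite inv_expR_le0.
have [t1|t1] := leP t 1.
  by rewrite (le_trans (inv_expR_bound 2 t0))// ger_pMr.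
rewrite /inv_expR t0 (@le_trans _ _ 1)// ?ler1n// mulr_ile1 ?expR_ge0 ?invr_ge0 ?exprn_ge0 ?ltW//.
  by rewrite invf_lt1 ?exprn_gt0// exprn_egt1.
by rewrite -expR0 ltr_expR oppr_lt0 invr_gt0.
Qed.

Lemma inv_expR_lip s t : `|inv_expR 0 t - inv_expR 0 s| <= 6 * `|t - s|.
Proof.
apply: (lipschitz_derive is_derive_inv_expR0) => x.
by rewrite ger0_norm ?inv_expR_ge0// inv_expR2_le.
Qed.

End truncation.

(** * Lipschitz fluxes, the exponential subsolution and comparison *)

Section subsolution.
Context {R : realType} {d : nat}.
Variables (Om : set 'rV[R]_d).
Hypotheses (oOm : open Om) (bOm : bounded_set Om).
Implicit Types (f g u v w : 'rV[R]_d -> R) (df du dv dw : 'I_d -> 'rV[R]_d -> R) (x : 'rV[R]_d).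

Local Notation mu := (leb d).
Local Notation sq := (sqint mu Om).
Local Notation ip := (L2_ip mu Om).
Let mO : measurable Om := measurable_Om oOm.

Lemma measurable_ext0 g : measurable_fun Om (g : 'rV[R]_d -> measurableTypeR R) ->
  measurable_fun setT (ext0 Om g : 'rV[R]_d -> measurableTypeR R).
Proof.
move=> /(measurable_restrictT _ mO); congr (measurable_fun _ _).
apply/funext => x; rewrite patchE /ext0; case: pselect => Ox; first by rewrite mem_set.
by rewrite memNset.
Qed.

(** Invariance of the measure moves the translation from [f] to the zero extension of [g]; since [f]
    vanishes outside [Om], the integral is again over [Om]. *)
Lemma ip_shift g f df (v : 'rV[R]_d) (M : R) : measurable_fun Om (g : 'rV[R]_d -> measurableTypeR R) ->
  (forall x, Om x -> `|g x| <= M) -> C1c Om f df ->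
  ip g (fun x => f (v + x)) = ip (fun x => ext0 Om g (- v + x)) f.
Proof.
move=> mg gM fC; have mG := measurable_ext0 mg.
have cf : continuous f by case: fC.
have mf : measurable_fun setT (f : 'rV[R]_d -> measurableTypeR R).
  by apply: continuous_measurable_rV; [exact: openT|move=> x _; exact: cf].
have mfv : measurable_fun setT (fun x => f (v + x) : measurableTypeR R).
  by under eq_fun do rewrite addrC; apply: (measurableT_comp mf); exact: measurable_shift.
rewrite /ip /Rintegral; congr fine.
rewrite integral_mkcond [RHS]integral_mkcond.
rewrite -(@integral_shift R d (- v)); last first.
  rewrite -(measurable_restrictT _ mO); apply/measurable_EFinP/measurable_funM => //.
  exact: measurable_funS mfv.
apply: eq_integral => x _; rewrite !patchE.
have -> : (if x - v \in Om then (g (x - v) * f (v + (x - v)))%:E else 0%E) =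
    (ext0 Om g (- v + x) * f x)%:E.
  rewrite [- v + x]addrC subrKC /ext0; case: pselect => Oy; first by rewrite mem_set.
  by rewrite memNset// mul0r.
case: ifPn => //; rewrite notin_setE => nx.
by rewrite (C1c_out fC nx) mulr0.
Qed.

(* An integration by parts for a [g] that is only Lipschitz: bound the difference
   quotients of [g], shift them to [f] and pass to the limit. *)
Lemma ip_derive_le g f df w i (M : R) (s : R^nat) (l : R) :
  measurable_fun Om (g : 'rV[R]_d -> measurableTypeR R) ->
  (forall x, Om x -> `|g x| <= M) -> C1c Om f df -> (forall x, 0 <= f x) -> sq w ->
  (\forall n \near \oo, forall x, f x != 0 ->
     n.+1%:R * (ext0 Om g (- (n.+1%:R^-1 *: e_ i) + x) - ext0 Om g x) <= s n * w x) ->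
  s n @[n --> \oo] --> l -> ip g (df i) <= l * ip w f.
Proof.
move=> mg gM fC f0 sw gw sl.
have [cf dff cdf _] := fC; have [sf sdf] := sqint_C1c oOm bOm fC.
have sg : sq g by apply: (@sqint_bounded _ _ _ _ _ mO M) => //; [exact: leb_Om_lty|exact: aeW].
have [F F0 dF] := C1c_derivative_bound bOm fC.
pose q n x := n.+1%:R * (f (n.+1%:R^-1 *: e_ i + x) - f x).
have csh n : continuous (fun x => f (n.+1%:R^-1 *: e_ i + x)).
  move=> x; apply: (@continuous_comp _ _ _ (fun x => n.+1%:R^-1 *: e_ i + x) f); last exact: cf.
  exact: continuous_addl.
have cq n : continuous (q n).
  apply: continuous_mul; first exact: continuous_cst.
  by apply: continuous_add => // x; exact: (continuousN (cf x)).
have qF n x : `|q n x| <= F.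
  rewrite /q normrM ger0_norm// -ler_pdivlMl// (le_trans (C1c_lipschitz _ _ _ fC dF))//.
  by rewrite ger0_norm// mulrC.
have sqq n : sq (q n) by apply: (sqint_continuous_bounded oOm bOm) => // x _; exact: cq.
have M0 x : `|ext0 Om g x| <= `|M|.
  rewrite /ext0; case: pselect => Ox; last by rewrite normr0.
  by rewrite (le_trans (gM x Ox)) ?ler_norm.
have sfs n : sq (fun x => f (n.+1%:R^-1 *: e_ i + x)).
  have := sqintD mO (sqintZ mO n.+1%:R^-1 (sqq n)) sf; congr sqint; apply/funext => x.
  by rewrite /q mulKf ?subrK// pnatr_eq0.
have sG : sq (ext0 Om g).
  apply: (@sqint_bounded _ _ _ _ _ mO `|M|) => //; [exact: leb_Om_lty| |exact: aeW].
  exact: measurable_funS (measurable_ext0 mg).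
have sGs n : sq (fun x => ext0 Om g (- (n.+1%:R^-1 *: e_ i) + x)).
  apply: (@sqint_bounded _ _ _ _ _ mO `|M|) => //; [exact: leb_Om_lty| |exact: aeW].
  apply: (@measurable_funS _ _ _ _ setT) => //; under eq_fun do rewrite addrC.
  by apply: (measurableT_comp (measurable_ext0 mg)); exact: measurable_shift.
have qE n : ip g (q n) = ip (fun x => n.+1%:R * (ext0 Om g (- (n.+1%:R^-1 *: e_ i) + x) - ext0 Om g x)) f.
  rewrite (ipZr mO)//; last exact: sqintB.
  rewrite (ipZl mO)//; last exact: sqintB.
  rewrite (ipBr mO)// (ipBl mO)// (ip_shift _ mg gM fC); congr (_ * (_ - _)).
  by apply: eq_Rintegral => x /[!inE] Ox; rewrite ext0E.
have cv : ip g (q n) @[n --> \oo] --> ip g (df i).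
  have [|||||_ _ H] := @dominated_convergence _ _ _ mu Om mO
    (fun n x => (g x * q n x)%:E) (fun x => (g x * df i x)%:E) (fun x => (M * F)%:E).
  - by move=> n; apply/measurable_EFinP; exact: (sqintM_measurable sg (sqq n)).
  - by apply/measurable_EFinP; exact: (sqintM_measurable sg (sdf i)).
  - apply: aeW => x Ox; apply: cvg_EFin; first exact: nearW.
    by apply: cvgMr; exact: cvg_difference_quotient.
  - exact: (sqint_Rintegrable oOm bOm (sqint_cst oOm bOm (M * F))).
  - by apply: aeW => x n Ox; rewrite lee_fin normrM ler_pM ?gM.
  by apply: fine_cvg; rewrite fineK//; apply: integrable_fin_num => //; exact: sqintM_integrable.
have cl : s n * ip w f @[n --> \oo] --> l * ip w f by apply: cvgMl.
apply: (ler_cvg_to cv cl); apply: filterS gw => n hn.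
rewrite qE -(ipZl mO)//.
apply: ip_ae_le => //; [by apply: sqintZ => //; exact: sqintB|exact: sqintZ|].
apply: aeW => x _; have [->|fx] := eqVneq (f x) 0; first by rewrite !mulr0.
by rewrite ler_wpM2r// hn.
Qed.

Variables (a : 'rV[R]_d -> R) (K0 K1 La : R).
Hypotheses (K00 : 0 < K0) (ma : measurable_fun Om (a : 'rV[R]_d -> measurableTypeR R)).
Hypothesis aK : forall x, Om x -> K0 <= a x <= K1.
Hypothesis aL : forall x y, Om x -> Om y -> `|a x - a y| <= La * `|x - y|.

(** In direction [i] the flux [a * lam * v] increases at a rate of order [lam ^+ 2 * v], which for
    large [lam] beats both the variation of [a], of order [lam * La * v], and the term [B * v]. A
    surplus [v >= m0] remains. *)
Lemma subsolution (i : 'I_d) (B m1 : R) : 0 <= La -> 0 <= B -> 0 < m1 ->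
  exists v dv (m0 : R), [/\ 0 < m0, C1_on Om v dv, forall x, Om x -> m0 <= v x <= m1,
    exists M, forall j x, Om x -> `|dv j x| <= M &
    forall f df, C1c Om f df -> (forall x, 0 <= f x) ->
      energy Om a dv df + B * ip v f + m0 * ip (fun=> 1) f <= 0].
Proof.
move=> La0 B0 m10; have [D D0 OD] := bounded_rVP bOm.
pose E := `|(e_ i : 'rV[R]_d)|.
have E0 : 0 <= E by exact: normr_ge0.
(* Dictated by the final estimate: [K0 * lam / 2] must cover [La * E], [B] and one unit for the
   surplus. The [+ 1] in the witness ensures [lam >= 1] and accounts for [K0 / 2]. *)
have [lam lam1 Klam] : exists2 lam, 1 <= lam & K0 * (lam / 2) = La * E + B + 1 + K0 / 2.
  exists (2 * (La * E + B + 1) / K0 + 1); last by field; rewrite gt_eqF.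
  by rewrite lerDr divr_ge0 ?(ltW K00)// mulr_ge0// !addr_ge0// mulr_ge0.
have lam0 : 0 < lam by exact: lt_le_trans lam1.
(* Since [|x_i| <= D] on [Om], this normalisation gives [v <= m1]; the same bound makes [m0] below a
   lower bound. *)
pose kap := m1 * expR (- (lam * D)); have kap0 : 0 < kap by rewrite mulr_gt0// expR_gt0.
pose v x := kap * expR (lam * x 0 i); pose dv (j : 'I_d) x := lam * v x * (j == i)%:R.
have v0 x : 0 < v x by rewrite mulr_gt0// expR_gt0.
pose m0 := kap * expR (- (lam * D)).
have m00 : 0 < m0 by rewrite mulr_gt0// expR_gt0.
have vm x : Om x -> m0 <= v x <= m1.
  move=> Ox; have := OD x i Ox; rewrite ler_norml => /andP[h1 h2]; apply/andP; split.
    by rewrite /m0 ler_pM2l// ler_expR -mulrN ler_pM2l.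
  by rewrite /v /kap -mulrA -expRD ger_pMr// -expR0 ler_expR addrC subr_le0 ler_pM2l.
have cv : continuous v.
  apply: continuous_mul; first exact: continuous_cst.
  move=> x; apply: (@continuous_comp _ _ _ (fun x : 'rV[R]_d => lam * x 0 i) expR); last exact: continuous_expR.
  by apply: continuous_mul; [exact: continuous_cst|exact: coord_continuous].
exists v, dv, m0; split => //.
- move=> x Ox; split => [|j]; first exact: cv.
  split; last by apply: continuous_mul; [apply: continuous_mul => //; exact: continuous_cst|exact: continuous_cst].
  have h := is_derive_comp_rV (is_derive_expR _) (is_deriveZ lam (is_derive_coord x j i)).
  have hz : is_derive x (e_ j) v _ := is_deriveZ kap h.
  by apply: (is_derive_eq hz); rewrite /dv /v /GRing.scale/=; ring.
- exists (lam * m1) => j x Ox; have /andP[h1 h2] := vm x Ox.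
  rewrite ger0_norm; last by rewrite mulr_ge0// mulr_ge0// ltW.
  rewrite /dv -mulrA ler_pM2l// (le_trans _ h2)//.
  by case: (_ == _); rewrite ?mulr1 ?mulr0// ltW.
move=> f df fC f0; have [sf sdf] := sqint_C1c oOm bOm fC.
have sv : sq v.
  apply: (@sqint_continuous_bounded _ _ _ oOm bOm m1) => [x _|x Ox]; first exact: cv.
  by rewrite ger0_norm ?(ltW (v0 x))//; have /andP[] := vm x Ox.
have ag x : Om x -> `|a x * (lam * v x)| <= K1 * (lam * m1).
  move=> Ox; have /andP[a1 a2] := aK Ox; have /andP[h1 h2] := vm x Ox.
  have ax0 : 0 <= a x := le_trans (ltW K00) a1.
  rewrite ger0_norm; last by rewrite mulr_ge0// mulr_ge0// ltW.
  by rewrite ler_pM// ?ler_pM2l// mulr_ge0// ltW.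
have mv : measurable_fun Om (v : 'rV[R]_d -> measurableTypeR R) by have [] := sv.
have mg : measurable_fun Om (fun x => a x * (lam * v x) : measurableTypeR R).
  by apply: measurable_funM => //; apply: measurable_funM.
have key : ip (fun x => a x * (lam * v x)) (df i) <= (lam * (- (K0 * (lam / 2)) + La * E)) * ip v f.
  apply: (ip_derive_le (s := fun=> lam * (- (K0 * (lam / 2)) + La * E)) mg ag fC f0 sv); last exact: cvg_cst.
  have [_ _ _ [K [cK KO Kf]]] := fC.
  have [r r0 Kr] := open_compact_radius cK oOm KO.
  near=> n => x fx; have Kx : K x by apply: contrapT => /Kf; apply/eqP.
  have Ox := KO x Kx; set y := - _ + x.
  have n0 : (0 : R) < n.+1%:R by [].
  have Oy : Om y.
    apply: (Kr x Kx); apply: ball_rV_sub => // j; rewrite !mxE opprD opprK addrCA subrr addr0 eqxx/=.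
    rewrite normrM ger0_norm// (@le_lt_trans _ _ n.+1%:R^-1)//.
      by rewrite ger_pMr ?invr_gt0//; case: (_ == _); rewrite ?normr1 ?normr0.
    by near: n; exact: near_infty_natSinv_lt (PosNum r0).
  rewrite !ext0E//.
  have vy : v y = v x * expR (- (lam / n.+1%:R)).
    by rewrite /v -mulrA -expRD /y !mxE !eqxx/=; congr (_ * expR _); ring.
  pose p := n.+1%:R * (1 - expR (- (lam / n.+1%:R))).
  (* The discrete logarithmic derivative [p] approximates [lam]. Half of it suffices and follows
     from [e^(- s) <= (1 + s)^-1] once [lam <= n.+1]. *)
  have hp : lam / 2 <= p.
    have ln : lam <= n.+1%:R.
      by rewrite (le_trans _ (_ : n%:R <= _))// ?ler_nat//; near: n; exact: nbhs_infty_ger.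
    have y1 : 0 < 1 + lam / n.+1%:R by rewrite addr_gt0// divr_gt0.
    have h1 : expR (- (lam / n.+1%:R)) <= (1 + lam / n.+1%:R)^-1.
      by rewrite expRN lef_pV2 ?posrE ?expR_gt0// expR_ge1Dx.
    apply: (@le_trans _ _ (n.+1%:R * (1 - (1 + lam / n.+1%:R)^-1))); last by rewrite /p ler_pM2l// lerD2l lerN2.
    have -> : n.+1%:R * (1 - (1 + lam / n.+1%:R)^-1) = lam * (n.+1%:R / (n.+1%:R + lam)).
      move: (n.+1%:R : R) n0 => N N0; field; by rewrite !gt_eqF ?addr_gt0.
    by rewrite ler_pM2l// ler_pdivlMr ?addr_gt0//; lra.
  have al : n.+1%:R * (a y - a x) <= La * E.
    have := aL Oy Ox; rewrite /y addrK normrN normrZ ger0_norm// => h.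
    rewrite -ler_pdivlMl// (le_trans (ler_norm _))// (le_trans h)//.
    by rewrite mulrCA.
  have -> : n.+1%:R * (a y * (lam * v y) - a x * (lam * v x)) =
     lam * (- (a y * p) + n.+1%:R * (a y - a x)) * v x by rewrite vy /p; ring.
  rewrite ler_pM2r// ler_pM2l// lerD// lerN2.
  have /andP[ay _] := aK Oy.
  by rewrite ler_pM// ?ltW// divr_gt0.
have -> : energy Om a dv df = ip (fun x => a x * (lam * v x)) (df i).
  rewrite /energy (bigD1 i)//= big1 ?addr0.
    by apply: eq_Rintegral => x _; rewrite /dv eqxx mulr1.
  move=> j /negbTE ji; rewrite -(ip0l mu Om (df j)); apply: eq_Rintegral => x _.
  by rewrite /dv ji mulr0 mulr0.
have vf0 : 0 <= ip v f by apply: ip_ae_ge0 => //; apply: aeW => x Ox; rewrite mulr_ge0 ?f0// ltW.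
have m0v : m0 * ip (fun=> 1) f <= ip v f.
  rewrite -(ipZl mO)//; last exact: sqint_cst.
  apply: ip_ae_le => //; first by apply: sqintZ => //; exact: sqint_cst.
  by apply: aeW => x Ox; rewrite mulr1 ler_wpM2r//; have /andP[] := vm x Ox.
have h : lam * (- (K0 * (lam / 2)) + La * E) <= - (B + 1).
  rewrite Klam.
  have -> : lam * (- (La * E + B + 1 + K0 / 2) + La * E) = - (lam * (B + 1 + K0 / 2)) by ring.
  have B1 : 0 <= B + 1 + K0 / 2 by rewrite !addr_ge0// ltW// divr_gt0.
  by rewrite lerN2 (le_trans _ (ler_peMl B1 lam1))// lerDl ltW// divr_gt0.
have := ler_wpM2r vf0 h; rewrite mulNr mulrDl mul1r.
by move: (lam * _ * _) (B * _) key m0v => p q; lra.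
Unshelve. all: by end_near. Qed.

Local Notation cvgL2 := (cvgL2 mu Om).
Local Notation dist2 := (dist2 mu Om).

Variables (b c : 'rV[R]_d -> R) (B C : R).
Hypotheses (mb : measurable_fun Om (b : 'rV[R]_d -> measurableTypeR R))
  (mc : measurable_fun Om (c : 'rV[R]_d -> measurableTypeR R)).
Hypothesis bB : \forall x \ae mu, Om x -> 0 <= b x <= B.
Hypothesis cC : \forall x \ae mu, Om x -> - C <= c x <= 0.
Variables (k : R -> R) (M L : R).
Hypotheses (kM : forall t, 0 <= k t <= M) (kL : forall s t, `|k t - k s| <= L * `|t - s|).

Let kM' t : `|k t| <= M.
Proof. by have /andP[h1 h2] := kM t; rewrite ger0_norm. Qed.

Lemma cvgL2_lipschitz (p : R -> R) (P : R) us u : (forall n, sq (us n)) -> sq u ->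
  (forall n, sq (fun x => p (us n x))) -> sq (fun x => p (u x)) ->
  (forall s t, `|p t - p s| <= P * `|t - s|) ->
  cvgL2 us u -> cvgL2 (fun n x => p (us n x)) (fun x => p (u x)).
Proof.
move=> sus su spus spu pP cu; apply: (@cvg0_le _ _ _ (P ^+ 2)) cu => n; first exact: dist2_ge0.
rewrite /dist2 -(ip_sqrZ mO); last exact: sqintB.
apply: ip_ae_le => //; try exact: sqintB; try (by apply: sqintZ => //; exact: sqintB).
apply: aeW => x _; rewrite -!expr2 -[leLHS]real_normK ?num_real// -[leRHS]real_normK ?num_real//.
rewrite ler_sqr ?nnegrE// normrM (le_trans (pP _ _))//.
by rewrite ler_wpM2r// ler_norm.
Qed.

Lemma sq_inv_expR u : sq u -> sq (fun x => inv_expR 0 (u x)).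
Proof.
move=> su; apply: (@sqint_bounded _ _ _ _ _ mO 1); first exact: leb_Om_lty.
  by apply: measurableT_comp; [exact: (lipschitz_measurable inv_expR_lip)|have [] := su].
by apply: aeW => x _; have /andP[h1 h2] := inv_expR_le1 (u x); rewrite ger0_norm.
Qed.

(* The test function approximates [inv_expR 0 (v - h - w)]: smooth and nondecreasing
   in [v - h - w], and zero where [v <= h + w]. *)
Lemma subsolution_le h dh w dw v dv m0 : sob Om h dh -> C1_on Om h dh -> sob0 Om w dw ->
  (forall f df, C1c Om f df -> weak_form Om a (fun i x => dh i x + dw i x)
     (reaction b c k (fun x => h x + w x)) f df = 0) ->
  C1_on Om v dv -> sq v -> (forall i, sq (dv i)) ->
  (forall x, Om x -> 0 <= v x <= h x) -> 0 < m0 ->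
  (forall f df, C1c Om f df -> (forall x, 0 <= f x) ->
     energy Om a dv df + B * ip v f + m0 * ip (fun=> 1) f <= 0) ->
  \forall x \ae mu, Om x -> v x <= h x + w x.
Proof.
move=> hs hC w0 weq vC sv sdv vh m00 vsub.
have sh := sob_sq hs; have sdh i := sob_sqd i hs.
have [ws _] := w0; have sw := sob_sq ws; have sdw i := sob_sqd i ws.
have [phis [tp cp cdp]] := sob0_ip_limit w0.
have sp n : sq (phis n) by have [] := test_sq oOm bOm (tp n).
have sdp n i : sq (partial i (phis n)) by have [] := test_sq oOm bOm (tp n).
pose S x := v x - (h x + w x); pose dS i x := dv i x - (dh i x + dw i x).
(* [w] is replaced by test functions: off a compact set [s n] equals [v - h <= 0], so that
   [inv_expR 0 (s n)] is an admissible test function. *)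
pose s n x := v x + - (h x + phis n x); pose ds n i x := dv i x + - (dh i x + partial i (phis n) x).
have sS : sq S by apply: sqintB => //; exact: sqintD.
have sdS i : sq (dS i) by apply: sqintB => //; exact: sqintD.
have ss n : sq (s n) by apply: sqintB => //; exact: sqintD.
have sds n i : sq (ds n i) by apply: sqintB => //; exact: sqintD.
have cs : cvgL2 s S.
  have E n : dist2 (s n) S = dist2 (phis n) w.
    by apply: eq_ip => x _; rewrite /s /S; ring.
  by rewrite /cvgL2; under eq_fun do rewrite E; exact: cp.
have cds i : cvgL2 (fun n => ds n i) (dS i).
  have E n : dist2 (ds n i) (dS i) = dist2 (partial i (phis n)) (dw i).
    by apply: eq_ip => x _; rewrite /ds /dS; ring.
  by rewrite /cvgL2; under eq_fun do rewrite E; exact: cdp.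
pose f n x := inv_expR 0 (s n x); pose df n i x := inv_expR 2 (s n x) * ds n i x.
have fC n : C1c Om (ext0 Om (f n)) (fun i => ext0 Om (df n i)).
  have pC := test_function_C1c (tp n); have [_ _ _ [K [cK KO K0']]] := pC.
  have sC : C1_on Om (s n) (ds n) by apply: C1_onD => //; apply: C1_onN; apply: C1_onD => //; exact: C1c_C1_on.
  apply: (C1c_ext0 oOm cK KO).
    apply: (C1_on_comp (p := inv_expR 0) (dp := inv_expR 2)) => // x Ox; split.
      exact: is_derive_inv_expR0.
    by apply: nderivable_continuous; exact: nderivable_inv_expR.
  move=> x Ox nK; have s0 : s n x <= 0.
    by rewrite /s (K0' _ nK) addr0 subr_le0; have /andP[] := vh x Ox.
  by split => [|i]; rewrite /f /df inv_expR_le0// mul0r.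
have f0 n x : 0 <= ext0 Om (f n) x.
  by rewrite /ext0; case: pselect => [?|?] //; exact: inv_expR_ge0.
have sf n : sq (f n) by exact: sq_inv_expR.
have sF : sq (fun x => inv_expR 0 (S x)) by exact: sq_inv_expR.
(* Nonnegative where [S > 0]: there [h + w < v] bounds [b * (h + w)] by [B * v], and
   [c * k <= 0]. *)
pose T x := B * v x - reaction b c k (fun x => h x + w x) x.
have sreac : sq (reaction b c k (fun x => h x + w x)).
  by apply: (sq_reaction oOm bOm mb mc bB cC kM' kL); exact: sqintD.
have sT : sq T by apply: sqintB => //; exact: sqintZ.
pose r n := \sum_i ip (fun x => a x * (inv_expR 2 (s n x) * (ds n i x - dS i x))) (dS i).
have s6 u (w' : 'rV[R]_d -> R) : sq u -> sq w' -> sq (fun x => inv_expR 2 (u x) * w' x).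
  move=> su; apply: (@sqint_mul_bounded _ _ _ _ _ mO 6).
    apply: measurableT_comp; last by have [] := su.
    by apply: continuous_measurable_fun; apply: nderivable_continuous; exact: nderivable_inv_expR.
  by apply: aeW => x _; rewrite ger0_norm ?inv_expR_ge0// inv_expR2_le.
have sdf n i : sq (df n i) by exact: s6.
have r0 : r n @[n --> \oo] --> (0 : R).
  apply: cvg_sum0 => i.
  rewrite -(ip0l mu Om (dS i)); apply: cvgL2_ip => //.
  - by move=> n; apply: (sq_a oOm K00 ma aK); apply: s6 => //; exact: sqintB.
  - exact: sqint0.
  apply: (@cvg0_le _ _ _ ((K1 * 6) ^+ 2)) (cds i) => n; first exact: dist2_ge0.
  rewrite /dist2 -(ip_sqrZ mO); last exact: sqintB.
  have sz : sq (fun x => a x * (inv_expR 2 (s n x) * (ds n i x - dS i x)) - 0).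
    by apply: sqintB => //; [apply: (sq_a oOm K00 ma aK); apply: s6 => //; exact: sqintB|exact: sqint0].
  apply: ip_ae_le => //; try (by apply: sqintZ => //; exact: sqintB).
  apply: aeW => x Ox; rewrite -!expr2 subr0 mulrA !exprMn ler_wpM2r ?sqr_ge0// -!exprMn.
  have /andP[a1 a2] := aK Ox; have a0 := le_trans (ltW K00) a1.
  have i0 : 0 <= inv_expR 2 (s n x) :> R by exact: inv_expR_ge0.
  have i6 := inv_expR2_le (s n x).
  rewrite ler_sqr ?nnegrE; [by rewrite ler_pM|by rewrite mulr_ge0|].
  by rewrite mulr_ge0// (le_trans a0).
have key n : r n + ip T (f n) + m0 * ip (fun=> 1) (f n) <= 0.
  have h1 := weq _ _ (fC n); have h2 := vsub _ _ (fC n) (f0 n).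
  have ipE u : ip u (ext0 Om (f n)) = ip u (f n).
    by apply: eq_Rintegral => x /[!inE] Ox; rewrite ext0E.
  have eE du : energy Om a du (fun i => ext0 Om (df n i)) = energy Om a du (df n).
    by apply: eq_bigr => i _; apply: eq_Rintegral => x /[!inE] Ox; rewrite ext0E.
  rewrite /weak_form !ipE eE in h1; rewrite !ipE eE in h2.
  have eS : energy Om a dS (df n) = energy Om a dv (df n) - energy Om a (fun i x => dh i x + dw i x) (df n).
    rewrite -mulN1r -(energyZl oOm K00 ma aK)//; last by move=> i; exact: sqintD.
    rewrite -(energyDl oOm K00 ma aK)//; last by move=> i; apply: sqintZ => //; exact: sqintD.
    by congr energy; apply/funext => i; apply/funext => x; rewrite /dS mulN1r.
  have rS : r n <= energy Om a dS (df n).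
    rewrite /r /energy; apply: ler_sum => i _; apply: ip_ae_le => //.
    - by apply: (sq_a oOm K00 ma aK); apply: s6 => //; exact: sqintB.
    - exact: (sq_a oOm K00 ma aK).
    apply: aeW => x Ox; rewrite -subr_ge0 /df.
    have -> : a x * dS i x * (inv_expR 2 (s n x) * ds n i x) -
      a x * (inv_expR 2 (s n x) * (ds n i x - dS i x)) * dS i x = a x * inv_expR 2 (s n x) * (dS i x) ^+ 2 by ring.
    have /andP[a1 _] := aK Ox.
    by rewrite mulr_ge0 ?sqr_ge0// mulr_ge0 ?inv_expR_ge0// (le_trans (ltW K00)).
  have TE : ip T (f n) = B * ip v (f n) - ip (reaction b c k (fun x => h x + w x)) (f n).
    by have := ipBl mO (sqintZ mO B sv) sreac (sf n); rewrite (ipZl mO B sv (sf n)).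
  rewrite TE; lra.
have lim : 0 + ip T (fun x => inv_expR 0 (S x)) + m0 * ip (fun=> 1) (fun x => inv_expR 0 (S x)) <= 0.
  have cf : cvgL2 f (fun x => inv_expR 0 (S x)).
    exact: (cvgL2_lipschitz (p := inv_expR 0) ss sS sf sF inv_expR_lip cs).
  have cip u : sq u -> ip u (f n) @[n --> \oo] --> ip u (fun x => inv_expR 0 (S x)).
    by move=> su; under eq_fun do rewrite ipC; rewrite ipC; exact: cvgL2_ip.
  have c1 := cip _ (sqint_cst oOm bOm 1); have cT := cip _ sT.
  have cc : r n + ip T (f n) + m0 * ip (fun=> 1) (f n) @[n --> \oo] -->
     0 + ip T (fun x => inv_expR 0 (S x)) + m0 * ip (fun=> 1) (fun x => inv_expR 0 (S x)).
    by apply: cvgD; [exact: cvgD|apply: cvgMr].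
  by apply: (ler_cvg_to cc (cvg_cst 0)); exact: nearW.
have T0 : 0 <= ip T (fun x => inv_expR 0 (S x)).
  apply: ip_ae_ge0 => //; apply: filterS2 bB cC => x hb hc Ox.
  have /andP[b0 bb] := hb Ox; have /andP[_ c0] := hc Ox; have /andP[v0 _] := vh x Ox.
  have [S0|S0] := leP (S x) 0; first by rewrite inv_expR_le0// mulr0.
  rewrite mulr_ge0 ?inv_expR_ge0// /T /reaction.
  have h1 : b x * (h x + w x) <= b x * v x by rewrite ler_wpM2l// -subr_ge0 ltW.
  have h2 : b x * v x <= B * v x by rewrite ler_wpM2r.
  have h3 : c x * k (h x + w x) <= 0.
    by rewrite mulr_le0_ge0//; have /andP[] := kM (h x + w x).
  lra.
have F0 : ip (fun=> 1) (fun x => inv_expR 0 (S x)) <= 0 by rewrite -(pmulr_rle0 _ m00); lra.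
have sr : sq (fun x => inv_expR 0 (S x) * inv_expR 0 (S x)).
  apply: (@sqint_mul_bounded _ _ _ _ _ mO 1) => //; first by have [] := sF.
  by apply: aeW => x _; have /andP[g1 g2] := inv_expR_le1 (S x); rewrite ger0_norm.
(* As [inv_expR 0] takes values in [[0, 1]], its square integrates to at most its integral,
   nonpositive by [F0]. *)
have : ip (fun x => inv_expR 0 (S x)) (fun x => inv_expR 0 (S x)) = 0.
  apply/eqP; rewrite eq_le ip_ge0 andbT (le_trans _ F0)//.
  apply: ip_ae_le => //; first exact: sqint_cst.
  apply: aeW => x _; have /andP[g1 g2] := inv_expR_le1 (S x).
  by rewrite ler_wpM2r.
move=> /(ip_eq0 mO sF); apply: filterS => x hx Ox; rewrite -subr_le0 leNgt; apply/negP => S0.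
by have := inv_expR_gt0 0 S0; rewrite hx// ltxx.
Qed.

End subsolution.

(** * Functions with zero trace *)

Section trace_interval.
Context {R : realType}.

Local Notation mu := (@lebesgue_measure R).

(* Integrate the derivative of [(t - o) * p t ^+ 2], which vanishes at [o]. *)
Lemma integral_sqr_le_endpoint (p dp : R -> R) (al be o e : R) : al < be ->
  {within `[al, be], continuous p} -> {within `[al, be], continuous dp} ->
  (forall t, t \in `]al, be[ -> is_derive t (1 : R) p (dp t)) ->
  (o = be /\ e = al) \/ (o = al /\ e = be) ->
  (\int[mu]_(t in `[al, be]) ((p t) ^+ 2)%:E <=
   (2 * (be - al) * (p e) ^+ 2)%:E +
   (4 * (be - al) ^+ 2)%:E * \int[mu]_(t in `[al, be]) ((dp t) ^+ 2)%:E)%E.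
Proof.
move=> ab cp cdp pdp oe.
pose g t := 2 * (p t * p t + (t - o) * (2 * (p t * dp t))).
pose G t := 2 * ((t - o) * (p t * p t)).
have co : {within `[al, be], continuous (fun t : R => t - o)}.
  by apply: continuous_subspaceT => t; apply: continuousB; [exact: cvg_id|exact: cvg_cst].
have c2 : {within `[al, be], continuous (fun _ : R => 2 : R)} by exact: continuous_cst.
have cpp := continuous_mul cp cp.
have cg : {within `[al, be], continuous g}.
  apply: (continuous_mul c2); apply: continuous_add => //.
  by apply: (continuous_mul co); apply: (continuous_mul c2); exact: continuous_mul.
have cG : {within `[al, be], continuous G} by apply: (continuous_mul c2); exact: continuous_mul.
have Gg t : t \in `]al, be[ -> is_derive t (1 : R) G (g t).
  move=> tab; have pt := pdp t tab.
  have h : is_derive t (1 : R) (fun y : R => y - o) 1.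
    have := is_deriveB (is_derive_id t (1 : R)) (is_derive_cst o t (1 : R)).
    by rewrite subr0.
  have hz : is_derive t (1 : R) G _ := is_deriveZ (2 : R) (is_deriveM h (is_deriveM pt pt)).
  by apply: (is_derive_eq hz); rewrite -[(p * p) t]/(p t * p t) /g /GRing.scale/=; ring.
have FTC : (\int[mu]_(t in `[al, be]) (g t)%:E = (G be)%:E - (G al)%:E)%E.
  apply: continuous_FTC2 => //.
    have [cG1 cG2 cG3] := proj1 (continuous_within_itvP G ab) cG.
    by split; [move=> t tab; have [] := Gg t tab|exact: cG2|exact: cG3].
  by move=> t tab; rewrite derive1E; have [_ ->] := Gg t tab.
have iseg (f : R -> R) : {within `[al, be], continuous f} -> mu.-integrable `[al, be] (EFin \o f).
  by move=> cf; apply: continuous_compact_integrable => //; exact: segment_compact.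
have ig := iseg _ cg; have ip := iseg _ cpp; have id := iseg _ (continuous_mul cdp cdp).
under eq_integral do rewrite expr2.
under [X in (_ <= _ + _ * X)%E]eq_integral do rewrite expr2.
have -> : (2 * (be - al) * p e ^+ 2)%:E = (\int[mu]_(t in `[al, be]) (g t)%:E)%E.
  rewrite FTC -EFinB; congr EFin; rewrite /G.
  by case: oe => -[-> ->]; ring.
rewrite -integralZl// -integralD//; last exact: integrableZl.
apply: le_integral => //; first by apply: integrableD => //; exact: integrableZl.
move=> t; rewrite inE/= in_itv/= => /andP[at_ tb].
rewrite -EFinM -EFinD lee_fin -subr_ge0.
have ot : (t - o) ^+ 2 <= (be - al) ^+ 2.
  by case: oe => -[-> _]; nra.
(* Completing the square: up to replacing [(t - o) ^+ 2] by [(be - al) ^+ 2], this is the difference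
   of the two integrands. *)
have := sqr_ge0 (p t + 2 * (t - o) * dp t).
have : (t - o) ^+ 2 * (dp t) ^+ 2 <= (be - al) ^+ 2 * (dp t) ^+ 2 by rewrite ler_wpM2r ?sqr_ge0.
rewrite /g; nra.
Qed.

End trace_interval.

Lemma continuous_within_comp (T U V : topologicalType) (D : set T) (A : set U)
    (phi : T -> U) (u : U -> V) : continuous phi -> (forall y, D y -> A (phi y)) ->
  {within A, continuous u} -> {within D, continuous (u \o phi)}.
Proof.
move=> cphi DA /subspace_continuousP cu; apply/subspace_continuousP => y Dy W nW.
have := cphi y _ (cu _ (DA _ Dy) W nW); rewrite /nbhs/=.
by apply: filterS => z h /DA; exact: h.
Qed.

(** * Boundary charts and thin layers along the boundary *)

Section chart.
Context {R : realType} {n : nat}.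
Implicit Types (x z : 'rV[R]_n.+1) (y : 'rV[R]_n) (i : 'I_n.+1).

Lemma col'_ins i (t : R) y : col' i (ins i (t, y)) = y.
Proof. by apply/rowP => k; rewrite !mxE liftK. Qed.

Lemma ins_col' i x : ins i (x 0 i, col' i x) = x.
Proof.
apply/rowP => j; rewrite insE /=; case: (unliftP i j) => [k|] -> //; first by rewrite mxE.
Qed.

Lemma ball_ins x (r : R) i t y : ball x r (ins i (t, y)) <->
  `|x 0 i - t| < r /\ ball (col' i x) r y.
Proof.
split => [bx|[h1 /ball_rVP[r0 h2]]].
  have [r0 _] := proj1 (ball_rVP _ _ _) bx.
  split; first by have := ball_coord i bx; rewrite ins_id.
  by apply: ball_rV_sub => // k; have := ball_coord (lift i k) bx; rewrite ins_lift mxE.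
apply: ball_rV_sub => // j; case: (unliftP i j) => [k|] ->; last by rewrite ins_id.
by rewrite ins_lift; have := h2 k; rewrite mxE.
Qed.

Lemma continuous_col' i : continuous (fun x => col' i x).
Proof.
move=> x A /nbhs_ballP[e /= e0 eA]; apply/nbhs_ballP; exists e => //= z xz.
by apply: eA; apply: ball_rV_sub => // k; rewrite !mxE; exact: ball_coord.
Qed.

Lemma continuous_ins (T : topologicalType) i (t : T -> R) (y : T -> 'rV[R]_n) :
  continuous t -> continuous y -> continuous (fun z : T => ins i (t z, y z) : 'rV[R]_n.+1).
Proof.
move=> ct cy z A /nbhs_ballP[e /= e0 eA].
have : \forall z' \near z, `|t z - t z'| < e by have /cvgrPdist_lt := ct z; apply.
have : \forall z' \near z, ball (y z) e (y z') by apply: cy; apply: nbhsx_ballx.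
apply: filterS2 => z' yz tz; apply: eA; apply: ball_rV_sub => // j; rewrite !insE /=.
by case: (unliftP i j) => [k|] _ //; exact: ball_coord.
Qed.

Lemma ins_line i (t : R) y : ins i (t, y) = t *: e_ i + ins i (0, y).
Proof.
apply/rowP => j; rewrite !mxE /=; case: (unliftP i j) => [k|] ->.
  by rewrite eq_sym (negbTE (neq_lift _ _)) mulr0 add0r.
by rewrite !eqxx mulr1 addr0.
Qed.

Section in_chart.
Variables (Om : set 'rV[R]_n.+1) (x0 : 'rV[R]_n.+1) (r : R) (i : 'I_n.+1) (s : bool) (gamma : 'rV[R]_n -> R).
Hypothesis ch : C2_chart Om x0 r i s gamma.
Local Notation sg := ((-1) ^+ s : R).

Let r0 : 0 < r. Proof. by case: ch. Qed.

Lemma chart_gamma_continuous : continuous gamma.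
Proof. by case: ch => _ /Ck_continuous. Qed.

Lemma chartP t y : ball x0 r (ins i (t, y)) -> (Om (ins i (t, y)) <-> 0 < sg * (t - gamma y)).
Proof. by case: ch => _ _ h /h; rewrite ins_id /= col'_ins. Qed.

Lemma sgK (t : R) : sg * (sg * t) = t.
Proof. by rewrite mulrA -expr2 sqrr_sign mul1r. Qed.

Lemma sg_norm (t : R) : `|sg * t| = `|t|.
Proof. by rewrite normrM normr_sign mul1r. Qed.

Lemma graph_pointE y : graph_point i gamma y = ins i (gamma y, y). Proof. by []. Qed.

(** Points slightly off the graph, on the side given by [s], lie in [Om]; on the graph the strict
    inequality of the chart fails. *)
Lemma graph_boundary y : chart_domain x0 r i gamma y ->
  closure Om (graph_point i gamma y) /\ ~ Om (graph_point i gamma y).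
Proof.
rewrite /chart_domain /= graph_pointE => by_; split; last first.
  by move=> /(chartP by_); rewrite subrr mulr0 ltxx.
have ob : open (ball x0 r) by exact: ball_open.
move=> A nA.
have : nbhs (ins i (gamma y, y)) (A `&` ball x0 r).
  by apply: filterI => //; apply: open_nbhs_nbhs; split.
move=> /nbhs_ballP[e /= e0 eA].
have h : ball (ins i (gamma y, y)) e (ins i (gamma y + sg * (e / 2), y)).
  apply/ball_ins; rewrite ins_id/= col'_ins opprD addrA subrr add0r normrN sg_norm.
  by split; [rewrite gtr0_norm ?divr_gt0//; lra|exact: ballxx].
have [A1 b1] := eA _ h.
exists (ins i (gamma y + sg * (e / 2), y)); split => //.
by apply/(chartP b1); rewrite addrAC subrr add0r sgK divr_gt0.
Qed.

Lemma chart_domain_open : open (chart_domain x0 r i gamma).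
Proof.
have -> : chart_domain x0 r i gamma = (fun y => ins i (gamma y, y)) @^-1` ball x0 r by [].
apply: open_comp; last exact: ball_open.
by move=> y _; apply: continuous_ins; [exact: chart_gamma_continuous|move=> z; exact: cvg_id].
Qed.

Lemma chart_area_continuous : continuous (@area_element R n.+1 gamma).
Proof.
move=> y; apply: (@continuous_comp _ _ _ (fun y => 1 + \sum_(k < n.+1.-1) partial k gamma y ^+ 2) Num.sqrt); last exact: sqrt_continuous.
apply: continuous_add; first exact: continuous_cst.
apply: continuous_sum => k; apply: continuous_mul; case: ch => _ [_ /(_ k)[_ [+ _]]] _ //.
Qed.

Lemma continuous_graph_point u : {within closure Om, continuous u} ->
  {in chart_domain x0 r i gamma, continuous (u \o graph_point i gamma : 'rV[R]_n -> R)}.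
Proof.
move=> cu; rewrite -continuous_open_subspace; last exact: chart_domain_open.
apply: (continuous_within_comp _ _ cu); first by apply: continuous_ins; [exact: chart_gamma_continuous|move=> y; exact: cvg_id].
by move=> y /graph_boundary[].
Qed.

(** A positive signed height would put [x0] in the open set [Om], and a negative one would keep [Om]
    away from [x0]. *)
Lemma boundary_point_graph : boundary Om x0 -> open Om -> x0 0 i = gamma (col' i x0).
Proof.
move=> [clx nx] oO.
have b0 : ball x0 r x0 by exact: ballxx.
rewrite -[in X in ball _ _ X](ins_col' i x0) in b0.
have cg : continuous (fun x => sg * (x 0 i - gamma (col' i x))).
  apply: continuous_mul; first exact: continuous_cst.
  apply: continuous_add; first exact: coord_continuous.
  move=> x; apply: continuousN; apply: (@continuous_comp _ _ _ (fun x => col' i x) gamma).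
    exact: continuous_col'.
  exact: chart_gamma_continuous.
have h1 : sg * (x0 0 i - gamma (col' i x0)) <= 0.
  by rewrite leNgt; apply/negP => /(chartP b0); rewrite ins_col' => Ox; apply: nx; rewrite (interior_id _).1.
have h2 : 0 <= sg * (x0 0 i - gamma (col' i x0)).
  rewrite leNgt; apply/negP => lt0.
  have /clx[z [Oz [bz hz]]] : nbhs x0 (ball x0 r `&` [set x : 'rV[R]_n.+1 | sg * (x 0 i - gamma (col' i x)) < 0]).
    apply: filterI; first exact: nbhsx_ballx.
    by have /cvgr_lt/(_ _ lt0) := cg x0.
  rewrite -(ins_col' i z) in bz Oz.
  by have := proj1 (chartP bz) Oz; rewrite ltNge ltW.
have : sg * (x0 0 i - gamma (col' i x0)) = 0 by apply/eqP; rewrite eq_le h1 h2.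
by move=> /(congr1 ( *%R sg)); rewrite sgK mulr0 => /eqP; rewrite subr_eq0 => /eqP.
Qed.

Definition C1_cl u (du : 'I_n.+1 -> 'rV[R]_n.+1 -> R) :=
  [/\ {within closure Om, continuous u}, forall j, {within closure Om, continuous (du j)} &
      forall j x, Om x -> is_derive x (e_ j) u (du j x)].

Variables (oOm : open Om) (rho tau : R).
Let Y := ball (col' i x0) rho.
Hypothesis Yr : Y `<=` ball (col' i x0) r.
(** Half of [r] is allotted to the graph and half to the thickness, so that the vertical segments of
    length [tau] over [Y] stay in the chart ball. *)
Hypothesis gammaY : forall y, Y y -> `|x0 0 i - gamma y| < r / 2.
Hypotheses (tau0 : 0 < tau) (taur : tau <= r / 2).

Definition layer := [set x | Y (col' i x) /\ 0 < sg * (x 0 i - gamma (col' i x)) < tau].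

Let layer_continuous : continuous (fun x => sg * (x 0 i - gamma (col' i x))).
Proof.
apply: continuous_mul; first exact: continuous_cst.
apply: continuous_add; first exact: coord_continuous.
move=> x; apply: continuousN; apply: (@continuous_comp _ _ _ (fun x => col' i x) gamma).
  exact: continuous_col'.
exact: chart_gamma_continuous.
Qed.

Lemma layer_open : open layer.
Proof.
have -> : layer = (fun x => col' i x) @^-1` Y `&`
    (fun x => sg * (x 0 i - gamma (col' i x))) @^-1` `]0, tau[%classic.
  by apply/seteqP; split => x /=; rewrite in_itv.
apply: openI; apply: open_comp.
- by move=> x _; exact: continuous_col'.
- exact: ball_open.
- by move=> x _; exact: layer_continuous.
- exact: itv_open.
Qed.

Let near_ball t y : Y y -> `|t - gamma y| <= tau -> ball x0 r (ins i (t, y)).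
Proof.
move=> Yy ty; apply/ball_ins; split; last exact: Yr.
have h := gammaY Yy.
have -> : x0 0 i - t = (x0 0 i - gamma y) + (gamma y - t) by ring.
rewrite (le_lt_trans (ler_normD _ _))// (distrC (gamma y)).
by rewrite [r](splitr r) ltr_leD// (le_trans ty).
Qed.

Lemma layer_sub : layer `<=` Om `&` ball x0 r.
Proof.
move=> x [Yx /andP[h1 h2]]; have b : ball x0 r (ins i (x 0 i, col' i x)).
  by apply: near_ball => //; rewrite -sg_norm ger0_norm ?ltW.
by split; [rewrite -(ins_col' i x); apply/(chartP b)|rewrite -(ins_col' i x)].
Qed.

Lemma layer_graph y : Y y -> chart_domain x0 r i gamma y.
Proof. by move=> Yy; apply: near_ball => //; rewrite subrr normr0 ltW. Qed.

Lemma layer_closure t y : Y y -> 0 <= sg * (t - gamma y) <= tau -> closure Om (ins i (t, y)).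
Proof.
move=> Yy /andP[h1 h2]; move: h1; rewrite le_eqVlt => /predU1P[h|h1]; last first.
  apply: subset_closure; have b : ball x0 r (ins i (t, y)).
    by apply: near_ball => //; rewrite -(sg_norm (t - gamma y)) ger0_norm// ltW.
  exact/(chartP b).
have -> : t = gamma y.
  by apply/eqP; rewrite -subr_eq0 -[t - _]sgK -h mulr0.
by have [] := graph_boundary (layer_graph Yy).
Qed.

(** Ends of the vertical segment of the layer over [y], in increasing order. The graph is its upper
    end when [s] is true and its lower end otherwise. *)
Let al y := gamma y - (if s then tau else 0).
Let be y := gamma y + (if s then 0 else tau).

Let al_be y : be y - al y = tau.
Proof. by rewrite /al /be; case: s; ring. Qed.

Let al_lt_be y : al y < be y. Proof. by rewrite -subr_gt0 al_be. Qed.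

Let in_layer y t : (al y < t < be y) = (0 < sg * (t - gamma y) < tau).
Proof.
rewrite /al /be; case: s ch; rewrite ?expr1 ?expr0 => _.
  by rewrite mulN1r opprB addr0 subr_gt0 ltrBlDl andbC -ltrBlDr.
by rewrite mul1r subr0 subr_gt0 ltrBlDl.
Qed.

Let in_layer_cl y t : (al y <= t <= be y) = (0 <= sg * (t - gamma y) <= tau).
Proof.
rewrite /al /be; case: s ch; rewrite ?expr1 ?expr0 => _.
  by rewrite mulN1r opprB addr0 subr_ge0 lerBlDl andbC -lerBlDr.
by rewrite mul1r subr0 subr_ge0 lerBlDl.
Qed.

Let sqE (w : 'rV[R]_n.+1 -> R) x : \bar R := ((w x) ^+ 2)%:E.

Let inner (w : 'rV[R]_n.+1 -> R) y : \bar R :=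
  (\int[lebesgue_measure]_t (sqE w \_ layer) (ins i (t, y)))%E.

Let innerE w y : Y y -> inner w y = (\int[lebesgue_measure]_(t in `]al y, be y[) sqE w (ins i (t, y)))%E.
Proof.
move=> Yy; rewrite [RHS]integral_mkcond; apply: eq_integral => t _; rewrite !patchE.
have E : (ins i (t, y) \in layer) = (t \in (`]al y, be y[%classic : set R)).
  apply/idP/idP; rewrite !inE /layer /= ins_id col'_ins in_itv/= in_layer; first by case.
  by move=> h; split.
by rewrite E.
Qed.

Let inner_out w y : ~ Y y -> inner w y = 0%E.
Proof.
move=> nY; apply: integral0_eq => t _; rewrite patchE memNset// /layer /= col'_ins.
by case.
Qed.

Let measurable_layer_fun w : measurable_fun layer (w : _ -> measurableTypeR R) ->
  measurable_fun setT (sqE w \_ layer).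
Proof.
move=> mw; apply/(measurable_restrictT _ (open_measurable_rV layer_open)).
by apply/measurable_EFinP; apply: measurable_funX.
Qed.

Let sqE_ge0 w x : (0 <= (sqE w \_ layer) x)%E.
Proof. by rewrite patchE; case: ifPn => // _; rewrite lee_fin sqr_ge0. Qed.

Let measurable_inner w : measurable_fun layer (w : _ -> measurableTypeR R) ->
  measurable_fun setT (inner w).
Proof.
move=> mw; apply: (@measurable_fun_fubini_tonelli_G _ _ _ _ _ (@lebesgue_measure R) ((sqE w \_ layer) \o ins i)).
  by apply: measurableT_comp; [exact: measurable_layer_fun|exact: measurable_ins].
by move=> p; exact: sqE_ge0.
Qed.

Let inner_ge0 w y : (0 <= inner w y)%E.
Proof. by apply: integral_ge0 => t _; exact: sqE_ge0. Qed.

Let integral_layerE w : measurable_fun layer (w : _ -> measurableTypeR R) ->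
  (\int[leb n.+1]_(x in layer) sqE w x = \int[leb n]_y inner w y)%E.
Proof.
move=> mw; rewrite integral_mkcond (ge0_integral_ins i)//; exact: measurable_layer_fun.
Qed.

Lemma within_closure_measurable (v : 'rV[R]_n.+1 -> R) : {within closure Om, continuous v} ->
  measurable_fun Om (v : _ -> measurableTypeR R).
Proof.
move=> cv; apply: continuous_measurable_rV => //; rewrite -continuous_open_subspace//.
by apply: continuous_subspaceW cv; exact: subset_closure.
Qed.

Let layer_measurable v : {within closure Om, continuous v} ->
  measurable_fun layer (v : 'rV[R]_n.+1 -> measurableTypeR R).
Proof.
move=> /within_closure_measurable; apply: measurable_funS; first exact: open_measurable_rV.
by move=> x /layer_sub[].
Qed.

(** The one-dimensional estimate on each vertical segment, with the endpoint value taken on the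
    graph, integrated over [Y] by Tonelli. *)
Lemma layer_estimate u du : C1_cl u du ->
  (\int[leb n.+1]_(x in layer) ((u x) ^+ 2)%:E <=
   (2 * tau)%:E * chart_integral2 x0 r i gamma u +
   (4 * tau ^+ 2)%:E * \int[leb n.+1]_(x in layer) ((du i x) ^+ 2)%:E)%E.
Proof.
move=> [cu cdu udu].
have mu_ := layer_measurable cu; have mdu := layer_measurable (cdu i).
rewrite (integral_layerE mu_) (integral_layerE mdu).
(* Boundary integrand without the surface factor; it is dominated by that of [chart_integral2]
   because [area_element >= 1]. *)
pose A y : \bar R := (((u (graph_point i gamma y)) ^+ 2)%:E * (\1_Y y)%:E)%E.
have mY : measurable Y by apply: open_measurable_rV; exact: ball_open.
have mg : measurable_fun (chart_domain x0 r i gamma) (u \o graph_point i gamma : 'rV[R]_n -> measurableTypeR R).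
  by apply: continuous_measurable_rV; [exact: chart_domain_open|exact: continuous_graph_point].
have AE : A = (fun y => ((u (graph_point i gamma y)) ^+ 2)%:E) \_ Y.
  apply/funext => y; rewrite /A patchE indicE; case: ifPn => _; first by rewrite mule1.
  by rewrite mule0.
have mA : measurable_fun setT A.
  rewrite AE; apply/(measurable_restrictT _ mY)/measurable_EFinP/measurable_funX.
  apply: measurable_funS mg; last by move=> y; exact: layer_graph.
  by apply: open_measurable_rV; exact: chart_domain_open.
have A0 y : (0 <= A y)%E by rewrite mule_ge0// lee_fin ?sqr_ge0.
have key y : (inner u y <= (2 * tau)%:E * A y + (4 * tau ^+ 2)%:E * inner (du i) y)%E.
  have t2 : (0 <= (2 * tau)%:E * A y)%E by rewrite mule_ge0// lee_fin mulr_ge0// ltW.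
  have t4 : (0 <= (4 * tau ^+ 2)%:E * inner (du i) y)%E by rewrite mule_ge0// lee_fin mulr_ge0// sqr_ge0.
  have [Yy|nY] := pselect (Y y); last by rewrite inner_out// adde_ge0.
  pose e := if s then be y else al y; pose o := if s then al y else be y.
  have eg : e = gamma y by rewrite /e /al /be; case: s; ring.
  have insD (v : 'rV[R]_n.+1 -> R) : {within closure Om, continuous v} ->
      {within `[al y, be y], continuous (fun t => v (ins i (t, y)))}.
    move=> cv; apply: (continuous_within_comp _ _ cv).
      by apply: continuous_ins; [move=> t; exact: cvg_id|move=> t; exact: cvg_cst].
    by move=> t /=; rewrite in_itv/= in_layer_cl => ht; apply: layer_closure.
  have := @integral_sqr_le_endpoint R (fun t => u (ins i (t, y))) (fun t => du i (ins i (t, y)))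
    (al y) (be y) o e (al_lt_be y) (insD _ cu) (insD _ (cdu i)).
  rewrite al_be !eg => H.
  have mD (v : 'rV[R]_n.+1 -> R) : {within closure Om, continuous v} ->
      measurable_fun `]al y, be y[ (fun t => ((v (ins i (t, y))) ^+ 2)%:E).
    move=> cv; apply/measurable_EFinP/measurable_funX.
    apply: (@measurable_funS _ _ _ _ `[al y, be y]%classic) => //; first exact: subset_itv_oo_cc.
    by apply: subspace_continuous_measurable_fun => //; exact: insD.
  rewrite !innerE// /A indicE mem_set// mule1 -EFinM.
  have <- := @integral_itv_bndoo R (al y) (be y) _ true false (mD _ cu).
  have <- := @integral_itv_bndoo R (al y) (be y) _ true false (mD _ (cdu i)).
  apply: H; last by rewrite -eg /e /o; case: s; [right|left].
  move=> t; rewrite in_itv/= in_layer => ht.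
  have Ot : Om (ins i (t, y)).
    by apply: (@proj1 _ (ball x0 r (ins i (t, y)))); apply: layer_sub; rewrite /layer /= ins_id col'_ins; split.
  rewrite ins_line in Ot *.
  under eq_fun do rewrite ins_line.
  by apply: is_derive_line; exact: udu.
apply: (@le_trans _ _ (\int[leb n]_y ((2 * tau)%:E * A y + (4 * tau ^+ 2)%:E * inner (du i) y))%E).
  apply: ge0_le_integral => //.
  - exact: measurable_inner.
  - by apply: emeasurable_funD; apply: measurable_funeM => //; exact: measurable_inner.
have t2 : (0 <= 2 * tau)%R by rewrite mulr_ge0// ltW.
have t4 : (0 <= 4 * tau ^+ 2)%R by rewrite mulr_ge0// sqr_ge0.
rewrite ge0_integralD//; last first.
- by apply: measurable_funeM; exact: measurable_inner.
- by move=> y _; rewrite mule_ge0.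
- exact: measurable_funeM.
- by move=> y _; rewrite mule_ge0.
rewrite !ge0_integralZl_EFin//; last exact: measurable_inner.
rewrite leeD2r// lee_wpmul2l ?lee_fin//.
have -> : chart_integral2 x0 r i gamma u = (\int[leb n]_(y in chart_domain x0 r i gamma)
    ((u (graph_point i gamma y)) ^+ 2 * @area_element R n.+1 gamma y)%:E)%E by [].
rewrite [leRHS]integral_mkcond; apply: ge0_le_integral => //.
- apply/(measurable_restrictT _ (open_measurable_rV chart_domain_open))/measurable_EFinP.
  apply: measurable_funM; first exact: measurable_funX.
  apply: continuous_measurable_rV; first exact: chart_domain_open.
  by move=> y _; exact: chart_area_continuous.
- move=> y _; rewrite /A patchE indicE; have [Yy|nY] := pselect (Y y); last first.
    rewrite memNset// mule0; case: ifPn => // _.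
    by rewrite lee_fin mulr_ge0 ?sqr_ge0 ?sqrtr_ge0.
  rewrite mem_set// mule1 mem_set; last exact: layer_graph.
  rewrite lee_fin ler_peMr ?sqr_ge0// -sqrtr1 ler_wsqrtr// lerDl sumr_ge0// => k _.
  exact: sqr_ge0.
Qed.

End in_chart.

Definition boundary_zone (Om : set 'rV[R]_n.+1) (del : R) := [set x | Om x /\ ~ (ball x del `<=` Om)].

Lemma boundary_zone_open Om del : open Om -> open (boundary_zone Om del).
Proof.
move=> oO; have -> : boundary_zone Om del = Om `&` \bigcup_(z in ~` Om) ball z del.
  apply/seteqP; split => [x [Ox /existsNP[z /not_implyP[xz nz]]]|x [Ox [z nz zx]]]; split => //.
    by exists z => //; exact: ball_sym.
  by move=> h; apply: nz; apply: h; exact: ball_sym.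
by apply: openI => //; apply: bigcup_open => z _; exact: ball_open.
Qed.

(** Near [x0] the function [gamma] is Lipschitz with constant [L] for the sum of the coordinate
    increments, so a point within [del] of the complement lies at height less than
    [(1 + L * n) * del] over the graph. *)
Lemma boundary_layer Om x0 r i s gamma : C2_chart Om x0 r i s gamma -> open Om -> boundary Om x0 ->
  exists rho C : R, [/\ 0 < rho /\ 0 < C, ball (col' i x0) rho `<=` ball (col' i x0) r,
    forall y, ball (col' i x0) rho y -> `|x0 0 i - gamma y| < r / 2 &
    forall del, 0 < del -> del <= rho ->
      boundary_zone Om del `&` ball x0 rho `<=` layer x0 i s gamma rho (C * del)].
Proof.
move=> ch oO bx0; have gx0 := boundary_point_graph ch bx0 oO.
have [r0 C2 _] := ch; have cg := chart_gamma_continuous ch.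
pose y0 := col' i x0.
have [e e0 ge] : exists2 e : R, 0 < e & forall y, ball y0 e y -> `|gamma y0 - gamma y| < r / 2.
  have r2 : 0 < r / 2 by rewrite divr_gt0.
  have /cvgrPdist_lt/(_ _ r2) /nbhs_ballP[e /= e0 he] := cg y0.
  by exists e => // y /he.
(* Halving leaves room for [z], which is within [del <= rho] of [x] and must still lie where [gamma]
   is controlled. *)
pose rho := Num.min e r / 2.
have m0 : 0 < Num.min e r by rewrite lt_min e0.
have rho0 : 0 < rho by rewrite divr_gt0.
have rhoe : rho + rho <= e by rewrite -splitr ge_min lexx.
have rhor : rho + rho <= r by rewrite -splitr ge_min lexx orbT.
have bB : bounded_set (ball y0 (rho + rho)).
  exists (`|y0| + (rho + rho)); split; first by rewrite num_real.
  move=> M hM z; rewrite -ball_normE /ball_ /= => h.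
  rewrite (le_trans _ (ltW hM))// -[z](subrK y0) addrC (le_trans (ler_normD _ _))//.
  by rewrite lerD2l distrC ltW.
have /choice[M hM] : forall k, exists M : R, 0 < M /\ forall y, closure (ball y0 (rho + rho)) y -> `|partial k gamma y| <= M.
  move=> k; have cp : continuous (partial k gamma) by case: C2 => _ /(_ k)[_ [+ _]].
  have [M M0 h] := continuous_within_bounded (compact_closure_rV bB) (continuous_subspaceT cp).
  by exists M.
pose L := \sum_k M k.
have L0 : 0 <= L by apply: sumr_ge0 => k _; have [/ltW] := hM k.
have lip y y' (d : R) : ball y0 (rho + rho) y -> ball y0 (rho + rho) y' -> ball y d y' ->
    `|gamma y' - gamma y| <= L * (n%:R * d).
  move=> By By' yy'.
  have := @lipschitz_of_partial R n gamma (fun k => partial k gamma) (ball y0 (rho + rho)) L y y'.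
  move=> /(_ _ _)/le_trans; apply.
  - move=> z hz; apply: ball_rV_sub; first by rewrite addr_gt0.
    move=> j; have := hz j; have := ball_coord j By; have := ball_coord j By'.
    rewrite !ltr_norml ge_min le_max => /andP[h1 h2] /andP[h3 h4] /andP[/orP h5 /orP h6].
    by apply/andP; split; case: h5; case: h6; lra.
  - move=> k z Bz; split; first exact: Ck1_is_derive C2.
    have [_ h] := hM k; rewrite (le_trans (h _ (subset_closure Bz)))//.
    by rewrite /L (bigD1 k)//= lerDl sumr_ge0// => j _; have [/ltW] := hM j.
  have -> : n%:R * d = \sum_(j < n) d by rewrite sumr_const card_ord mulr_natl.
  rewrite ler_wpM2l// ler_sum// => j _.
  by rewrite distrC ltW// ball_coord.
pose C := 1 + L * n%:R.
have C0 : 0 < C by rewrite ltr_pwDl// mulr_ge0.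
exists rho, C; split => //.
- by apply: le_ball; rewrite (le_trans _ rhor)// lerDl ltW.
- by move=> y By; rewrite gx0; apply: ge; apply: le_ball By; rewrite (le_trans _ rhoe)// lerDl ltW.
move=> del del0 delr x [[Ox /existsNP[z /not_implyP[xz nz]]] bx].
have bxr : ball x0 r x by apply: le_ball bx; rewrite (le_trans _ rhor)// lerDl ltW.
have bz2 : ball x0 (rho + rho) z by apply: ball_triangle bx _; exact: le_ball xz.
have bzr : ball x0 r z by apply: le_ball bz2.
rewrite -(ins_col' i x) -(ins_col' i z) in Ox nz xz bxr bzr bx bz2 *.
have h1 := proj1 (chartP ch bxr) Ox.
have h2 : (-1) ^+ s * (z 0 i - gamma (col' i z)) <= 0.
  by rewrite leNgt; apply/negP => /(chartP ch bzr).
have [_ bx'] := proj1 (ball_ins _ _ _ _ _) bx.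
have [_ bz'] := proj1 (ball_ins _ _ _ _ _) bz2.
have [xzi xz'] := proj1 (ball_ins _ _ _ _ _) xz.
rewrite ins_id col'_ins /= in xzi xz'.
have bx2 : ball y0 (rho + rho) (col' i x) by apply: le_ball bx'; rewrite lerDl ltW.
have hl := lip _ _ _ bx2 bz' xz'.
rewrite /layer /= ins_id col'_ins /=; split => //; rewrite h1 /=.
have -> : (-1) ^+ s * (x 0 i - gamma (col' i x)) = (-1) ^+ s * (z 0 i - gamma (col' i z)) +
  ((-1) ^+ s * (x 0 i - z 0 i) + (-1) ^+ s * (gamma (col' i z) - gamma (col' i x))) by ring.
have a1 := ler_norm ((-1) ^+ s * (x 0 i - z 0 i)).
have a2 := ler_norm ((-1) ^+ s * (gamma (col' i z) - gamma (col' i x))).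
rewrite sg_norm in a1; rewrite sg_norm in a2.
have -> : C * del = del + L * (n%:R * del) by rewrite /C; ring.
lra.
Qed.

End chart.

Section square_integrals_on_subsets.
Context {disp : measure_display} {T : measurableType disp} {R : realType}.
Variables (mu : {measure set T -> \bar R}).
Implicit Types (u : T -> R) (D A B : set T).

Lemma sqint_subset D A u : measurable D -> measurable A -> A `<=` D ->
  sqint mu D u -> sqint mu A u.
Proof.
move=> mD mA AD [mu_ fu]; split; first exact: measurable_funS mu_.
apply: le_lt_trans fu; apply: ge0_subset_integral => //.
- by apply/measurable_EFinP; exact: measurable_funX.
- by move=> x _; rewrite lee_fin sqr_ge0.
Qed.

Lemma ip_subset D A u : measurable D -> measurable A -> A `<=` D ->
  sqint mu D u -> L2_ip mu A u u <= L2_ip mu D u u.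
Proof.
move=> mD mA AD su; rewrite -lee_fin -!ip_fine//; last exact: sqint_subset su.
have [mu_ _] := su; apply: ge0_subset_integral => //.
- by apply/measurable_EFinP; exact: measurable_funX.
- by move=> x _; rewrite lee_fin sqr_ge0.
Qed.

Lemma ip_setU A B u : measurable A -> measurable B -> sqint mu (A `|` B) u ->
  L2_ip mu (A `|` B) u u <= L2_ip mu A u u + L2_ip mu B u u.
Proof.
move=> mA mB su.
have mAB : measurable (A `|` B) by exact: measurableU.
have mBA : measurable (B `\` A) by exact: measurableD.
have sA : sqint mu A u by apply: sqint_subset su => //; exact: subsetUl.
have sB : sqint mu B u by apply: sqint_subset su => //; exact: subsetUr.
have sBA : sqint mu (B `\` A) u by apply: sqint_subset sB => // x [].
have -> : L2_ip mu (A `|` B) u u = L2_ip mu A u u + L2_ip mu (B `\` A) u u.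
  have EAB : A `|` B `\` A = A `|` B.
    apply/seteqP; split => x; first by move=> [?|[? _]]; [left|right].
    by have [?|?] := pselect (A x); [left|move=> [//|?]; right].
  apply: EFin_inj; rewrite EFinD -!ip_fine// -ge0_integral_setU//.
  - by rewrite EAB.
  - by rewrite EAB; apply/measurable_EFinP; apply: measurable_funX; have [] := su.
  - by move=> x _; rewrite lee_fin sqr_ge0.
  - by apply/disj_setPS => x [? []].
by rewrite lerD2l ip_subset.
Qed.

Lemma ip_shrink D (S : (set T)^nat) u : measurable D -> (forall k, measurable (S k)) ->
  (forall k, S k `<=` D) -> (forall x, D x -> \forall k \near \oo, ~ S k x) ->
  sqint mu D u -> L2_ip mu (S k) u u @[k --> \oo] --> (0 : R).
Proof.
move=> mD mS SD S0 su.
have sS k : sqint mu (S k) u by apply: sqint_subset su.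
have E k : L2_ip mu (S k) u u = fine (\int[mu]_(x in D) ((u x) ^+ 2 * \1_(S k) x)%:E)%E.
  rewrite -[LHS]/(fine (L2_ip mu (S k) u u)%:E) -ip_fine//; congr fine.
  rewrite integral_mkcond [RHS]integral_mkcond; apply: eq_integral => x _; rewrite !patchE indicE.
  case: ifPn => [xS|xS] /=; last by rewrite mulr0; case: ifP.
  by rewrite mulr1 (mem_set (SD k x (set_mem xS))).
under eq_fun do rewrite E.
have [|||||_ _ H] := @dominated_convergence _ _ _ mu D mD
  (fun k x => ((u x) ^+ 2 * \1_(S k) x)%:E) (cst 0%E) (fun x => ((u x) ^+ 2)%:E).
- move=> k; apply/measurable_EFinP; apply: measurable_funM; last exact: measurable_indic.
  by apply: measurable_funX; have [] := su.
- exact: measurable_cst.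
- apply: aeW => x Dx; apply: cvg_near_cst; apply: filterS (S0 x Dx) => k nS.
  by rewrite indicE memNset// mulr0.
- exact: integrable_sqr.
- apply: aeW => x k Dx; rewrite lee_fin normrM ger0_norm ?sqr_ge0// indicE.
  by case: (_ \in _); rewrite ?normr1 ?normr0 ?mulr1 ?mulr0 ?sqr_ge0.
rewrite integral0 in H.
exact: fine_cvg H.
Qed.

End square_integrals_on_subsets.

(** * Zero trace implies membership in [H^1_0] *)

Section trace_zero.
Context {R : realType} {n : nat}.
Variables (Om : set 'rV[R]_n.+1).
Hypotheses (oOm : open Om) (bOm : bounded_set Om) (bdOm : C2_boundary Om).
Implicit Types (x : 'rV[R]_n.+1).

Local Notation mu := (leb n.+1).
Local Notation sq := (sqint mu Om).
Local Notation ip := (L2_ip mu Om).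
Local Notation dist2 := (dist2 mu Om).
Let mO : measurable Om := measurable_Om oOm.

Variables (ws : ('rV[R]_n.+1 -> R)^nat) (dws : nat -> 'I_n.+1 -> 'rV[R]_n.+1 -> R).
Variables (w : 'rV[R]_n.+1 -> R) (dw : 'I_n.+1 -> 'rV[R]_n.+1 -> R).
Hypotheses (wsC : forall m, C1_cl Om (ws m) (dws m)).
Hypotheses (wss : forall m, sob Om (ws m) (dws m)) (wsob : sob Om w dw).
Hypothesis cws : hd Om (ws m) (dws m) w dw @[m --> \oo] --> (0 : R).
Hypothesis trace0 : forall x0 r i s gamma, C2_chart Om x0 r i s gamma ->
  chart_integral2 x0 r i gamma (ws m) @[m --> \oo] --> 0%E.

(** [layer_estimate] for the approximations, whose boundary term tends to [0]. The constant is
    [2 * 4 * 2]: squared norms are doubled when passing from [w] to [ws m] and from the derivative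
    of [ws m] back to [dw]. *)
Lemma layer_decay x0 r i s gamma (rho tau : R) : C2_chart Om x0 r i s gamma ->
  ball (col' i x0) rho `<=` ball (col' i x0) r ->
  (forall y, ball (col' i x0) rho y -> `|x0 0 i - gamma y| < r / 2) ->
  0 < tau -> tau <= r / 2 ->
  L2_ip mu (layer x0 i s gamma rho tau) w w <=
    16 * tau ^+ 2 * L2_ip mu (layer x0 i s gamma rho tau) (dw i) (dw i).
Proof.
move=> ch Yr gY tau0 taur; set S := layer _ _ _ _ _ _.
have SO : S `<=` Om by move=> x /(layer_sub ch Yr gY taur)[].
have oS : open S := @layer_open _ _ _ _ _ _ _ _ ch rho tau.
have mS : measurable S by exact: open_measurable_rV.
have sS u : sq u -> sqint mu S u by exact: sqint_subset.
have sw := sob_sq wsob; have sdw := sob_sqd i wsob.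
have swm m := sob_sq (wss m); have sdwm m := sob_sqd i (wss m).
apply/ler_addgt0Pr => e e0.
(* Total coefficient of the small quantity [e / k] in the estimates below. *)
pose k := 2 + 4 * tau + 16 * tau ^+ 2.
have k0 : 0 < k by rewrite addr_gt0 ?mulr_gt0 ?exprn_gt0// addr_gt0// mulr_gt0.
have ek0 : 0 < e / k by rewrite divr_gt0.
have [m [h1 h2 h3]] : exists m, [/\ dist2 (ws m) w <= e / k, dist2 (dws m i) (dw i) <= e / k &
    (chart_integral2 x0 r i gamma (ws m) <= (e / k)%:E)%E].
  have /cvgr_le/(_ _ ek0)[N1 _ hN1] := cws.
  have [N2 _ hN2] : \forall m \near \oo, (chart_integral2 x0 r i gamma (ws m) < (e / k)%:E)%E.
    have H : nbhs 0%E [set y : \bar R | (y < (e / k)%:E)%E].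
      by apply: open_nbhs_nbhs; split; [exact: open_ereal_lt_ereal|rewrite /= lte_fin].
    exact: (trace0 ch H).
  exists (maxn N1 N2); have := hN1 (maxn N1 N2) (leq_maxl _ _) => h; split.
  - exact: le_trans (hd_le0 _ _ _ _ _) h.
  - exact: le_trans (hd_led _ i _ _ _ _) h.
  - by apply: ltW; apply: hN2; exact: leq_maxr.
have L : L2_ip mu S (ws m) (ws m) <= 2 * tau * (e / k) + 4 * tau ^+ 2 * L2_ip mu S (dws m i) (dws m i).
  rewrite -lee_fin EFinD EFinM (EFinM (4 * _)) -ip_fine; last exact: sS.
  rewrite -[in leRHS]ip_fine; last exact: sS.
  have t0 : (0 <= (2 * tau)%:E)%E by rewrite lee_fin mulr_ge0// ltW.
  apply: (le_trans (layer_estimate ch oOm Yr gY tau0 taur (wsC m))).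
  by rewrite leeD2r// lee_wpmul2l.
have split2 u v : sq u -> sq v -> L2_ip mu S v v <= 2 * dist2 u v + 2 * L2_ip mu S u u.
  move=> su sv; have suv : sq (fun x => v x - u x) by exact: sqintB.
  have := ip_sqrD_le mS (sqintB mS (sS _ sv) (sS _ su)) (sS _ su).
  have -> : L2_ip mu S (fun x => v x - u x + u x) (fun x => v x - u x + u x) = L2_ip mu S v v.
    by apply: eq_ip => x _; rewrite subrK.
  move=> /le_trans; apply; rewrite lerD2r ler_pM2l// dist2C.
  exact: ip_subset.
have b1 := split2 _ _ (swm m) sw.
have b2 := split2 _ _ sdw (sdwm m); rewrite dist2C in b2.
have b3 : 4 * tau ^+ 2 * L2_ip mu S (dws m i) (dws m i) <=
    4 * tau ^+ 2 * (2 * (e / k) + 2 * L2_ip mu S (dw i) (dw i)).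
  apply: ler_wpM2l; first by rewrite mulr_ge0// sqr_ge0.
  by rewrite (le_trans b2)// lerD2r ler_pM2l.
have -> : 16 * tau ^+ 2 * L2_ip mu S (dw i) (dw i) + e =
    16 * tau ^+ 2 * L2_ip mu S (dw i) (dw i) + e / k * k by rewrite divfK// gt_eqF.
rewrite /k; lra.
Qed.

Let zone (k : nat) := boundary_zone Om k.+1%:R^-1.

Let zone_open k : open (zone k). Proof. exact: boundary_zone_open. Qed.

Let zone_sub k : zone k `<=` Om. Proof. by move=> x []. Qed.

Let near_inv (e : R) : 0 < e -> \forall k \near \oo, k.+1%:R^-1 <= e.
Proof. by move=> e0; near=> k; apply: ltW; near: k; exact: near_infty_natSinv_lt (PosNum e0). Unshelve. all: by end_near. Qed.

(** A small ball around an interior point eventually misses the zone. At a boundary point the zone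
    lies in a layer of thickness [C / k.+1], and [layer_decay] compensates the factor [k.+1 ^+ 2]
    exactly. *)
Lemma zone_decay_local x : closure Om x -> exists2 rho : R, 0 < rho &
  k.+1%:R ^+ 2 * L2_ip mu (zone k `&` ball x rho) w w @[k --> \oo] --> (0 : R).
Proof.
move=> clx; have sw := sob_sq wsob.
have [Ox|nOx] := pselect (Om x).
  have /nbhs_ballP[r /= r0 rO] : nbhs x Om by apply: open_nbhs_nbhs.
  exists (r / 2); first by rewrite divr_gt0.
  apply: cvg_near_cst.
  have : \forall k \near \oo, k.+1%:R^-1 <= r / 2 by apply: near_inv; rewrite divr_gt0.
  apply: filterS => k hk.
  have -> : zone k `&` ball x (r / 2) = set0.
    rewrite -subset0 => y [[Oy ny] xy]; apply: ny => z yz; apply: rO.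
    by rewrite [r]splitr; apply: ball_triangle xy _; exact: le_ball yz.
  by rewrite /L2_ip /Rintegral integral_set0 mulr0.
have bx : boundary Om x by split => //; rewrite (interior_id _).1.
have [r [i [s [gamma ch]]]] := bdOm bx.
have [rho [C [[rho0 C0] Yr gY sub]]] := boundary_layer ch oOm bx.
have [r0 _ _] := ch.
exists rho => //.
(* Intersected with [Om] because the layer is known to lie in [Om] only once its thickness is at
   most [r / 2]. *)
pose S k := layer x i s gamma rho (C * k.+1%:R^-1) `&` Om.
have oL k : open (layer x i s gamma rho (C * k.+1%:R^-1)) := @layer_open _ _ _ _ _ _ _ _ ch _ _.
have mS k : measurable (S k) by apply: open_measurable_rV; exact: openI.
have SO k : S k `<=` Om by move=> y [].
have lim : L2_ip mu (S k) (dw i) (dw i) @[k --> \oo] --> (0 : R).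
  apply: (ip_shrink mO mS SO _ (sob_sqd i wsob)) => y Oy.
  have [t0|t0] := leP ((-1) ^+ s * (y 0 i - gamma (col' i y))) 0.
    by apply: nearW => k [[_ /andP[]]]; rewrite ltNge t0.
  have tC : 0 < (-1) ^+ s * (y 0 i - gamma (col' i y)) / C by rewrite divr_gt0.
  apply: filterS (near_inv tC) => k; rewrite ler_pdivlMr// mulrC => hk [[_ /andP[_]]].
  by rewrite ltNge hk.
apply: (@squeeze_cvgr _ _ _ _ (fun=> 0) (fun k => 16 * C ^+ 2 * L2_ip mu (S k) (dw i) (dw i))).
- near=> k.
  have k0 : (0 : R) < k.+1%:R by [].
  have kr : C * k.+1%:R^-1 <= r / 2.
    rewrite -ler_pdivlMl// mulrC; near: k; apply: near_inv; rewrite !divr_gt0//.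
  have krho : k.+1%:R^-1 <= rho by near: k; exact: near_inv.
  rewrite mulr_ge0 ?sqr_ge0 ?ip_ge0//=.
  have SE : S k = layer x i s gamma rho (C * k.+1%:R^-1).
    by apply/setIidPl => y /(layer_sub ch Yr gY kr)[].
  have C1 : 0 < C * k.+1%:R^-1 by rewrite mulr_gt0// invr_gt0.
  have := layer_decay ch Yr gY C1 kr; rewrite -SE => h.
  apply: (@le_trans _ _ (k.+1%:R ^+ 2 * L2_ip mu (S k) w w)).
    rewrite ler_pM2l ?exprn_gt0//; apply: ip_subset => //.
    - by apply: open_measurable_rV; apply: openI => //; exact: ball_open.
    - by rewrite SE; apply: sub => //; rewrite invr_gt0.
    - by apply: sqint_subset sw => //.
  apply: (le_trans (ler_wpM2l (sqr_ge0 k.+1%:R) h)).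
  rewrite le_eqVlt; apply/orP; left; apply/eqP.
  move: (L2_ip _ _ (dw i) _) => q; move: (k.+1%:R : R) k0 => t t0.
  by field; rewrite gt_eqF.
- exact: cvg_cst.
- rewrite -[X in _ --> X](mulr0 (16 * C ^+ 2)); exact: cvgMr.
Unshelve. all: by end_near. Qed.

(* Since the zone has width [1/k], [layer_decay] bounds its [w]-mass by [1/k^2]
   times a gradient mass that tends to [0]. *)
Lemma zone_decay : k.+1%:R ^+ 2 * L2_ip mu (zone k) w w @[k --> \oo] --> (0 : R).
Proof.
have sw := sob_sq wsob.
have /choice[rho hrho] : forall x, exists rho : R, 0 < rho /\ (closure Om x ->
    k.+1%:R ^+ 2 * L2_ip mu (zone k `&` ball x rho) w w @[k --> \oo] --> (0 : R)).
  move=> x; have [/zone_decay_local[rho rho0 h]|ncl] := pselect (closure Om x).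
    by exists rho.
  by exists 1.
(* Finitely many balls with local decay cover the closure; the contributions are added by induction
   on their list. *)
have := compact_closure_rV bOm; rewrite compact_cover => /(_ _ (closure Om) (fun x => ball x (rho x))).
case=> [x _|x clx|D DO cov]; first exact: ball_open.
  by exists x => //; apply: ballxx; have [] := hrho x.
pose U (s : seq 'rV[R]_n.+1) := [set y | exists2 x, x \in s & ball x (rho x) y].
have H (s : seq 'rV[R]_n.+1) : (forall x, x \in s -> closure Om x) ->
    open (U s) /\ k.+1%:R ^+ 2 * L2_ip mu (zone k `&` U s) w w @[k --> \oo] --> (0 : R).
  elim: s => [|x s IH] cls.
    have -> : U [::] = set0 by rewrite -subset0 => y [x].
    split; first exact: open0.
    by under eq_fun do rewrite setI0 /L2_ip /Rintegral integral_set0 mulr0; exact: cvg_cst.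
  have [|oU lU] := IH; first by move=> y ys; apply: cls; rewrite inE ys orbT.
  have UE : U (x :: s) = ball x (rho x) `|` U s.
    apply/seteqP; split => y.
      by move=> [z]; rewrite inE => /predU1P[->|zs] bz; [left|right; exists z].
    by move=> [bz|[z zs bz]]; [exists x; rewrite ?mem_head|exists z; rewrite // inE zs orbT].
  have [_ lx] := hrho x; have {}lx := lx (cls x (mem_head _ _)).
  rewrite UE; split; first by apply: openU => //; exact: ball_open.
  apply: (@squeeze_cvgr _ _ _ _ (fun=> 0) (fun k => k.+1%:R ^+ 2 * L2_ip mu (zone k `&` ball x (rho x)) w w +
    k.+1%:R ^+ 2 * L2_ip mu (zone k `&` U s) w w)).
  - apply: nearW => k; rewrite mulr_ge0 ?sqr_ge0 ?ip_ge0//= -mulrDr ler_wpM2l ?sqr_ge0//.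
    rewrite setIUr; apply: ip_setU.
    + by apply: open_measurable_rV; apply: openI => //; exact: ball_open.
    + by apply: open_measurable_rV; exact: openI.
    + apply: sqint_subset sw => //; last by move=> y [[/zone_sub]|[/zone_sub]].
      by apply: open_measurable_rV; apply: openU; apply: openI => //; exact: ball_open.
  - exact: cvg_cst.
  - by rewrite -[X in _ --> X]addr0; exact: cvgD.
have [x xD|_] := H (finmap.enum_fset D); first by have := DO x xD; rewrite inE.
have zU k : zone k `&` U (finmap.enum_fset D) = zone k.
  apply/setIidPl => y /zone_sub /subset_closure /cov [x xD bx].
  by exists x.
by under eq_fun do rewrite zU.
Qed.

Lemma zone_decay_grad i : L2_ip mu (zone k) (dw i) (dw i) @[k --> \oo] --> (0 : R).
Proof.
apply: (ip_shrink mO _ zone_sub _ (sob_sqd i wsob)) => [k|x Ox]; first exact: open_measurable_rV.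
have /nbhs_ballP[r /= r0 rO] : nbhs x Om by apply: open_nbhs_nbhs.
by apply: filterS (near_inv r0) => k hk [_]; apply => y /(le_ball hk)/rO.
Qed.

(** The cutoff is the interpolant, with mesh of order [1 / k.+1], of the indicator of the points
    whose [del]-ball lies in [Om]. Off the zone every contributing node has value [1], so [sum_hat]
    and [sum_dhat] give value [1] and gradient [0]. *)
Lemma cutoff_exists : exists2 C : R, 0 < C & forall k, exists eta, [/\ test_function Om eta,
  forall x, Om x -> `|eta x| <= C /\ forall i, `|partial i eta x| <= C * k.+1%:R &
  forall x, Om x -> ~ zone k x -> eta x = 1 /\ forall i, partial i eta x = 0].
Proof.
have [C C0 hC] := @hat_bound R n.+1.
(* [eps^-1 = 8 * k.+1] for the mesh chosen below. *)
exists (8 * C) => [|k]; first by rewrite mulr_gt0.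
pose del : R := k.+1%:R^-1 / 2; pose eps := del / 4.
have k0 : (0 : R) < k.+1%:R by [].
have del0 : 0 < del by rewrite divr_gt0// invr_gt0.
have eps0 : 0 < eps by rewrite divr_gt0.
have [N hN] := qi_range bOm eps0.
pose f (x : 'rV[R]_n.+1) : R := if pselect (ball x del `<=` Om) then 1 else 0.
have f1 x : `|f x| <= 1 by rewrite /f; case: pselect => [?|?]; rewrite ?normr1 ?normr0.
have qE i x : partial i (qi eps N (N + N.+1) f) x = dqi eps N (N + N.+1) f i x.
  by have [_ h] := @is_derive_qi R n.+1 eps N (N + N.+1) f i x; exact: h.
exists (qi eps N (N + N.+1) f); split.
- apply: (test_function_qi bOm (del := del)) => //.
    by rewrite /eps mulrC divfK.
  by move=> y; rewrite /f; case: pselect => [?|?] //; rewrite eqxx.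
- move=> x Ox; have [h1 h2] := hC eps N (N + N.+1)%N x eps0; split.
    apply: (le_trans (ler_norm_sum _ _ _)); apply: (@le_trans _ _ C); last by rewrite ler_peMl ?ler1n// ltW.
    by apply: le_trans h1; apply: ler_sum => z _; rewrite normrM ler_piMl.
  move=> i; rewrite qE; apply: (le_trans (ler_norm_sum _ _ _)).
  have -> : 8 * C * k.+1%:R = eps^-1 * C by rewrite /eps /del; field; rewrite gt_eqF.
  by apply: le_trans (h2 i); apply: ler_sum => z _; rewrite normrM ler_piMl.
move=> x Ox nz.
have xO : ball x k.+1%:R^-1 `<=` Om by apply: contrapT => nx; apply: nz; split.
have fz z : (forall j, `|x 0 j - (@node R n.+1 eps N (N + N.+1)%N z) 0 j| <= 2 * eps) -> f (node eps N z) = 1.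
  move=> hz; rewrite /f; case: pselect => // nb; exfalso; apply: nb => y by_; apply: xO.
  have -> : k.+1%:R^-1 = del + del :> R by rewrite /del -splitr.
  apply: ball_triangle by_; apply: ball_rV_sub => // j; apply: le_lt_trans (hz j) _.
  rewrite /eps; lra.
split => [|i].
  rewrite /qi -[RHS](@sum_hat R n.+1 eps N (N + N.+1) x) => [|j]; last exact: hN.
  apply: eq_bigr => z _; have [->|hz] := eqVneq (hat eps N z x) 0; first by rewrite mulr0.
  by rewrite fz ?mul1r// => j; exact: hat_neq0.
rewrite qE /dqi -[RHS](@sum_dhat R n.+1 eps N (N + N.+1) x _ i) => [|j]; last exact: hN.
apply: eq_bigr => z _; have [->|hz] := eqVneq (dhat eps N i z x) 0; first by rewrite mulr0.
by rewrite fz ?mul1r// => j; exact: dhat_neq0 hz _.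
Qed.

Let ip_mul_le u v (M : R) : 0 <= M -> sq u -> sq v ->
  (forall x, Om x -> `|v x| <= M * `|u x|) -> ip v v <= M ^+ 2 * ip u u.
Proof.
move=> M0 su sv h; rewrite -(ip_sqrZ mO)//; apply: ip_ae_le => //; try exact: sqintZ.
apply: aeW => x Ox; rewrite -!expr2 -[leLHS]real_normK ?num_real// -[leRHS]real_normK ?num_real//.
by rewrite ler_sqr ?nnegrE// normrM (ger0_norm M0) h.
Qed.

Let ip_zone_le k u v (M : R) : 0 <= M -> sq u -> sq v ->
  (forall x, Om x -> `|v x| <= M * `|u x|) -> (forall x, Om x -> ~ zone k x -> v x = 0) ->
  ip v v <= M ^+ 2 * L2_ip mu (zone k) u u.
Proof.
move=> M0 su sv h v0.
have mz : measurable (zone k) by exact: open_measurable_rV.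
have zs t : sq t -> sqint mu (zone k) t by apply: sqint_subset => //; exact: zone_sub.
have -> : ip v v = L2_ip mu (zone k) v v.
  rewrite /L2_ip /Rintegral; congr fine; rewrite integral_mkcond [RHS]integral_mkcond.
  apply: eq_integral => x _; rewrite !patchE; case: ifPn => xO; case: ifPn => // xz.
    by rewrite v0 ?mulr0//; [exact: set_mem|move: xz; rewrite notin_setE].
  by move: xO; rewrite (mem_set (zone_sub (set_mem xz))).
rewrite -(ip_sqrZ mz)//; last exact: zs.
apply: ip_ae_le => //; try exact: zs; try (by apply: zs; exact: sqintZ).
apply: aeW => x /zone_sub Ox; rewrite -!expr2 -[leLHS]real_normK ?num_real// -[leRHS]real_normK ?num_real//.
by rewrite ler_sqr ?nnegrE// normrM (ger0_norm M0) h.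
Qed.

Hypothesis wsC1 : forall m, C1_on Om (ws m) (dws m).

(** [w] is approximated by [eta * ws m], with error [eta * (ws m - w) + (eta - 1) * w]. The gradient
    of [eta] costs a factor [k.+1]: [zone_decay] pays for it on [w], the choice of [m] on
    [ws m - w]. *)
Lemma trace_zero_sob0 : sob0 Om w dw.
Proof.
have sw := sob_sq wsob; have sdw i := sob_sqd i wsob.
have swm m := sob_sq (wss m); have sdwm m i := sob_sqd i (wss m).
have [C C0 hC] := cutoff_exists.
pose C' := C + 1; have C'0 : 0 <= C' by rewrite addr_ge0// ltW.
have CC' : C <= C' by rewrite lerDl.
pose Bk k := k.+1%:R ^+ 2 * L2_ip mu (zone k) w w + \sum_i L2_ip mu (zone k) (dw i) (dw i).
have Bk0 : Bk k @[k --> \oo] --> (0 : R).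
  rewrite -[X in _ --> X]addr0; apply: cvgD; first exact: zone_decay.
  by apply: cvg_sum0 => i; exact: zone_decay_grad.
pose K := (1 + n.+1%:R) * (16 * C' ^+ 2).
have K0 : 0 < K by rewrite mulr_gt0 ?addr_gt0// mulr_gt0// exprn_gt0// ltr_wpDl// ltW.
apply: (sob0_approx oOm bOm) => // e e0.
have eK : 0 < e / 2 / K by rewrite !divr_gt0.
have [k hk] : exists k, Bk k <= e / 2 / K.
  by have /cvgr_le/(_ _ eK)[k _ hk] := Bk0; exists k; exact: hk (leqnn k).
have k0 : (0 : R) < k.+1%:R by [].
have k1 : (1 : R) <= k.+1%:R ^+ 2 by rewrite exprn_ege1// ler1n.
(* [m] is chosen after [k], so the factor [k.+1 ^+ 2] due to the gradient of the cutoff is divided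
   out in advance. *)
have eKk : 0 < e / 2 / K / k.+1%:R ^+ 2 by rewrite divr_gt0// exprn_gt0.
have [m hm] : exists m, hd Om (ws m) (dws m) w dw <= e / 2 / K / k.+1%:R ^+ 2.
  by have /cvgr_le/(_ _ eKk)[m _ hm] := cws; exists m; exact: hm (leqnn m).
have [eta [teta bd one]] := hC k.
have etaC := test_function_C1c teta; have [seta sdeta] := test_sq oOm bOm teta.
have [A AE] : {A | A = hd Om (ws m) (dws m) w dw} by eexists.
have [Z ZE] : {Z | Z = \sum_i L2_ip mu (zone k) (dw i) (dw i)} by eexists.
have [G GE] : {G | G = k.+1%:R ^+ 2 * A + (k.+1%:R ^+ 2 * L2_ip mu (zone k) w w + Z)} by eexists.
have A0 : 0 <= A by rewrite AE; exact: hd_ge0.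
have zw0 : 0 <= k.+1%:R ^+ 2 * L2_ip mu (zone k) w w by rewrite mulr_ge0 ?sqr_ge0// ip_ge0.
have zdw0 i : 0 <= L2_ip mu (zone k) (dw i) (dw i) by exact: ip_ge0.
have szdw i : L2_ip mu (zone k) (dw i) (dw i) <= Z.
  by rewrite ZE [leRHS](bigD1 i)//= lerDl sumr_ge0.
have zdws : 0 <= Z by rewrite ZE; exact: sumr_ge0.
have zw : L2_ip mu (zone k) w w <= k.+1%:R ^+ 2 * L2_ip mu (zone k) w w by rewrite ler_peMl// ip_ge0.
have kA : A <= k.+1%:R ^+ 2 * A by rewrite ler_peMl.
have G0 : 0 <= G by rewrite GE addr_ge0 ?mulr_ge0 ?sqr_ge0// addr_ge0.
have meta : measurable_fun Om (eta : _ -> measurableTypeR R) by have [] := seta.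
have sqM1 u : sq u -> sq (fun x => eta x * u x).
  apply: (@sqint_mul_bounded _ _ _ _ _ mO C) => //; apply: aeW => x Ox; by have [] := bd x Ox.
have sqM2 i u : sq u -> sq (fun x => partial i eta x * u x).
  apply: (@sqint_mul_bounded _ _ _ _ _ mO (C * k.+1%:R)); first by have [] := sdeta i.
  by apply: aeW => x Ox; have [_] := bd x Ox.
have sqM3 u : sq u -> sq (fun x => (eta x - 1) * u x).
  move=> su; have := sqintB mO (sqM1 u su) su.
  by congr sqint; apply/funext => x; rewrite mulrBl mul1r.
have eta1 x : Om x -> `|eta x - 1| <= C'.
  move=> Ox; have [h _] := bd x Ox; rewrite (le_trans (ler_normB _ _))// normr1 lerD2r//.
have e1 : dist2 (fun x => ws m x * eta x) w <= 16 * C' ^+ 2 * G.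
  have -> : dist2 (fun x => ws m x * eta x) w =
    ip (fun x => eta x * (ws m x - w x) + (eta x - 1) * w x) (fun x => eta x * (ws m x - w x) + (eta x - 1) * w x).
    by apply: eq_ip => x _; ring.
  apply: (le_trans (ip_sqrD_le mO (sqM1 _ (sqintB mO (swm m) sw)) (sqM3 _ sw))).
  have h1 : ip (fun x => eta x * (ws m x - w x)) (fun x => eta x * (ws m x - w x)) <= C' ^+ 2 * dist2 (ws m) w.
    apply: ip_mul_le => //; [exact: sqintB|by apply: sqM1; exact: sqintB|].
    by move=> x Ox; rewrite normrM ler_wpM2r// (le_trans _ CC')//; have [] := bd x Ox.
  have h2 : ip (fun x => (eta x - 1) * w x) (fun x => (eta x - 1) * w x) <= C' ^+ 2 * L2_ip mu (zone k) w w.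
    apply: ip_zone_le => //; [exact: sqM3| |].
      by move=> x Ox; rewrite normrM ler_wpM2r// eta1.
    by move=> x Ox nz; have [-> _] := one x Ox nz; rewrite subrr mul0r.
  have h3 : dist2 (ws m) w <= A by rewrite AE; exact: hd_le0.
  have h4 : dist2 (ws m) w + L2_ip mu (zone k) w w <= G by rewrite GE; lra.
  have h5 := ler_wpM2l (sqr_ge0 C') h4.
  have h6 : 0 <= C' ^+ 2 * G by rewrite mulr_ge0// sqr_ge0.
  rewrite mulrDr in h5; lra.
have e2 i : dist2 (fun x => ws m x * partial i eta x + eta x * dws m i x) (dw i) <= 16 * C' ^+ 2 * G.
  pose p x := partial i eta x * (ws m x - w x) + partial i eta x * w x.
  pose q x := eta x * (dws m i x - dw i x) + (eta x - 1) * dw i x.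
  have -> : dist2 (fun x => ws m x * partial i eta x + eta x * dws m i x) (dw i) =
      ip (fun x => p x + q x) (fun x => p x + q x).
    by apply: eq_ip => x _; rewrite /p /q; ring.
  have s1 := sqM2 i _ (sqintB mO (swm m) sw); have s2 := sqM2 i _ sw.
  have s3 := sqM1 _ (sqintB mO (sdwm m i) (sdw i)); have s4 := sqM3 _ (sdw i).
  apply: (le_trans (ip_sqrD_le mO (sqintD mO s1 s2) (sqintD mO s3 s4))).
  have hp := ip_sqrD_le mO s1 s2; have hq := ip_sqrD_le mO s3 s4.
  have Ck0 : 0 <= C' * k.+1%:R by rewrite mulr_ge0.
  have bdk x : Om x -> `|partial i eta x| <= C' * k.+1%:R.
    by move=> Ox; have [_ /(_ i)] := bd x Ox => /le_trans; apply; rewrite ler_wpM2r.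
  have h1 : ip (fun x => partial i eta x * (ws m x - w x)) (fun x => partial i eta x * (ws m x - w x)) <=
      (C' * k.+1%:R) ^+ 2 * dist2 (ws m) w.
    by apply: ip_mul_le => //; [exact: sqintB|move=> x Ox; rewrite normrM ler_wpM2r// bdk].
  have h2 : ip (fun x => partial i eta x * w x) (fun x => partial i eta x * w x) <=
      (C' * k.+1%:R) ^+ 2 * L2_ip mu (zone k) w w.
    apply: ip_zone_le => //; first by move=> x Ox; rewrite normrM ler_wpM2r// bdk.
    by move=> x Ox nz; have [_ ->] := one x Ox nz; rewrite mul0r.
  have h3 : ip (fun x => eta x * (dws m i x - dw i x)) (fun x => eta x * (dws m i x - dw i x)) <=
      C' ^+ 2 * dist2 (dws m i) (dw i).
    apply: ip_mul_le => //; first exact: sqintB.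
    by move=> x Ox; rewrite normrM ler_wpM2r// (le_trans _ CC')//; have [] := bd x Ox.
  have h4 : ip (fun x => (eta x - 1) * dw i x) (fun x => (eta x - 1) * dw i x) <=
      C' ^+ 2 * L2_ip mu (zone k) (dw i) (dw i).
    apply: ip_zone_le => //; first by move=> x Ox; rewrite normrM ler_wpM2r// eta1.
    by move=> x Ox nz; have [-> _] := one x Ox nz; rewrite subrr mul0r.
  have a1 : dist2 (ws m) w <= A by rewrite AE; exact: hd_le0.
  have a2 : dist2 (dws m i) (dw i) <= A by rewrite AE; exact: hd_led.
  have a3 : k.+1%:R ^+ 2 * dist2 (ws m) w <= k.+1%:R ^+ 2 * A by rewrite ler_wpM2l ?sqr_ge0.
  have a4 := szdw i.
  have a5 : (k.+1%:R ^+ 2 * dist2 (ws m) w + k.+1%:R ^+ 2 * L2_ip mu (zone k) w w) +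
      (dist2 (dws m i) (dw i) + L2_ip mu (zone k) (dw i) (dw i)) <= 2 * G by rewrite GE; lra.
  have a6 := ler_wpM2l (sqr_ge0 C') a5.
  have a7 : 0 <= C' ^+ 2 * G by rewrite mulr_ge0// sqr_ge0.
  rewrite exprMn -mulrA in h1; rewrite exprMn -mulrA in h2; rewrite !mulrDr in a6.
  have {}hp : ip p p <= _ := hp; have {}hq : ip q q <= _ := hq.
  lra.
pose f := ext0 Om (fun x => ws m x * eta x).
pose df i := ext0 Om (fun x => ws m x * partial i eta x + eta x * dws m i x).
exists f, df; split; first by apply: C1c_mul => //.
have -> : hd Om f df w dw = dist2 (fun x => ws m x * eta x) w +
    \sum_i dist2 (fun x => ws m x * partial i eta x + eta x * dws m i x) (dw i).
  by congr (_ + _); [|apply: eq_bigr => i _]; apply: eq_ip => x Ox; rewrite /f /df !ext0E.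
have -> : e = K * (k.+1%:R ^+ 2 * (e / 2 / K / k.+1%:R ^+ 2) + e / 2 / K).
  by field; rewrite (gt_eqF K0) gt_eqF// exprn_gt0.
have GK : G <= k.+1%:R ^+ 2 * (e / 2 / K / k.+1%:R ^+ 2) + e / 2 / K.
  by rewrite GE lerD//; [rewrite AE ler_pM2l// exprn_gt0|rewrite ZE].
apply: (@le_trans _ _ (K * G)); last by rewrite ler_pM2l.
have -> : K * G = 16 * C' ^+ 2 * G + \sum_(i < n.+1) (16 * C' ^+ 2 * G).
  by rewrite sumr_const card_ord -mulr_natl /K; ring.
by rewrite lerD// ler_sum.
Qed.

End trace_zero.

(** * The boundary value problem *)

Section truncated_power.
Context {R : realType}.
Variables (theta m0 : R).
Hypotheses (theta0 : 0 <= theta) (m00 : 0 < m0).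
Implicit Types s t : R.

Lemma is_derive_powR_gt0 (p t : R) : 0 < t -> is_derive t (1 : R) (fun x => x `^ p) (p * t `^ (p - 1)).
Proof. exact: is_derive1_powR. Qed.

Lemma mvt_interval (p dp : R -> R) s t : s <= t ->
  (forall x, s <= x -> x <= t -> is_derive x (1 : R) p (dp x)) ->
  exists2 x, s <= x <= t & p t - p s = dp x * (t - s).
Proof.
move=> st pdp.
have [x||x xst ->] := @MVT_segment _ p dp s t st.
- by rewrite in_itv/= => /andP[/ltW sx /ltW xt]; exact: pdp.
- apply/continuous_in_subspaceT => x; rewrite inE/= in_itv/= => /andP[sx xt].
  by apply: differentiable_continuous; apply/derivable1_diffP; have [] := pdp x sx xt.
- by exists x => //; move: xst; rewrite in_itv.
Qed.

Lemma powRN_nincr (p x y : R) : 0 <= p -> 0 < x -> x <= y -> y `^ (- p) <= x `^ (- p).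
Proof.
move=> p0 x0 xy; have y0 := lt_le_trans x0 xy.
by rewrite !powRN lef_pV2 ?posrE ?powR_gt0//; apply: ge0_ler_powR; rewrite ?nnegrE// ltW.
Qed.

Definition tpow t : R := (Num.max t m0) `^ (- theta).

Let max_gt0 t : 0 < Num.max t m0. Proof. by rewrite lt_max m00 orbT. Qed.

Let max_le s t : s <= t -> Num.max s m0 <= Num.max t m0.
Proof. by move=> st; rewrite ge_max !le_max st lexx/= orbT. Qed.

Let max_ge t : m0 <= Num.max t m0. Proof. by rewrite le_max lexx orbT. Qed.

Lemma tpow_nincr s t : s <= t -> tpow t <= tpow s.
Proof. by move=> st; apply: powRN_nincr => //; exact: max_le. Qed.

Lemma tpow_range t : 0 <= tpow t <= m0 `^ (- theta).
Proof. by rewrite powR_ge0/=; apply: powRN_nincr. Qed.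

Let L := theta * m0 `^ (- (theta + 1)).

Let max_diff s t : s <= t -> Num.max t m0 - Num.max s m0 <= t - s.
Proof.
move=> st; rewrite lerBlDl ge_max; apply/andP; split.
  by rewrite -lerBlDr opprB addrCA subrr addr0 le_max lexx.
by rewrite (le_trans (max_ge s))// lerDl subr_ge0.
Qed.

Lemma tpow_lip s t : `|tpow t - tpow s| <= L * `|t - s|.
Proof.
wlog st : s t / s <= t.
  by move=> H; have [/H//|/ltW/H] := leP s t; rewrite distrC (distrC s).
have [x /andP[sx xt] E] := mvt_interval (p := fun x => x `^ (- theta)) (max_le st)
  (fun x sx _ => is_derive_powR_gt0 (- theta) (lt_le_trans (max_gt0 s) sx)).
have x0 := lt_le_trans (max_gt0 s) sx.
rewrite /tpow E normrM ler_pM//; last first.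
  by rewrite !ger0_norm ?subr_ge0 ?max_le// max_diff.
rewrite normrM normrN (ger0_norm theta0) ler_wpM2l// ger0_norm ?powR_ge0//.
rewrite -opprD; apply: powRN_nincr => //; first by rewrite addr_ge0.
exact: le_trans (max_ge s) sx.
Qed.

(** Above [m0] an antiderivative of the power, continued below [m0] by its tangent line. The lower
    bound is concavity, since [tpow] decreases; the upper one combines it with [tpow_lip]. *)
Lemma tpow_primitive : exists K : R -> R,
  forall s t, 0 <= K s + tpow s * (t - s) - K t <= L * (t - s) ^+ 2.
Proof.
(* The antiderivative is logarithmic exactly when [theta = 1]. *)
have [P hP] : exists P : R -> R, forall t, 0 < t -> is_derive t (1 : R) P (t `^ (- theta)).
  have [->|t1] := eqVneq theta 1.
    by exists (@ln R) => t t0; rewrite powR_inv1 ?ltW//; exact: is_derive1_ln.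
  have t1' : 1 - theta != 0 by rewrite subr_eq0 eq_sym.
  exists (fun t => (1 - theta)^-1 * t `^ (1 - theta)) => t t0.
  have h := is_deriveZ (1 - theta)^-1 (is_derive_powR_gt0 (1 - theta) t0).
  apply: (is_derive_eq h); rewrite /GRing.scale/= mulKf//; congr powR; ring.
pose K t := P (Num.max t m0) + m0 `^ (- theta) * (t - Num.max t m0).
(* The increment splits into a part above [m0], handled by the mean value theorem, and a part below,
   where the slope is constant. *)
have key s t : s <= t -> tpow t * (t - s) <= K t - K s <= tpow s * (t - s).
  move=> st; have h := max_le st; have hd := max_diff st.
  have [x /andP[sx xt] E] := mvt_interval (p := P) h (fun x sx _ => hP x (lt_le_trans (max_gt0 s) sx)).
  have x0 := lt_le_trans (max_gt0 s) sx.
  have k1 : tpow t <= x `^ (- theta) by exact: powRN_nincr.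
  have k2 : x `^ (- theta) <= tpow s by exact: powRN_nincr.
  have -> : K t - K s = x `^ (- theta) * (Num.max t m0 - Num.max s m0) +
      m0 `^ (- theta) * ((t - s) - (Num.max t m0 - Num.max s m0)) by rewrite -E /K; ring.
  have /andP[_ k3] := tpow_range t.
  move: E k1 k2 h hd; set D := Num.max t m0 - Num.max s m0 => E k1 k2 h hd.
  have D0 : 0 <= D by rewrite subr_ge0.
  have ts0 : 0 <= t - s - D by rewrite subr_ge0.
  have e y : y * (t - s) = y * D + y * (t - s - D) by ring.
  rewrite !e; apply/andP; split; first by apply: lerD; rewrite ler_wpM2r.
  apply: lerD; first by rewrite ler_wpM2r.
  have [sm|/ltW ms] := leP s m0; first by rewrite /tpow (max_r sm).
  have -> : t - s - D = 0; last by rewrite !mulr0.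
  by rewrite /D (max_l ms) (max_l (le_trans ms st)) subrr.
exists K => s t; have [st|/ltW ts] := leP s t.
  have /andP[h1 h2] := key s t st; have := tpow_lip s t.
  rewrite ler0_norm ?subr_le0 ?tpow_nincr// ger0_norm ?subr_ge0// => h3.
  have := ler_wpM2r (_ : 0 <= t - s) h3; rewrite subr_ge0 => /(_ st).
  by rewrite -mulrA -expr2; nra.
have /andP[h1 h2] := key t s ts; have := tpow_lip s t.
rewrite ger0_norm ?subr_ge0 ?tpow_nincr// ler0_norm ?subr_le0// => h3.
have := ler_wpM2r (_ : 0 <= s - t) h3; rewrite subr_ge0 => /(_ ts).
by rewrite opprB -mulrA -expr2 -(sqrrN (s - t)) opprB; nra.
Qed.

Lemma tpowE t : m0 <= t -> tpow t = t `^ (- theta).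
Proof. by move=> mt; rewrite /tpow max_l. Qed.

End truncated_power.

Lemma powR_normM {R : realType} (theta t : R) : 0 < t -> `|t| `^ (- (1 + theta)) * t = t `^ (- theta).
Proof.
move=> t0; rewrite gtr0_norm// -[X in _ * X](powRr1 (ltW t0)) -powRD; last first.
  by apply/implyP => _; rewrite gt_eqF.
by congr powR; ring.
Qed.

(** * Functions of class C^1 up to the boundary *)

Section C1_closure_functions.
Context {R : realType} {n : nat}.
Variables (Om : set 'rV[R]_n.+1).
Hypotheses (oOm : open Om) (bOm : bounded_set Om).
Implicit Types (u v : 'rV[R]_n.+1 -> R).

Local Notation mu := (leb n.+1).

Lemma C1_closureP u : C1_closure Om u -> exists du, C1_cl Om u du.
Proof.
move=> [cu h]; have /choice[du hdu] : forall i, exists v, {within closure Om, continuous v} /\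
    forall x, Om x -> is_derive x (e_ i) u (v x).
  by move=> i; have [v] := h i; exists v.
by exists du; split => // i; [have [] := hdu i|move=> x; have [_] := hdu i; exact].
Qed.

Lemma C1_cl_closure u du : C1_cl Om u du -> C1_closure Om u.
Proof. by move=> [cu cdu udu]; split => // i; exists (du i) => //; exact: udu. Qed.

Lemma C1_cl_comb (k : R) u du v dv : C1_cl Om u du -> C1_cl Om v dv ->
  C1_cl Om (fun x => u x + k * v x) (fun i x => du i x + k * dv i x).
Proof.
move=> [cu cdu udu] [cv cdv vdv].
have ck : {within closure Om, continuous (fun=> k)} by exact: continuous_cst.
split.
- exact: (continuous_add cu (continuous_mul ck cv)).
- by move=> i; exact: (continuous_add (cdu i) (continuous_mul ck (cdv i))).
- by move=> i x Ox; have := vdv i x Ox; have := udu i x Ox => h1 h2; apply: is_deriveD; exact: is_deriveZ.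
Qed.

Lemma within_closure_at u x : {within closure Om, continuous u} -> Om x -> {for x, continuous u}.
Proof.
move=> cu Ox; have : {within Om, continuous u} by apply: continuous_subspaceW cu; exact: subset_closure.
by rewrite continuous_open_subspace// => /(_ x); rewrite inE; exact.
Qed.

Lemma C1_cl_C1_on u du : C1_cl Om u du -> C1_on Om u du.
Proof.
move=> [cu cdu udu] x Ox; split; first exact: within_closure_at.
by move=> i; split; [exact: udu|apply: within_closure_at].
Qed.

Lemma sqint_within_closure u : {within closure Om, continuous u} -> sqint mu Om u.
Proof.
move=> cu; have [M M0 hM] := continuous_within_bounded (compact_closure_rV bOm) cu.
apply: (@sqint_continuous_bounded _ _ _ oOm bOm M); first by move=> x Ox; exact: within_closure_at.
by move=> x Ox; apply: hM; exact: subset_closure.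
Qed.

Lemma C1_cl_sob u du : C1_cl Om u du -> sob Om u du.
Proof.
move=> uC; have [cu cdu udu] := uC.
apply: sob_C1 => //; [exact: C1_cl_C1_on|exact: sqint_within_closure|].
by move=> i; exact: sqint_within_closure.
Qed.

Lemma continuous_within_post (p : R -> R) u : (forall x, closure Om x -> {for u x, continuous p}) ->
  {within closure Om, continuous u} -> {within closure Om, continuous (fun x => p (u x))}.
Proof.
move=> cp /subspace_continuousP cu; apply/subspace_continuousP => x Ox.
exact: (cvg_comp _ _ (cu x Ox) (cp x Ox)).
Qed.

Lemma C1_cl_powR u du (p : R) : C1_cl Om u du -> (forall x, closure Om x -> 0 < u x) ->
  C1_cl Om (fun x => u x `^ p) (fun i x => p * u x `^ (p - 1) * du i x).
Proof.
move=> [cu cdu udu] u0.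
have cpow (q t : R) : 0 < t -> {for t, continuous (fun x => x `^ q)}.
  move=> t0; apply: differentiable_continuous; apply/derivable1_diffP.
  by have [] := is_derive_powR_gt0 q t0.
have cw (q : R) : {within closure Om, continuous (fun x => u x `^ q)}.
  by apply: (continuous_within_post (p := fun t => t `^ q)) => // x Ox; apply: cpow; exact: u0.
have cp : {within closure Om, continuous (fun=> p)} by exact: continuous_cst.
split.
- exact: cw.
- by move=> i; exact: (continuous_mul (continuous_mul cp (cw _)) (cdu i)).
- move=> i x Ox; apply: (is_derive_comp_rV (p := fun t => t `^ p)); last exact: udu.
  by apply: is_derive_powR_gt0; apply: u0; exact: subset_closure.
Qed.

End C1_closure_functions.

(** * Existence and uniqueness for the boundary value problem *)

Section boundary_value_problem.
Context {R : realType} {n : nat}.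
Variables (Om : set 'rV[R]_n.+1).
Hypotheses (oOm : open Om) (bOm : bounded_set Om).
Variables (a b c h : 'rV[R]_n.+1 -> R) (dh : 'I_n.+1 -> 'rV[R]_n.+1 -> R).
Variables (K0 K1 La B C m1 theta : R).
Hypotheses (K00 : 0 < K0) (ma : measurable_fun Om (a : 'rV[R]_n.+1 -> measurableTypeR R)).
Hypothesis aK : forall x, Om x -> K0 <= a x <= K1.
Hypotheses (La0 : 0 <= La) (aL : forall x y, Om x -> Om y -> `|a x - a y| <= La * `|x - y|).
Hypotheses (mb : measurable_fun Om (b : 'rV[R]_n.+1 -> measurableTypeR R))
  (mc : measurable_fun Om (c : 'rV[R]_n.+1 -> measurableTypeR R)).
Hypotheses (B0 : 0 <= B) (C0 : 0 <= C).
Hypothesis bB : \forall x \ae leb n.+1, Om x -> 0 <= b x <= B.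
Hypothesis cC : \forall x \ae leb n.+1, Om x -> - C <= c x <= 0.
Hypothesis theta0 : 0 <= theta.
Hypotheses (hC : C1_cl Om h dh) (m10 : 0 < m1) (hm : forall x, Om x -> m1 <= h x).

Local Notation mu := (leb n.+1).
Local Notation sq := (sqint mu Om).
Local Notation ip := (L2_ip mu Om).
Local Notation dist2 := (dist2 mu Om).
Let mO : measurable Om := measurable_Om oOm.

Let F (Psi : 'rV[R]_n.+1 -> R) x := b x * Psi x + c x * (`|Psi x| `^ (- (1 + theta)) * Psi x).

Let measurable_F Psi : sq Psi -> measurable_fun Om (F Psi : 'rV[R]_n.+1 -> measurableTypeR R).
Proof.
move=> [mP _]; apply: measurable_funD; first exact: measurable_funM.
apply: measurable_funM => //; apply: measurable_funM => //.
apply: (measurableT_comp (measurable_powR _)).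
by apply: measurableT_comp mP.
Qed.

Lemma Rintegral_energy du df : (forall i, sq (du i)) -> (forall i, sq (df i)) ->
  \int[mu]_(x in Om) (a x * \sum_i du i x * df i x) = energy Om a du df.
Proof.
move=> su sf; have si i : sq (fun x => a x * du i x) by exact: (sq_a oOm K00 ma aK).
rewrite /energy /L2_ip /Rintegral.
under eq_integral do rewrite mulr_sumr.
under eq_integral do under eq_bigr do rewrite mulrA.
under eq_integral do rewrite -sumEFin.
rewrite integral_sum//; last by move=> i; exact: sqintM_integrable.
rewrite -[RHS]/(fine (\sum_i fine (\int[mu]_(x in Om) (a x * du i x * df i x)%:E))%:E); congr fine.
rewrite -sumEFin; apply: eq_bigr => i _; rewrite fineK//.
by apply: integrable_fin_num => //; exact: sqintM_integrable.
Qed.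

Lemma energy_ae du du' df df' : (forall i, sq (du i)) -> (forall i, sq (df i)) ->
  (forall i, sq (du' i)) -> (forall i, sq (df' i)) ->
  (forall i, \forall x \ae mu, Om x -> du i x = du' i x) ->
  (forall i, \forall x \ae mu, Om x -> df i x = df' i x) ->
  energy Om a du df = energy Om a du' df'.
Proof.
move=> su sf su' sf' uu ff; apply: eq_bigr => i _.
apply: ip_ae_eq => //; try exact: (sq_a oOm K00 ma aK).
by apply: filterS2 (uu i) (ff i) => x hu hf Ox; rewrite hu// hf.
Qed.

Lemma positive_weak_solution_exists : exists Psi, positive_weak_solution Om a b c h theta Psi.
Proof.
have hs := C1_cl_sob oOm bOm hC; have hC1 := C1_cl_C1_on oOm hC.
have sh := sob_sq hs; have sdh i := sob_sqd i hs.
(* The subsolution precedes the truncation: it is built from [a], [B] and [m1], and its lower bound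
   [m0] becomes the truncation level. *)
have [v [dv [m0 [m00 vC vm [V vV] vsub]]]] := subsolution oOm bOm K00 ma aK aL ord0 La0 B0 m10.
have [K hK] := tpow_primitive theta0 m00.
have kM t : `|tpow theta m0 t| <= m0 `^ (- theta).
  by have /andP[k0 k1] := tpow_range theta0 m00 t; rewrite ger0_norm.
have kL := tpow_lip theta0 m00.
have [w [dw [w0 weq]]] := weak_solution_exists oOm bOm K00 ma aK mb mc bB cC kM kL hK B0 C0 ord0 hs.
have ws := sob0_sob w0; have sw := sob_sq ws; have sdw i := sob_sqd i ws.
pose Psi x := h x + w x; pose dPsi i x := dh i x + dw i x.
have Ps : sob Om Psi dPsi by exact: sobD.
have sP := sob_sq Ps; have sdP i := sob_sqd i Ps.
have sv : sq v.
  apply: (@sqint_continuous_bounded _ _ _ oOm bOm m1); first by move=> x /vC[].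
  by move=> x Ox; have /andP[v0 v1] := vm x Ox; rewrite ger0_norm// (le_trans (ltW m00)).
have sdv i : sq (dv i).
  apply: (@sqint_continuous_bounded _ _ _ oOm bOm V); last by move=> x; exact: vV.
  by move=> x /vC[_ /(_ i)[]].
have vPsi : \forall x \ae mu, Om x -> v x <= Psi x.
  apply: (subsolution_le oOm bOm K00 ma aK mb mc bB cC (tpow_range theta0 m00) kL hs hC1 w0 _ vC sv sdv _ m00 vsub).
    by move=> f df fC; apply: weq; exact: C1c_sob0.
  move=> x Ox; have /andP[v0 v1] := vm x Ox.
  by rewrite (le_trans (ltW m00))//= (le_trans v1)// hm.
have Psim : \forall x \ae mu, Om x -> m0 <= Psi x.
  by apply: filterS vPsi => x hx Ox; rewrite (le_trans _ (hx Ox))//; have /andP[] := vm x Ox.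
exists Psi; split.
- exact: sob_H1 Ps.
- by apply: filterS Psim => x hx Ox; apply: lt_le_trans (hx Ox).
- split.
    move=> x0 r i s gamma ch; apply: continuous_measurable_rV; first exact: chart_domain_open ch.
    by apply: (continuous_graph_point ch); case: hC.
  have [phis [tp cp cdp]] := sob0_ip_limit w0.
  (* These approximations agree with [h] on the graph of every chart, because test functions vanish
     outside [Om]; the boundary integrals are therefore [0]. *)
  pose u m x := h x + 1 * phis m x; pose du m i x := dh i x + 1 * partial i (phis m) x.
  have uC m : C1_cl Om (u m) (du m).
    apply: C1_cl_comb => //; have [cf ff cdf _] := test_function_C1c (tp m).
    split => [|i|i x _]; [exact: continuous_subspaceT|exact: continuous_subspaceT|exact: ff].
  exists u; split.
  + by move=> m; exact: C1_cl_closure (uC m).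
  + apply/(@H1_dist2_cvgP _ _ _ oOm bOm u du Psi dPsi) => //.
      by move=> m; exact: C1_cl_sob.
    apply: cvgL2_hd => [|i].
      have E m : dist2 (u m) Psi = dist2 (phis m) w by apply: eq_ip => x _; rewrite /u /Psi; ring.
      by rewrite /cvgL2; under eq_fun do rewrite E; exact: cp.
    have E m : dist2 (du m i) (dPsi i) = dist2 (partial i (phis m)) (dw i).
      by apply: eq_ip => x _; rewrite /du /dPsi; ring.
    by rewrite /cvgL2; under eq_fun do rewrite E; exact: cdp.
  + move=> x0 r i s gamma ch; apply: cvg_near_cst; apply: nearW => m.
    rewrite /chart_integral2; apply: integral0_eq => y dy.
    have [_ nO] := graph_boundary ch dy.
    by rewrite /= /u (C1c_out (test_function_C1c (tp m)) nO) mulr0 addr0 subrr expr0n mul0r.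
- move=> phi phiH; have p0 := H10_sob0 oOm bOm phiH.
  have ps := sob0_sob p0; have sp := sob_sq ps; have sdp i := sob_sqd i ps.
  have sR : sq (reaction b c (tpow theta m0) Psi).
    exact: (sq_reaction oOm bOm mb mc bB cC kM kL sP).
  (* Since [Psi >= m0] almost everywhere, the truncated and the original powers coincide. *)
  have FR : \forall x \ae mu, Om x -> F Psi x * phi x = reaction b c (tpow theta m0) Psi x * phi x.
    apply: filterS Psim => x hx Ox; congr (_ * _); rewrite /F /reaction.
    by rewrite powR_normM ?(lt_le_trans m00 (hx Ox))// tpowE// hx.
  have mFp : measurable_fun Om (fun x => F Psi x * phi x).
    by apply: measurable_funM; [exact: measurable_F|have [] := sp].
  have iR := sqintM_integrable mO sR sp.
  have iF : mu.-integrable Om (fun x => (F Psi x * phi x)%:E).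
    apply/integrableP; split; first exact/measurable_EFinP.
    rewrite (ae_eq_integral (fun x => `|(reaction b c (tpow theta m0) Psi x * phi x)%:E|%E))//.
    + by have /integrableP[] := iR.
    + by apply: measurableT_comp => //; apply/measurable_EFinP.
    + by apply: measurableT_comp => //; apply/measurable_EFinP; exact: sqintM_measurable sR sp.
    + by apply: filterS FR => x hx Ox; rewrite hx.
  split => //.
  have H1P := H1_sob (sob_H1 Ps); have sdP' i := sob_sqd i H1P.
  have Ee := Rintegral_energy sdP' sdp; rewrite Ee {Ee}.
  have aeP i : \forall x \ae mu, Om x -> wD Om i Psi x = dPsi i x := sob_wD oOm bOm i Ps.
  have aep i : \forall x \ae mu, Om x -> wD Om i phi x = wD Om i phi x by exact: aeW.
  rewrite (energy_ae sdP' sdp sdP sdp aeP aep).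
  have := weq _ _ p0; rewrite /weak_form => /eqP; rewrite addr_eq0 => /eqP ->; congr (- _).
  rewrite /L2_ip /Rintegral; congr fine; apply: ae_eq_integral => //.
  + by apply/measurable_EFinP; exact: sqintM_measurable sR sp.
  + exact/measurable_EFinP.
  + by apply: filterS FR => x hx Ox; rewrite hx.
Qed.

(** Integrates the pointwise bound [(p - q)^2 <= 2 (p - z)^2 + 2 (q - z)^2], so that two sequences
    with the same boundary limit have a difference tending to [0]. *)
Lemma chart_integral2_sub x0 r i s gamma u v : C2_chart Om x0 r i s gamma ->
  {within closure Om, continuous u} -> {within closure Om, continuous v} -> boundary_measurable Om h ->
  (chart_integral2 x0 r i gamma (fun x => u x - v x)%R <=
   2%:E * chart_integral2 x0 r i gamma (u \- h)%R + 2%:E * chart_integral2 x0 r i gamma (v \- h)%R)%E.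
Proof.
move=> ch cu cv mh.
pose D := chart_domain x0 r i gamma; have oD : open D := chart_domain_open ch.
have mD : measurable D by exact: open_measurable_rV.
pose A := @area_element R n.+1 gamma; have A0 y : 0 <= A y by exact: sqrtr_ge0.
have mA : measurable_fun D (A : 'rV[R]_n -> measurableTypeR R).
  by apply: continuous_measurable_rV => // y _; exact: (chart_area_continuous ch).
have mg w : {within closure Om, continuous w} ->
    measurable_fun D (w \o graph_point i gamma : 'rV[R]_n -> measurableTypeR R).
  by move=> cw; apply: (continuous_measurable_rV oD); exact: (continuous_graph_point ch cw).
have mf (p q : 'rV[R]_n -> R) : measurable_fun D (p : _ -> measurableTypeR R) ->
    measurable_fun D (q : _ -> measurableTypeR R) ->
    measurable_fun D (fun y => ((p y - q y) ^+ 2 * A y)%:E).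
  by move=> mp mq; apply/measurable_EFinP; apply: measurable_funM => //; apply: measurable_funX; exact: measurable_funB.
have m1' := mf _ _ (mg u cu) (mh _ _ _ _ _ ch); have m2' := mf _ _ (mg v cv) (mh _ _ _ _ _ ch).
have m3' := mf _ _ (mg u cu) (mg v cv).
have g0 (p q : 'rV[R]_n -> R) y : (0 <= ((p y - q y) ^+ 2 * A y)%:E)%E by rewrite lee_fin mulr_ge0// sqr_ge0.
have -> : (2%:E * chart_integral2 x0 r i gamma (u \- h)%R = \int[leb n]_(y in D)
    (2%:E * ((u (graph_point i gamma y) - h (graph_point i gamma y)) ^+ 2 * A y)%:E))%E.
  by rewrite ge0_integralZl_EFin// => y _; exact: (g0 (u \o graph_point i gamma) (h \o graph_point i gamma)).
have -> : (2%:E * chart_integral2 x0 r i gamma (v \- h)%R = \int[leb n]_(y in D)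
    (2%:E * ((v (graph_point i gamma y) - h (graph_point i gamma y)) ^+ 2 * A y)%:E))%E.
  by rewrite ge0_integralZl_EFin// => y _; exact: (g0 (v \o graph_point i gamma) (h \o graph_point i gamma)).
rewrite -ge0_integralD//; first last.
- by apply: measurable_funeM.
- by move=> y _; rewrite mule_ge0//; exact: (g0 (v \o graph_point i gamma) (h \o graph_point i gamma)).
- by apply: measurable_funeM.
- by move=> y _; rewrite mule_ge0//; exact: (g0 (u \o graph_point i gamma) (h \o graph_point i gamma)).
apply: ge0_le_integral => //.
- by move=> y _; exact: (g0 (u \o graph_point i gamma) (v \o graph_point i gamma)).
- by apply: emeasurable_funD; apply: measurable_funeM.
move=> y _; rewrite -!EFinM -EFinD lee_fin !mulrA -mulrDl ler_wpM2r//.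
set p := u _; set q := v _; set z := h _.
by have := sqr_ge0 ((p - z) + (q - z)); nra.
Qed.

(** Replaces [wD] of the test function by any explicit weak gradient, since the two agree almost
    everywhere. *)
Lemma positive_weak_solution_sob Psi : positive_weak_solution Om a b c h theta Psi ->
  exists dPsi, sob Om Psi dPsi /\ forall phi dphi, sob0 Om phi dphi ->
    mu.-integrable Om (fun x => (F Psi x * phi x)%:E) /\
    energy Om a dPsi dphi = - \int[mu]_(x in Om) (F Psi x * phi x).
Proof.
move=> [H1P _ _ Peq]; have Ps := H1_sob H1P; have sdP i := sob_sqd i Ps.
exists (wD Om ^~ Psi); split; first exact: Ps.
move=> phi dphi p0; have ps := sob0_sob p0; have sdp i := sob_sqd i ps.
have [iF <-] := Peq phi (sob0_H10 oOm bOm p0); split; first exact: iF.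
have sdp' i := sob_sqd i (H1_sob (sob_H1 ps)).
have Ee := Rintegral_energy sdP sdp'; rewrite Ee {Ee}.
have aeP i : \forall x \ae mu, Om x -> wD Om i Psi x = wD Om i Psi x by exact: aeW.
have aep i : \forall x \ae mu, Om x -> wD Om i phi x = dphi i x := sob_wD oOm bOm i ps.
by rewrite (energy_ae sdP sdp' sdP sdp aeP aep).
Qed.

Hypothesis bdOm : C2_boundary Om.

(** The differences of the two approximating sequences tend to [0] on the boundary in every chart,
    which is the input of [trace_zero_sob0]. *)
Lemma same_trace_sob0 Psi dPsi Psi' dPsi' : sob Om Psi dPsi -> sob Om Psi' dPsi' ->
  has_trace Om Psi h -> has_trace Om Psi' h ->
  sob0 Om (fun x => Psi' x - Psi x) (fun i x => dPsi' i x - dPsi i x).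
Proof.
move=> sP sP' [mh [us [usC cus tus]]] [_ [us' [usC' cus' tus']]].
have /choice[dus dusC] : forall m, exists du, C1_cl Om (us m) du by move=> m; exact: C1_closureP.
have /choice[dus' dusC'] : forall m, exists du, C1_cl Om (us' m) du by move=> m; exact: C1_closureP.
pose w x := Psi' x - Psi x; pose dw i x := dPsi' i x - dPsi i x.
have ws : sob Om w dw by exact: sobB.
have sw := sob_sq ws; have sdw i := sob_sqd i ws.
pose W m x := us' m x + -1 * us m x; pose dW m i x := dus' m i x + -1 * dus m i x.
have WC m : C1_cl Om (W m) (dW m) by exact: C1_cl_comb.
have Ws m : sob Om (W m) (dW m) by exact: C1_cl_sob.
have uss m : sob Om (us m) (dus m) by exact: C1_cl_sob.
have uss' m : sob Om (us' m) (dus' m) by exact: C1_cl_sob.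
have h1 := proj1 (H1_dist2_cvgP oOm bOm uss sP) cus.
have h2 := proj1 (H1_dist2_cvgP oOm bOm uss' sP') cus'.
have dB p q p' q' : sq p -> sq q -> sq p' -> sq q' ->
    dist2 (fun x => p' x + -1 * p x) (fun x => q' x - q x) <= 2 * dist2 p' q' + 2 * dist2 p q.
  move=> sp sq_ sp' sq'.
  have -> : dist2 (fun x => p' x + -1 * p x) (fun x => q' x - q x) =
      ip (fun x => (p' x - q' x) + (q x - p x)) (fun x => (p' x - q' x) + (q x - p x)).
    by apply: eq_ip => x _; ring.
  by rewrite (dist2C _ _ p); apply: ip_sqrD_le => //; exact: sqintB.
have hW : hd Om (W m) (dW m) w dw @[m --> \oo] --> (0 : R).
  apply: (@cvg0_le _ _ (fun m => hd Om (us' m) (dus' m) Psi' dPsi' + hd Om (us m) (dus m) Psi dPsi) 2).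
  - by move=> m; exact: hd_ge0.
  - move=> m; rewrite /hd addrACA mulrDr; apply: lerD.
      by rewrite mulrDr; apply: dB; [exact: sob_sq (uss m)|exact: sob_sq sP|exact: sob_sq (uss' m)|exact: sob_sq sP'].
    rewrite -big_split mulr_sumr /=; apply: ler_sum => i _; rewrite mulrDr.
    by apply: dB; [exact: sob_sqd (uss m)|exact: sob_sqd sP|exact: sob_sqd (uss' m)|exact: sob_sqd sP'].
  - by have h3 := cvgD h2 h1; rewrite addr0 in h3; exact: h3.
have tW x0 r i s gamma : C2_chart Om x0 r i s gamma ->
    chart_integral2 x0 r i gamma (W m) @[m --> \oo] --> 0%E.
  move=> ch; have t1 := tus _ _ _ _ _ ch; have t2 := tus' _ _ _ _ _ ch.
  apply: (@squeeze_cvge _ _ _ _ (fun=> 0%E) _ (fun m => 2%:E * chart_integral2 x0 r i gamma (us' m \- h)%R +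
    2%:E * chart_integral2 x0 r i gamma (us m \- h)%R)%E).
  - apply: nearW => m; apply/andP; split.
      by apply: integral_ge0 => y _; rewrite lee_fin mulr_ge0 ?sqr_ge0// sqrtr_ge0.
    have -> : W m = fun x => us' m x - us m x by apply/funext => x; rewrite /W mulN1r.
    by apply: (chart_integral2_sub ch) => //; [case: (usC' m)|case: (usC m)].
  - exact: cvg_cst.
  - rewrite -[X in _ --> X]adde0 -[X in _ --> (X + X)%E](mule0 2%:E).
    by apply: cvgeD => //; apply: cvgeZl.
apply: (trace_zero_sob0 oOm bOm bdOm WC Ws ws hW tW) => m.
exact: C1_cl_C1_on.
Qed.

Lemma positive_weak_solution_unique Psi Psi' :
  positive_weak_solution Om a b c h theta Psi -> positive_weak_solution Om a b c h theta Psi' ->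
  \forall x \ae mu, Om x -> Psi' x = Psi x.
Proof.
move=> SP SP'; have [_ P0 tP _] := SP; have [_ P0' tP' _] := SP'.
have [dP [sP eP]] := positive_weak_solution_sob SP.
have [dP' [sP' eP']] := positive_weak_solution_sob SP'.
pose w x := Psi' x - Psi x; pose dw i x := dP' i x - dP i x.
have w0 : sob0 Om w dw by exact: same_trace_sob0.
have ws := sob0_sob w0; have sw := sob_sq ws; have sdw i := sob_sqd i ws.
have [iF E] := eP _ _ w0; have [iF' E'] := eP' _ _ w0.
have sPd i := sob_sqd i sP; have sPd' i := sob_sqd i sP'.
have energy_w : energy Om a dw dw <= 0.
  have -> : energy Om a dw dw = energy Om a dP' dw - energy Om a dP dw.
    rewrite -mulN1r -(energyZl oOm K00 ma aK)// -(energyDl oOm K00 ma aK)//; last by move=> i; exact: sqintZ.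
    by congr energy; apply/funext => i; apply/funext => x; rewrite /dw mulN1r.
  rewrite E E' opprK addrC subr_le0 -subr_ge0 -RintegralB//.
  apply: Rintegral_ae_ge0 => //.
    by apply: measurable_funB; apply/measurable_EFinP; [have /integrableP[] := iF'|have /integrableP[] := iF].
  apply: filterS2 (filterI P0 P0') (filterI bB cC) => x [p0 p0'] [hb hc] Ox.
  have q0 := p0 Ox; have q0' := p0' Ox; have /andP[b0 _] := hb Ox; have /andP[_ c0] := hc Ox.
  rewrite /F !powR_normM//.
  (* Both terms are nonnegative: the negative power is nonincreasing, so the product of increments
     is nonpositive, and so is [c]. *)
  have -> : (b x * Psi' x + c x * Psi' x `^ (- theta)) * w x - (b x * Psi x + c x * Psi x `^ (- theta)) * w x =
    b x * (w x) ^+ 2 + c x * ((Psi' x `^ (- theta) - Psi x `^ (- theta)) * (Psi' x - Psi x)) by rewrite /w; ring.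
  apply: addr_ge0; first by rewrite mulr_ge0// sqr_ge0.
  rewrite mulr_le0//.
  have [pp|/ltW pp] := leP (Psi x) (Psi' x).
    by rewrite mulr_le0_ge0// ?subr_le0 ?subr_ge0// powRN_nincr.
  by rewrite mulr_ge0_le0// ?subr_ge0 ?subr_le0// powRN_nincr.
have [P hP0 hP] := poincare oOm bOm (ord0 : 'I_n.+1).
have sum0 : \sum_i ip (dw i) (dw i) <= 0.
  by rewrite -(pmulr_rle0 _ K00) (le_trans _ energy_w)// (energy_ge oOm K00 ma aK).
have ww0 : ip w w = 0.
  apply/eqP; rewrite eq_le ip_ge0 andbT (le_trans (hP _ _ w0))// pmulr_rle0//.
apply: filterS (ip_eq0 mO sw ww0) => x hx Ox; apply/eqP; rewrite -subr_eq0; apply/eqP; exact: hx.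
Qed.

End boundary_value_problem.

Lemma lipschitz_within_continuous {R : realType} {n : nat} (A : set 'rV[R]_n) (a : 'rV[R]_n -> R) (L : R) :
  (forall x y, A x -> A y -> `|a x - a y| <= L * `|x - y|) -> {within A, continuous a}.
Proof.
move=> aL; apply/subspace_continuousP => x Ax; apply/cvgrPdist_le => e e0.
have L1 : 0 < `|L| + 1 by rewrite ltr_wpDl.
have h : \forall y \near x, `|x - y| <= e / (`|L| + 1).
  by apply: (@cvgr_dist_le _ _ _ (nbhs x) _ id x); [exact: cvg_id|rewrite divr_gt0].
apply: filterS h => y xy Ay; rewrite (le_trans (aL _ _ Ax Ay))//.
apply: (@le_trans _ _ ((`|L| + 1) * `|x - y|)).
  by rewrite ler_wpM2r// (le_trans (ler_norm L))// lerDl.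
by rewrite mulrC -ler_pdivlMr.
Qed.

Theorem proposition3p5 (R : realType) (d : nat) (hd : d = 2%N \/ d = 3%N)
  (Omega : set 'rV[R]_d) (hdom : domain Omega) (hbnd : bounded_set Omega)
  (hsc : simply_connected Omega) (hC2 : C2_boundary Omega)
  (K0 K1 : R) (hK0 : 0 < K0) (hK1 : 0 < K1)
  (a : 'rV[R]_d -> R) (ha : [lipschitz a x | x in closure Omega])
  (haK : forall x, closure Omega x -> K0 < a x < K1)
  (sigma : 'rV[R]_d -> R) (hsigma : Linfty Omega sigma)
  (hsigmaK : \forall x \ae leb d, Omega x -> K0 < sigma x < K1)
  (g : 'rV[R]_d -> R) (hg : C1_closure Omega g)
  (hgK : forall x, closure Omega x -> K0 < g x < K1)
  (theta : R) (htheta1 : theta != -1) (mu : R)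
  (c : 'rV[R]_d -> R) (hc : Linfty Omega c)
  (b : 'rV[R]_d -> R)
  (hb : b = fun x => - (2 / (1 + theta)) * mu * sigma x)
  (htheta : 0 <= theta)
  (hb0 : \forall x \ae leb d, Omega x -> 0 <= b x)
  (hc0 : \forall x \ae leb d, Omega x -> c x <= 0) :
  let h := fun x => g x `^ (2 / (1 + theta)) in
  exists Psi : 'rV[R]_d -> R,
    positive_weak_solution Omega a b c h theta Psi /\
    forall Psi' : 'rV[R]_d -> R,
      positive_weak_solution Omega a b c h theta Psi' ->
      \forall x \ae leb d, Omega x -> Psi' x = Psi x.
Proof.
move=> h; have [oO _ _] := hdom.
(* The dimension becomes [n.+1], so that the coordinate [ord0] is available for the Poincare
   inequality and for the exponential subsolution. *)
case: d hd Omega hdom hbnd hsc hC2 a ha haK sigma hsigma hsigmaK g hg hgK c hc b hb hb0 hc0 @h oO => [[]//|n] _ Om.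
move=> _ bO _ bdO a ha haK sigma [msig _] sigK g hg hgK c [mc [M cM]] b bE b0 c0 h oO.
have p0 : 0 < 1 + theta by rewrite ltr_wpDr.
have [dg gC] := C1_closureP hg.
have g0 x : closure Om x -> 0 < g x by move=> /hgK/andP[/(lt_trans hK0)].
have hC := C1_cl_powR (2 / (1 + theta)) gC g0.
have [La La0 aL] : exists2 La : R, 0 <= La & forall x y, closure Om x -> closure Om y -> `|a x - a y| <= La * `|x - y|.
  have [La La0 aL] := pinfty_ex_gt0 ha; exists La; first exact: ltW.
  by move=> x y clx cly; exact: (aL (x, y)).
have aL' x y : Om x -> Om y -> `|a x - a y| <= La * `|x - y|.
  by move=> Ox Oy; apply: aL; exact: subset_closure.
have ma : measurable_fun Om (a : 'rV[R]_n.+1 -> measurableTypeR R).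
  by apply: within_closure_measurable => //; exact: lipschitz_within_continuous aL.
have aK x : Om x -> K0 <= a x <= K1.
  by move=> Ox; have /andP[/ltW -> /ltW ->] := haK x (subset_closure Ox).
have mb : measurable_fun Om (b : 'rV[R]_n.+1 -> measurableTypeR R).
  by rewrite bE; apply: measurable_funM => //; exact: measurable_cst.
(* [b] is a constant multiple of [sigma], which lies below [K1] almost everywhere. *)
pose B := `|- (2 / (1 + theta)) * mu| * K1.
have B0 : 0 <= B by rewrite mulr_ge0// ltW.
have bB : \forall x \ae leb n.+1, Om x -> 0 <= b x <= B.
  apply: filterS2 b0 sigK => x hb hs Ox; rewrite hb//= bE.
  have /andP[s0 s1] := hs Ox.
  rewrite (le_trans (ler_norm _))// normrM ler_wpM2l// gtr0_norm ?ltW//.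
  exact: lt_trans s0.
have cC : \forall x \ae leb n.+1, Om x -> - `|M| <= c x <= 0.
  apply: filterS2 c0 cM => x hc hM Ox; rewrite hc// andbT.
  have := hM Ox; rewrite ler_norml => /andP[h1 _].
  by rewrite (le_trans _ h1)// lerN2 ler_norm.
(* Lower bound for the boundary datum: the exponent is positive, so the power preserves [K0 < g]. *)
have m10 : 0 < K0 `^ (2 / (1 + theta)) by exact: powR_gt0.
have hm x : Om x -> K0 `^ (2 / (1 + theta)) <= h x.
  move=> Ox; have /andP[g1 _] := hgK x (subset_closure Ox).
  by rewrite /h ge0_ler_powR ?nnegrE ?divr_ge0 ?(ltW hK0) ?(ltW p0) ?(ltW g1)// ltW// (lt_trans hK0).
have [Psi PsiS] := positive_weak_solution_exists oO bO hK0 ma aK La0 aL' mb mc B0 (normr_ge0 M) bB cC htheta hC m10 hm.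
exists Psi; split => // Psi' PsiS'.
exact: (positive_weak_solution_unique oO bO hK0 ma aK bB cC htheta bdO PsiS PsiS').
Qed.
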